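(* Let $d$ be a positive square-free integer such that $K=\mathbb{Q}(\sqrt d)$ is a real quadratic number field, with totally positive fundamental unit $\varepsilon=\frac{a+b\sqrt d}{2}\in\mathcal{O}_{K,+}^\times$, $a,b\in\mathbb{N}$, such that $\mathbb{Z}+\mathbb{Z}\varepsilon=\mathcal{O}_K$. Let $\mathfrak{f}=(u+v\sqrt d)$ be a non-zero principal integral ideal of $\mathcal{O}_K$. Then there exist $g=g(\mathfrak{f})\in\mathbb{N}$ and $(x,y)\in\mathbb{Q}^2$ such that Shintani's invariant $X(\mathfrak{f})$ is given by $$X(\mathfrak{f})=\lim_{n\to\infty}\left|\frac{(x,y;\tau_{n-g})_\infty}{(x,y;\tau_{n+g})_\infty}\cdot\frac{(x,y;\tau_{-n-g})_\infty}{(x,y;\tau_{-n+g})_\infty}\right|,$$ where $n$ runs through the integers, $\tau_n=\frac{T_{n+1}(a)+i\,b\sqrt d}{T_n(a)}$ for $n\in\mathbb{Z}$, and $$(x,y;\tau)_\infty=\prod_{k\ge 0}\left(1-e^{2\pi i(x\tau+y)}e^{2\pi i k\tau}\right)\qquad(\mathrm{Im}(\tau)>0).$$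
   Context: Notation. $\mathcal{O}_K$ is the ring of integers of $K$, and $\mathcal{O}_{K,+}^\times$ is the group of totally positive units; the totally positive fundamental unit $\varepsilon$ is its generator with $a,b\in\mathbb{N}$ (so $\varepsilon>1$). $\varepsilon'=\varepsilon^{-1}$ denotes the Galois conjugate of $\varepsilon$. The polynomials $T_n$ ($n\in\mathbb{Z}$) are the normalized Chebyshev polynomials of the first kind, defined by $T_n(X+X^{-1})=X^n+X^{-n}$; thus $T_n(a)=\varepsilon^n+\varepsilon^{-n}$. $g(\mathfrak{f})$ is the smallest positive integer such that $\varepsilon^{g(\mathfrak{f})}$ generates the group $\mathcal{O}_{K,+}^\times\cap(1+\mathfrak{f})$. Double sine function: for $\omega>0$ and $0<z<1+\omega$, $$\mathcal{S}(\omega,z)=\exp\left(\zeta_2'(0,1+\omega-z,\omega)-\zeta_2'(0,z,\omega)\right),$$ where $\zeta_2(s,z,\omega)=\sum_{n_1,n_2=0}^\infty(n_1+n_2\omega+z)^{-s}$ (analytically continued in $s$), and $'$ means the derivative with respect to $s$. Shintani's invariant (for the trivial ray class of conductor $\mathfrak{f}$): put $\mu=\frac{1}{u+v\sqrt d}\in K^\times$. For each $k\in\mathbb{Z}$ there is a unique pair $(x_k,y_k)\in\mathbb{Q}^2$ with $0<x_k\le 1$, $0\le y_k<1$ and $x_k\varepsilon^{1-k}+y_k\varepsilon^{-k}\in\mu+\mathcal{O}_K$. Then $$X(\mathfrak{f})=X_1(\mathfrak{f})X_2(\mathfrak{f}),\quad X_1(\mathfrak{f})=\prod_{k=1}^{g(\mathfrak{f})}\mathcal{S}(\varepsilon,x_k\varepsilon+y_k),\quad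 X_2(\mathfrak{f})=\prod_{k=1}^{g(\mathfrak{f})}\mathcal{S}(\varepsilon',x_k\varepsilon'+y_k).$$ *)

(* Defs.v *)
From mathcomp Require Import all_boot all_order all_algebra.
From mathcomp Require Import complex.
From mathcomp Require Import all_classical all_reals all_analysis.
From mathcomp Require Import ring.

Set Implicit Arguments.
Unset Strict Implicit.
Unset Printing Implicit Defensive.

Import Order.TTheory GRing.Theory Num.Theory.
Import numFieldNormedType.Exports.

Local Open Scope classical_set_scope.
Local Open Scope ring_scope.
Local Open Scope complex_scope.

Definition squarefree (d : nat) : Prop :=
  forall m : nat, (m ^ 2 %| d)%N -> m = 1%N.

(* K = Q(sqrt d) is realized as a subfield of R. *)
Definition quad (R : realType) (d : nat) (p q : rat) : R :=
  ratr p + ratr q * Num.sqrt d%:R.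

Definition quad_field (R : realType) (d : nat) : set R :=
  [set x | exists p q : rat, x = quad R d p q].

Definition quad_integers (R : realType) (d : nat) : set R :=
  [set x | quad_field d x /\ integralOver (intr : int -> R) x].

(* [quad R d p (- q)] is the Galois conjugate of [quad R d p q]. *)
Definition totally_positive (R : realType) (d : nat) (x : R) : Prop :=
  exists p q : rat,
    [/\ x = quad R d p q, 0 < quad R d p q & 0 < quad R d p (- q)].

Definition totpos_units (R : realType) (d : nat) : set R :=
  [set x | [/\ quad_integers d x, quad_integers d x^-1
             & totally_positive d x]].

Definition mul_generates (R : realType) (x : R) (G : set R) : Prop :=
  G = range (fun n : int => x ^ n).

Definition unit_eps (R : realType) (d a b : nat) : R :=
  (a%:R + b%:R * Num.sqrt d%:R) / 2.

Definition principal_ideal (R : realType) (d : nat) (beta : R) : set R :=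
  [set beta * z | z in quad_integers d].

Definition congr1_units (R : realType) (d : nat) (f : set R) : set R :=
  totpos_units d `&` [set 1 + z | z in f].

Definition is_unit_index (R : realType) (d : nat) (eps : R) (f : set R)
    (g : nat) : Prop :=
  [/\ (0 < g)%N, mul_generates (eps ^+ g) (congr1_units d f)
    & forall h : nat, (0 < h)%N ->
        mul_generates (eps ^+ h) (congr1_units d f) -> (g <= h)%N].

Definition unit_index (R : realType) (d : nat) (eps : R) (f : set R) : nat :=
  xget 0%N [set g | is_unit_index d eps f g].

Fixpoint chebn2 (n : nat) : {poly int} * {poly int} :=
  if n is m.+1 then
    let: (p, q) := chebn2 m in (q, 'X * q - p)
  else (2%:P, 'X).

(* The n-th normalized Chebyshev polynomial of the first kind; see
   [chebTE] for its defining property. *)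
Definition chebT (n : int) : {poly int} := (chebn2 `|n|%N).1.

Lemma chebn2E (F : fieldType) (n : nat) (x : F) : x != 0 ->
  (map_poly intr (chebn2 n).1).[x + x^-1] = x ^+ n + x ^- n /\
  (map_poly intr (chebn2 n).2).[x + x^-1] = x ^+ n.+1 + x ^- n.+1.
Proof.
move=> x0; elim: n => [|n] /=.
  by rewrite map_polyC map_polyX hornerC hornerX expr0 invr1 expr1.
case: (chebn2 n) => p q /= [IHp IHq]; split=> //.
rewrite rmorphB rmorphM /= map_polyX !hornerE IHp IHq.
by rewrite !exprS; field; rewrite expf_neq0.
Qed.

Lemma chebTE (F : fieldType) (n : int) (x : F) : x != 0 ->
  (map_poly intr (chebT n)).[x + x^-1] = x ^ n + x ^ (- n).
Proof.
move=> x0; rewrite /chebT; case: n => n.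
  by rewrite absz_nat (chebn2E n x0).1 exprnN.
by rewrite NegzE abszN absz_nat (chebn2E _ x0).1 opprK -exprnN -exprnP addrC.
Qed.

(* Limits of complex sequences are taken in [R[i]^o], which carries the
   topology of the modulus. *)
Definition cexp (R : realType) (z : R[i]) : R[i] :=
  (expR (complex.Re z))%:C * (cos (complex.Im z) +i* sin (complex.Im z)).

(* [r ^ s] for a positive real [r] and a complex exponent [s]. *)
Definition cpow (R : realType) (r : R) (s : R[i]) : R[i] :=
  cexp (s * (ln r)%:C).

(* The double series converges absolutely for [2 < Re s], so that it may be
   summed along squares. *)
Definition barnes_partial (R : realType) (z w : R) (s : R[i]) (N : nat)
    : R[i] :=
  \sum_(n1 < N) \sum_(n2 < N) cpow (n1%:R + n2%:R * w + z) (- s).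

Definition analytic_at (R : realType) (f : R[i] -> R[i]) (s0 : R[i]) : Prop :=
  exists (r : R) (c : nat -> R[i]), 0 < r /\
    forall h : R[i], `|h| < r%:C ->
      (fun N : nat => \sum_(k < N) c k * h ^+ k : R[i]^o) @ \oo
        --> (f (s0 + h) : R[i]^o).

(* The analytic continuation of the double series lives on C minus {1, 2}; by
   the identity theorem it is unique there. *)
Definition is_barnes_zeta2 (R : realType) (z w : R) (Z : R[i] -> R[i])
    : Prop :=
  (forall s : R[i], 2 < complex.Re s ->
     (barnes_partial z w s : nat -> R[i]^o) @ \oo --> (Z s : R[i]^o)) /\
  (forall s : R[i], s != 1 -> s != 2 -> analytic_at Z s).

Definition barnes_zeta2 (R : realType) (z w : R) : R[i] -> R[i] :=
  xget (fun _ : R[i] => 0) [set Z | is_barnes_zeta2 z w Z].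

Definition barnes_zeta2_deriv0 (R : realType) (z w : R) : R[i] :=
  derive1 (barnes_zeta2 z w : R[i] -> R[i]^o) 0.

Definition double_sine (R : realType) (w z : R) : R[i] :=
  cexp (barnes_zeta2_deriv0 (1 + w - z) w - barnes_zeta2_deriv0 z w).

Definition is_shintani_pair (R : realType) (d : nat) (eps mu : R) (k : int)
    (p : rat * rat) : Prop :=
  [/\ 0 < p.1 <= 1, 0 <= p.2 < 1
    & [set mu + z | z in quad_integers d]
        (ratr p.1 * eps ^ (1 - k) + ratr p.2 * eps ^ (- k))].

Definition shintani_pair (R : realType) (d : nat) (eps mu : R) (k : int)
    : rat * rat :=
  xget (0, 0) [set p | is_shintani_pair d eps mu k p].

(* [shintani_half d eps beta eps] is X_1 and [shintani_half d eps beta eps^-1]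
   is X_2, for the conductor generated by [beta]. *)
Definition shintani_half (R : realType) (d : nat) (eps beta w : R) : R[i] :=
  \prod_(1 <= k < (unit_index d eps (principal_ideal d beta)).+1)
    let p := shintani_pair d eps beta^-1 k%:Z in
    double_sine w (ratr p.1 * w + ratr p.2).

Definition shintani_X (R : realType) (d : nat) (eps beta : R) : R[i] :=
  shintani_half d eps beta eps * shintani_half d eps beta eps^-1.

Definition qpoch (R : realType) (x y : rat) (tau : R[i]) : R[i] :=
  let e (z : R[i]) := cexp ((0 +i* (2 * pi)) * z) in
  lim ((fun N : nat =>
    \prod_(k < N) (1 - e (ratr x * tau + ratr y) * e (k%:R * tau)) : R[i]^o)
      @ \oo).

Definition tau_seq (R : realType) (d a b : nat) (n : int) : R[i] :=
  ((chebT (n + 1)).[a%:Z]%:~R + (0 +i* (b%:R * Num.sqrt d%:R)))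
    / (chebT n).[a%:Z]%:~R.

(* Main.v *)
(* Both sides come from one regularised lattice sum. For Re tau > 0 let
   Psi_N(tau, w) be the sum of log((1 + tau)/2 + w + i + j tau) over the box
   0 <= i, j < N plus Euler-Maclaurin terms at its corners; it converges, locally
   uniformly in tau.
   For real tau = omega > 0 the same summation applied to powers continues the
   Barnes double zeta function, and gives -zeta_2'(0, (1 + omega)/2 + w, omega)
   as the limit of Psi_N(omega, w). Hence log S(omega, z), with
   z = (1 + omega)/2 + w, is the limit of Psi_N(omega, w) - Psi_N(omega, -w).
   For Im tau > 0 the upper half lattice sum of log|z + i + j tau| equals
   log|(x, y; tau)_oo| by Euler's sine product. Comparing this sum with the one
   for -1/tau, which is the same sum turned by a quarter, leaves
   Re(Psi(tau, w) - Psi(tau, -w)) up to a term vanishing on the real axis. So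
   |(x, y; tau)_oo / (1 - y, x + a y; a - 1/tau)_oo| tends to
   S(omega, x omega + y) as tau tends to omega.
   Now tau_{n+2} = a - 1/tau_n, the map (x, y) -> (1 - y, x + a y) modulo 1 sends
   Shintani's pair of index k + 1 to the one of index k, and these pairs are
   periodic of period g; hence the product over k telescopes. *)
Require Import Defs.
From mathcomp Require Import all_boot all_order all_algebra.
From mathcomp Require Import complex.
From mathcomp Require Import all_classical all_reals all_analysis.
From mathcomp Require Import ring lra zify.

Set Implicit Arguments.
Unset Strict Implicit.
Unset Printing Implicit Defensive.

Import Order.TTheory GRing.Theory Num.Theory.
Import numFieldNormedType.Exports.

Local Open Scope classical_set_scope.
Local Open Scope ring_scope.
Local Open Scope complex_scope.

(** Centring at [(1 + tau) / 2] turns the reflection [z -> 1 + tau - z] into [w -> - w], and makes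
    the difference operator of a lattice cell equal to [4 sinh(D/2) sinh(tau D/2)], which is even in
    [D]. Corner terms up to order 3 leave a remainder [O(|m| ^ -4)] in the cell of midpoint [m]. It
    sums over a quadrant with tail [O(1/N)], and the constants depend only on bounds for [tau],
    [1/tau] and [w]. This uniformity lets [tau] reach the real axis, outside the domain of the
    q-product. The obstacle is the branch of the logarithm: [Psi] uses the principal one on the
    right half-plane, the upper half lattice the one with argument in [[0, pi]]. The estimates are
    proved for any local branch, and the two are compared at the corners only. Continuing the zeta
    function takes corner terms of arbitrary order; at [s = 0] all but those of [Psi] vanish in the
    limit. The numbers [eps] and [eps^-1] are both fixed by [t -> a - 1/t], so one limit serves both
    halves of the invariant, at [n] and at [- n]. *)

Local Notation Re := complex.Re.
Local Notation Im := complex.Im.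

(** * The modulus, and limits of complex sequences *)

Section Modulus.
Context {R : realType}.
Implicit Types (x y z : R[i]) (r : R).

(* The norm of [R[i]] takes its values in [R[i]]; [md] is the same modulus as a
   real number. *)
Definition md x : R := Num.sqrt (Re x ^+ 2 + Im x ^+ 2).

Lemma normc_md x : `|x| = (md x)%:C.
Proof. by rewrite normc_def. Qed.

Lemma md_ge0 x : 0 <= md x.
Proof. exact: sqrtr_ge0. Qed.

Lemma sqr_md x : md x ^+ 2 = Re x ^+ 2 + Im x ^+ 2.
Proof. by rewrite sqr_sqrtr// addr_ge0// sqr_ge0. Qed.

Lemma mdM x y : md (x * y) = md x * md y.
Proof. by apply: complexI; rewrite rmorphM/= -!normc_md normrM. Qed.

Lemma md_real r : md r%:C = `|r|.
Proof. by rewrite /md/= expr0n/= addr0 sqrtr_sqr. Qed.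

Lemma md0 : md 0 = 0 :> R.
Proof. by rewrite -[0]/(0%:C) md_real normr0. Qed.

Lemma md1 : md 1 = 1 :> R.
Proof. by rewrite -[1]/(1%:C) md_real normr1. Qed.

Lemma md_eq0 x : (md x == 0) = (x == 0).
Proof. by rewrite -(inj_eq (@complexI _)) -normc_md normr_eq0. Qed.

Lemma md_gt0 x : (0 < md x) = (x != 0).
Proof. by rewrite lt0r md_eq0 md_ge0 andbT. Qed.

Lemma mdN x : md (- x) = md x.
Proof. by apply: complexI; rewrite -!normc_md normrN. Qed.

Lemma mdB x y : md (x - y) = md (y - x).
Proof. by rewrite -mdN opprB. Qed.

Lemma mdV x : md x^-1 = (md x)^-1.
Proof. by apply: complexI; rewrite fmorphV/= -!normc_md normfV. Qed.

Lemma mdX x n : md (x ^+ n) = md x ^+ n.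
Proof. by elim: n => [|n IH]; rewrite ?expr0 ?md1// !exprS mdM IH. Qed.

Lemma md_prod (I : Type) (s : seq I) (P : pred I) (F : I -> R[i]) :
  md (\prod_(i <- s | P i) F i) = \prod_(i <- s | P i) md (F i).
Proof.
by elim/big_rec2 : _ => [|i u v _ <-]; rewrite ?md1 ?mdM.
Qed.

Lemma ler_mdD x y : md (x + y) <= md x + md y.
Proof. by rewrite -lecR rmorphD/= -!normc_md ler_normD. Qed.

Lemma ler_mdB x y : md (x - y) <= md x + md y.
Proof. by rewrite (le_trans (ler_mdD _ _))// mdN. Qed.

Lemma lerB_md x y : md x - md y <= md (x - y).
Proof. by rewrite lerBlDr (le_trans _ (ler_mdD _ _))// subrK. Qed.

Lemma ler_dist_md x y : `|md x - md y| <= md (x - y).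
Proof. by rewrite ler_norml lerB_md andbT lerNl opprB mdB lerB_md. Qed.

Lemma ler_md_sum (I : Type) (s : seq I) (P : pred I) (F : I -> R[i]) :
  md (\sum_(i <- s | P i) F i) <= \sum_(i <- s | P i) md (F i).
Proof.
elim/big_rec2 : _ => [|i u v _ h]; rewrite ?md0//.
by rewrite (le_trans (ler_mdD _ _))// lerD2l.
Qed.

Lemma ler_Re_md x : `|Re x| <= md x.
Proof. by rewrite -lecR -normc_md normc_ge_Re. Qed.

Lemma ler_Im_md x : `|Im x| <= md x.
Proof.
rewrite -(ler_pXn2r (n := 2)) ?nnegrE ?md_ge0//.
by rewrite sqr_md real_normK ?num_real// lerDr sqr_ge0.
Qed.

Lemma ler_md_ReIm x : md x <= `|Re x| + `|Im x|.
Proof.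
have -> : x = (Re x)%:C + 'i%C * (Im x)%:C by exact: complexE.
apply: (le_trans (ler_mdD _ _)).
by rewrite mdM !md_real/= /md/= !(mul0r,mul1r,subr0,add0r,addr0) expr0n/= expr1n add0r sqrtr1 mul1r.
Qed.

Lemma md_lt_ltc x r : (`|x| < r%:C) = (md x < r).
Proof. by rewrite normc_md ltcR. Qed.

Lemma ReD x y : Re (x + y) = Re x + Re y. Proof. by case: x; case: y. Qed.
Lemma ImD x y : Im (x + y) = Im x + Im y. Proof. by case: x; case: y. Qed.
Lemma ReN x : Re (- x) = - Re x. Proof. by case: x. Qed.
Lemma ImN x : Im (- x) = - Im x. Proof. by case: x. Qed.
Lemma ReM x y : Re (x * y) = Re x * Re y - Im x * Im y.
Proof. by case: x; case: y. Qed.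
Lemma ImM x y : Im (x * y) = Re x * Im y + Im x * Re y.
Proof. by case: x; case: y. Qed.

Lemma Im0 : Im (0 : R[i]) = 0. Proof. by []. Qed.
Lemma Re1 : Re (1 : R[i]) = 1. Proof. by []. Qed.

Lemma Re_sum (I : Type) (s : seq I) (P : pred I) (F : I -> R[i]) :
  Re (\sum_(i <- s | P i) F i) = \sum_(i <- s | P i) Re (F i).
Proof. by elim/big_rec2 : _ => [|i u v _ <-]; rewrite ?ReD. Qed.
Lemma Im_sum (I : Type) (s : seq I) (P : pred I) (F : I -> R[i]) :
  Im (\sum_(i <- s | P i) F i) = \sum_(i <- s | P i) Im (F i).
Proof. by elim/big_rec2 : _ => [|i u v _ <-]; rewrite ?ImD. Qed.
Lemma natrC n : n%:R = (n%:R : R)%:C :> R[i].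
Proof. by rewrite rmorph_nat. Qed.
Lemma intrC (n : int) : n%:~R = (n%:~R : R)%:C :> R[i].
Proof. by rewrite rmorph_int. Qed.
Lemma Re_nat n : Re (n%:R : R[i]) = n%:R. Proof. by rewrite natrC. Qed.
Lemma Im_nat n : Im (n%:R : R[i]) = 0. Proof. by rewrite natrC. Qed.
Lemma md_nat n : md (n%:R : R[i]) = n%:R.
Proof. by rewrite natrC md_real ger0_norm. Qed.
Lemma ReMr r x : Re (r%:C * x) = r * Re x.
Proof. by rewrite ReM/= mul0r subr0. Qed.
Lemma ImMr r x : Im (r%:C * x) = r * Im x.
Proof. by rewrite ImM/= mul0r addr0. Qed.
Lemma ReV x : Re x^-1 = Re x / (Re x ^+ 2 + Im x ^+ 2).
Proof. by case: x. Qed.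
Lemma ImV x : Im x^-1 = - (Im x / (Re x ^+ 2 + Im x ^+ 2)).
Proof. by case: x => a b; rewrite /= -mulNr. Qed.
Lemma eqC x y : Re x = Re y -> Im x = Im y -> x = y.
Proof. by case: x y => [a b] [c d] /= -> ->. Qed.

Lemma cvg0_squeeze (u v : nat -> R) : (forall n, 0 <= u n <= v n) ->
  v @ \oo --> (0 : R) -> u @ \oo --> (0 : R).
Proof.
move=> h hv; apply: (@squeeze_cvgr _ _ _ _ (fun=> 0) v) => //.
- exact: nearW.
- exact: cvg_cst.
Qed.

Lemma ccvgP (u : nat -> R[i]) (l : R[i]) :
  ((u : nat -> R[i]^o) @ \oo --> (l : R[i]^o)) <->
  ((fun n => md (u n - l)) @ \oo --> (0 : R)).
Proof.
split.
  move=> /cvgrPdist_lt h; apply/cvgr0Pnorm_lt => e e0.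
  have := h e%:C; rewrite ltcR => /(_ e0).
  apply: filterS => n; rewrite md_lt_ltc ger0_norm ?md_ge0//.
  by rewrite mdB.
move=> /cvgr0Pnorm_lt h; apply/cvgrPdist_lt => e e0.
have eE : e = (Re e)%:C.
  by move: e0; rewrite ltcE => /andP[/eqP i0 _]; apply: eqC => //.
have : 0 < Re e by move: e0; rewrite eE ltcR.
move=> /h; apply: filterS => n; rewrite ger0_norm ?md_ge0// => H.
by rewrite eE md_lt_ltc mdB.
Qed.

Lemma ccvg_ReIm (u : nat -> R[i]) (l : R[i]) :
  (fun n => Re (u n)) @ \oo --> Re l -> (fun n => Im (u n)) @ \oo --> Im l ->
  (u : nat -> R[i]^o) @ \oo --> (l : R[i]^o).
Proof.
move=> hr hi; apply/ccvgP.
apply: (@cvg0_squeeze _ (fun n => `|Re (u n) - Re l| + `|Im (u n) - Im l|)).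
  move=> n; rewrite md_ge0/=.
  by rewrite (le_trans (ler_md_ReIm _))// ReD ReN ImD ImN.
rewrite -[0]addr0; apply: cvgD; apply/norm_cvg0P; exact/subr_cvg0.
Qed.

Lemma ccvg_Re (u : nat -> R[i]) (l : R[i]) :
  (u : nat -> R[i]^o) @ \oo --> (l : R[i]^o) ->
  (fun n => Re (u n)) @ \oo --> Re l.
Proof.
move=> /ccvgP h; apply/subr_cvg0/norm_cvg0P.
apply: cvg0_squeeze h => n.
by rewrite normr_ge0/= -ReN -ReD ler_Re_md.
Qed.

Lemma ccvg_md (u : nat -> R[i]) (l : R[i]) :
  (u : nat -> R[i]^o) @ \oo --> (l : R[i]^o) ->
  (fun n => md (u n)) @ \oo --> md l.
Proof.
move=> /ccvgP h; apply/subr_cvg0/norm_cvg0P.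
apply: cvg0_squeeze h => n.
by rewrite normr_ge0/= ler_dist_md.
Qed.

Lemma ccvg_real (u : nat -> R) (l : R) : u @ \oo --> l ->
  ((fun n => (u n)%:C) : nat -> R[i]^o) @ \oo --> (l%:C : R[i]^o).
Proof. by move=> h; apply: ccvg_ReIm => //=; exact: cvg_cst. Qed.

Lemma cvg_rate (u : nat -> R) (c : R) K0 :
  (forall K N, (K0 <= K)%N -> (K <= N)%N -> `|u N - u K| <= c / K.+1%:R) ->
  exists2 l, u @ \oo --> l &
    forall K, (K0 <= K)%N -> `|l - u K| <= c / K.+1%:R.
Proof.
move=> h.
have cz : (fun K => c / K.+1%:R) @ \oo --> (0 : R).
  rewrite -[0](mulr0 c); apply: cvgMr; exact: cvg_harmonic.
have cu : cvgn u.
  apply/cauchy_cvgP/cauchy_exP => e e0.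
  have /cvgr0Pnorm_lt/(_ _ e0)[K _ HK] := cz.
  exists (u (maxn K K0)); exists (maxn K K0) => //= n /= Kn.
  rewrite /ball/= distrC (le_lt_trans (h _ _ _ Kn)) ?leq_maxr//.
  by rewrite (le_lt_trans (ler_norm _))// HK//= leq_maxl.
exists (limn u) => // K KK.
have c1 : (fun N => `|u N - u K|) @ \oo --> `|limn u - u K|.
  by apply: cvg_norm; apply: cvgB => //; exact: cvg_cst.
rewrite -(cvg_lim _ c1)//; apply: limr_le; first by apply/cvg_ex; eexists; exact: c1.
by exists K => // N /= KN; exact: h.
Qed.

(** Real and imaginary parts are treated separately, whence the factor 2. *)
Lemma ccvg_rate (u : nat -> R[i]) (c : R) K0 :
  (forall K N, (K0 <= K)%N -> (K <= N)%N -> md (u N - u K) <= c / K.+1%:R) ->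
  exists2 l : R[i], (u : nat -> R[i]^o) @ \oo --> (l : R[i]^o) &
    forall K, (K0 <= K)%N -> md (l - u K) <= 2 * c / K.+1%:R.
Proof.
move=> h.
have [lr cr hr] : exists2 l, (fun n => Re (u n)) @ \oo --> l &
    forall K, (K0 <= K)%N -> `|l - Re (u K)| <= c / K.+1%:R.
  apply: cvg_rate => K N h1 h2; apply: le_trans (h _ _ h1 h2).
  by rewrite -ReN -ReD ler_Re_md.
have [li ci hi] : exists2 l, (fun n => Im (u n)) @ \oo --> l &
    forall K, (K0 <= K)%N -> `|l - Im (u K)| <= c / K.+1%:R.
  apply: cvg_rate => K N h1 h2; apply: le_trans (h _ _ h1 h2).
  by rewrite -ImN -ImD ler_Im_md.
exists (lr +i* li); first exact: ccvg_ReIm.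
move=> K K0K; apply: (le_trans (ler_md_ReIm _)).
rewrite ReD ImD ReN ImN/= -mulrA mulrDl !mul1r.
by apply: lerD; [exact: hr | exact: hi].
Qed.

Lemma ccvg_unique (u : nat -> R[i]) (l l' : R[i]) :
  (u : nat -> R[i]^o) @ \oo --> (l : R[i]^o) ->
  (u : nat -> R[i]^o) @ \oo --> (l' : R[i]^o) -> l = l'.
Proof. by move=> /cvg_lim <-// /cvg_lim <-. Qed.

Lemma ccvg_eps (u : nat -> R[i]) (l : R[i]) :
  (forall e : R, 0 < e -> \forall n \near \oo, md (u n - l) <= e) ->
  (u : nat -> R[i]^o) @ \oo --> (l : R[i]^o).
Proof.
move=> h; apply/ccvgP/cvgr0Pnorm_le => e /h; apply: filterS => n.
by rewrite ger0_norm ?md_ge0.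
Qed.

End Modulus.

(** * Complex-valued functions of a real variable *)

Section ComplexDerivative.
Context {R : realType}.
Implicit Types (f g : R -> R[i]) (x : R) (l : R[i]).

Lemma deriv_ext (f g : R -> R) x d : is_derive x 1 f d -> f =1 g ->
  is_derive x 1 g d.
Proof. by move=> h /funext <-. Qed.

(** Complex functions are only ever differentiated along real segments, so a componentwise
    derivative in a real variable is enough. *)
Definition cD f x l : Prop :=
  is_derive x 1 (fun y => Re (f y)) (Re l) /\
  is_derive x 1 (fun y => Im (f y)) (Im l).

Lemma cD_eq f x l l' : cD f x l -> l = l' -> cD f x l'.
Proof. by move=> ? <-. Qed.

Lemma cD_ext f g x l : cD f x l -> f =1 g -> cD g x l.
Proof. by move=> ? /funext <-. Qed.

Lemma cD_cst c x : cD (fun=> c) x 0.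
Proof. by split; exact: is_derive_cst. Qed.

Lemma cD_id x : cD (fun y => y%:C) x 1.
Proof. by split; [exact: is_derive_id | exact: is_derive_cst]. Qed.

Lemma cDD f g x l m : cD f x l -> cD g x m -> cD (fun y => f y + g y) x (l + m).
Proof.
move=> [f1 f2] [g1 g2]; split.
  rewrite ReD; apply: deriv_ext (is_deriveD f1 g1) _ => y; by rewrite ReD.
rewrite ImD; apply: deriv_ext (is_deriveD f2 g2) _ => y; by rewrite ImD.
Qed.

Lemma cDM f g x l m : cD f x l -> cD g x m ->
  cD (fun y => f y * g y) x (l * g x + f x * m).
Proof.
move=> [f1 f2] [g1 g2]; split.
  have H := is_deriveB (is_deriveM f1 g1) (is_deriveM f2 g2).
  apply: (@is_derive_eq _ _ _ _ _ _ _ _ (deriv_ext H _)).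
    by move=> y; rewrite ReM.
  by rewrite !(ReD, ReM) /GRing.scale/=; ring.
have H := is_deriveD (is_deriveM f1 g2) (is_deriveM f2 g1).
apply: (@is_derive_eq _ _ _ _ _ _ _ _ (deriv_ext H _)).
  by move=> y; rewrite ImM.
by rewrite !(ImD, ImM) /GRing.scale/=; ring.
Qed.

Lemma cDZ c f x l : cD f x l -> cD (fun y => c * f y) x (c * l).
Proof.
by move=> h; apply: cD_eq (cDM (cD_cst c x) h) _; rewrite mul0r add0r.
Qed.

Lemma cDN f x l : cD f x l -> cD (fun y => - f y) x (- l).
Proof.
move=> h; apply: cD_ext (cD_eq (cDZ (-1) h) _) _; first by rewrite mulN1r.
by move=> y; rewrite mulN1r.
Qed.

Lemma cDB f g x l m : cD f x l -> cD g x m -> cD (fun y => f y - g y) x (l - m).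
Proof. by move=> hf /cDN hg; exact: cDD. Qed.

Lemma cDV f x l : f x != 0 -> cD f x l -> cD (fun y => (f y)^-1) x (- l / f x ^+ 2).
Proof.
move=> f0 [f1 f2].
have n0 : Re (f x) ^+ 2 + Im (f x) ^+ 2 != 0.
  by rewrite -sqr_md sqrf_eq0 md_eq0.
have hn : is_derive x 1 (fun y => Re (f y) ^+ 2 + Im (f y) ^+ 2)
    (2 * (Re (f x) * Re l + Im (f x) * Im l)).
  have H := is_deriveD (is_deriveM f1 f1) (is_deriveM f2 f2).
  apply: (@is_derive_eq _ _ _ _ _ _ _ _ (deriv_ext H _)).
    by move=> y; rewrite /= !expr2.
  by rewrite /GRing.scale/=; ring.
have hv : is_derive x 1 (fun y => (Re (f y) ^+ 2 + Im (f y) ^+ 2)^-1)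
    (- (2 * (Re (f x) * Re l + Im (f x) * Im l)) / (Re (f x) ^+ 2 + Im (f x) ^+ 2) ^+ 2).
  have := @is_deriveV _ (fun y => Re (f y) ^+ 2 + Im (f y) ^+ 2) _ _ _ n0 hn; rewrite /GRing.scale/= => H.
  by apply: (@is_derive_eq _ _ _ _ _ _ _ _ H); rewrite !mulNr mulrC.
split.
  apply: (@is_derive_eq _ _ _ _ _ _ _ _ (deriv_ext (is_deriveM f1 hv) _)).
    by move=> y; rewrite /= ReV.
  rewrite [in RHS]mulNr ReN ReM expr2 ReV ImV ReM ImM /GRing.scale/=.
  have -> : (Re (f x) * Re (f x) - Im (f x) * Im (f x)) ^+ 2 +
    (Re (f x) * Im (f x) + Im (f x) * Re (f x)) ^+ 2 = (Re (f x) ^+ 2 + Im (f x) ^+ 2) ^+ 2 by ring.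
  by field.
apply: (@is_derive_eq _ _ _ _ _ _ _ _ (deriv_ext (is_deriveN (is_deriveM f2 hv)) _)).
  by move=> y; rewrite /= ImV.
rewrite [in RHS]mulNr ImN ImM expr2 ReV ImV ReM ImM /GRing.scale/=.
have -> : (Re (f x) * Re (f x) - Im (f x) * Im (f x)) ^+ 2 +
  (Re (f x) * Im (f x) + Im (f x) * Re (f x)) ^+ 2 = (Re (f x) ^+ 2 + Im (f x) ^+ 2) ^+ 2 by ring.
by field.
Qed.

Lemma cexp_md (z : R[i]) : md (cexp z) = expR (Re z).
Proof.
rewrite /cexp mdM md_real ger0_norm ?expR_ge0// /md/= cos2Dsin2 sqrtr1.
by rewrite mulr1.
Qed.

Lemma cexpD (z w : R[i]) : cexp (z + w) = cexp z * cexp w.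
Proof.
rewrite /cexp; apply: eqC; rewrite !(ReM, ImM, ReD, ImD)/= expRD cosD sinD; ring.
Qed.

Lemma cexp0 : cexp 0 = 1 :> R[i].
Proof. by rewrite /cexp/= expR0 cos0 sin0 mul1r. Qed.

Lemma cexp_neq0 (z : R[i]) : cexp z != 0.
Proof. by rewrite -md_eq0 cexp_md gt_eqF// expR_gt0. Qed.

Lemma cexpN (z : R[i]) : cexp (- z) = (cexp z)^-1.
Proof.
apply: (mulfI (cexp_neq0 z)); rewrite mulfV ?cexp_neq0//.
by rewrite -cexpD subrr cexp0.
Qed.

Lemma cexp_natmul (z : R[i]) n : cexp (n%:R * z) = cexp z ^+ n.
Proof.
elim: n => [|n IH]; first by rewrite mul0r cexp0 expr0.
by rewrite -natr1 mulrDl mul1r cexpD IH exprSr.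
Qed.

Lemma cexp_real (r : R) : cexp r%:C = (expR r)%:C.
Proof. by rewrite /cexp/= cos0 sin0 -[1 +i* 0]/(1%:C) mulr1. Qed.

Lemma cD_cexp f x l : cD f x l -> cD (fun y => cexp (f y)) x (l * cexp (f x)).
Proof.
move=> [f1 f2].
have he : is_derive x 1 (fun y => expR (Re (f y))) (Re l * expR (Re (f x))).
  have := @is_derive1_comp _ expR (fun y => Re (f y)) x _ _ (is_derive_expR _) f1.
  move=> h; apply: (@is_derive_eq _ _ _ _ _ _ _ _ h); by rewrite mulrC.
have hc : is_derive x 1 (fun y => cos (Im (f y))) (- sin (Im (f x)) * Im l).
  exact: (@is_derive1_comp _ (@cos R) (fun y => Im (f y)) x _ _ (is_derive_cos _) f2).
have hs : is_derive x 1 (fun y => sin (Im (f y))) (cos (Im (f x)) * Im l).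
  exact: (@is_derive1_comp _ (@sin R) (fun y => Im (f y)) x _ _ (is_derive_sin _) f2).
split.
  apply: (@is_derive_eq _ _ _ _ _ _ _ _ (deriv_ext (is_deriveM he hc) _)).
    by move=> y; rewrite /cexp ReMr.
  by rewrite /cexp ReM ReMr ImMr/= /GRing.scale/=; ring.
apply: (@is_derive_eq _ _ _ _ _ _ _ _ (deriv_ext (is_deriveM he hs) _)).
  by move=> y; rewrite /cexp ImMr.
by rewrite /cexp ImM ReMr ImMr/= /GRing.scale/=; ring.
Qed.

(* Principal logarithm; meaningful only for [0 < Re t]. *)
Definition cLn (t : R[i]) : R[i] :=
  (ln (Re t ^+ 2 + Im t ^+ 2) / 2) +i* atan (Im t / Re t).

Lemma cD_cLn f x l : 0 < Re (f x) -> cD f x l ->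
  cD (fun y => cLn (f y)) x (l / f x).
Proof.
move=> f0 [f1 f2].
have r0 : Re (f x) != 0 by rewrite gt_eqF.
have n0 : 0 < Re (f x) ^+ 2 + Im (f x) ^+ 2.
  by rewrite ltr_wpDr ?sqr_ge0// exprn_gt0.
have hn : is_derive x 1 (fun y => Re (f y) ^+ 2 + Im (f y) ^+ 2)
    (2 * (Re (f x) * Re l + Im (f x) * Im l)).
  have H := is_deriveD (is_deriveM f1 f1) (is_deriveM f2 f2).
  apply: (@is_derive_eq _ _ _ _ _ _ _ _ (deriv_ext H _)).
    by move=> y; rewrite /= !expr2.
  by rewrite /GRing.scale/=; ring.
have hl := @is_derive1_comp _ (@ln R) _ x _ _ (is_derive1_ln n0) hn.
have hq : is_derive x 1 (fun y => Im (f y) / Re (f y))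
    ((Im l * Re (f x) - Im (f x) * Re l) / Re (f x) ^+ 2).
  apply: (@is_derive_eq _ _ _ _ _ _ _ _ (is_deriveM f2 (is_deriveV r0 f1))).
  by rewrite /GRing.scale/=; field.
have ha := @is_derive1_comp _ (@atan R) _ x _ _ (is_derive1_atan _) hq.
split.
  have H := is_deriveM hl (is_derive_cst (2^-1 : R) x 1).
  apply: (@is_derive_eq _ _ _ _ _ _ _ _ (deriv_ext H _)).
    by move=> y; rewrite /cLn/=.
  by rewrite ReM ReV ImV /GRing.scale/=; field; rewrite gt_eqF.
apply: (@is_derive_eq _ _ _ _ _ _ _ _ ha).
rewrite ImM ReV ImV; field.
by rewrite r0 gt_eqF.
Qed.

Lemma cexp_cLn (t : R[i]) : 0 < Re t -> cexp (cLn t) = t.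
Proof.
move=> t0.
have n0 : 0 < Re t ^+ 2 + Im t ^+ 2.
  by rewrite ltr_wpDr ?sqr_ge0// exprn_gt0.
have ht := atanK (Im t / Re t).
have hc : cos (atan (Im t / Re t)) = Re t / md t.
  rewrite cos_atan.
  have -> : 1 + (Im t / Re t) ^+ 2 = (md t / Re t) ^+ 2.
    rewrite [in RHS]expr_div_n sqr_md; field; by rewrite gt_eqF.
  rewrite sqrtr_sqr ger0_norm ?divr_ge0 ?md_ge0 ?ltW//.
  by rewrite invf_div.
have hm : expR (ln (Re t ^+ 2 + Im t ^+ 2) / 2) = md t.
  apply: (@pexpIrn _ 2) => //; rewrite ?nnegrE ?expR_ge0 ?md_ge0//.
  rewrite -expRM_natl -mulr_natl mulrCA mulfV// mulr1 lnK//.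
  by rewrite sqr_md.
have m0 : md t != 0 by rewrite -sqrf_eq0 sqr_md gt_eqF.
have hs : sin (atan (Im t / Re t)) = Im t / md t.
  have c0 : cos (atan (Im t / Re t)) != 0.
    by rewrite hc mulf_neq0// ?invr_eq0// gt_eqF.
  move: ht; rewrite /tan => /(congr1 (fun u => u * cos (atan (Im t / Re t)))).
  rewrite divfK// => ->; rewrite hc; field; by rewrite m0 gt_eqF.
rewrite /cexp/= hm hc hs; apply: eqC; rewrite (ReMr, ImMr)/=; field => //.
Qed.

Lemma Re_cLn (t : R[i]) : t != 0 -> Re (cLn t) = ln (md t).
Proof.
move=> t0; rewrite /cLn/= -sqr_md lnXn ?md_gt0// -[_ *+ 2]mulr_natr mulfK//.
Qed.

(** With [v] the difference of the imaginary parts, [cos v = 1] forces [sin (|v| / 2) = 0], and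
    [|v| / 2 < pi] leaves only [v = 0]. The identities between branches of the logarithm are
    obtained from this: compare exponentials, then bound arguments. *)
Lemma cexp_inj (z w : R[i]) : cexp z = cexp w -> `|Im z - Im w| < 2 * pi -> z = w.
Proof.
move=> h hi.
have hr : Re z = Re w.
  by apply: expR_inj; rewrite -!cexp_md h.
have h1 : cexp (z - w) = 1 by rewrite cexpD cexpN h mulfV// cexp_neq0.
set v := Im z - Im w in hi.
have hc : cos v = 1.
  have := congr1 (@complex.Re R) h1; rewrite /cexp ReMr/= ReD ReN hr subrr expR0 mul1r.
  by rewrite ImD ImN.
apply: eqC => //; apply/eqP; rewrite -subr_eq0 -/v; apply/eqP.
have hv : cos `|v| = 1 by rewrite cos_norm.
have hs2 : cos (`|v| / 2) ^+ 2 = 1.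
  have := cos_mulr2n (`|v| / 2).
  have -> : (`|v| / 2) *+ 2 = `|v| by rewrite -mulr_natr; field.
  rewrite hv => H; lra.
have hs : sin (`|v| / 2) = 0.
  by apply/eqP; rewrite -sqrf_eq0 sin2cos2 hs2 subrr.
have [|v0] := eqVneq v 0; first by [].
have := @sin_gt0_pi R (`|v| / 2).
rewrite hs ltxx divr_gt0 ?normr_gt0//= => H.
suff : false by []; apply: H; lra.
Qed.

Lemma taylor_sum_deriv (c : nat -> R) n x :
  is_derive x 1 (fun y => \sum_(i < n) c i * y ^+ i.+1 / (i.+1)`!%:R)
    (\sum_(i < n) c i * x ^+ i / i`!%:R).
Proof.
elim: n => [|n IH].
  rewrite big_ord0; apply: (deriv_ext (is_derive_cst 0 x 1)) => y.
  by rewrite big_ord0.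
rewrite big_ord_recr/=.
have h : is_derive x 1 (fun y : R => c n / (n.+1)`!%:R * y ^+ n.+1) (c n * x ^+ n / n`!%:R).
  have := is_deriveZ (c n / (n.+1)`!%:R) (is_deriveX n.+1 (is_derive_id x (1 : R))).
  move=> H; apply: (@is_derive_eq _ _ _ _ _ _ _ _ (deriv_ext H _)).
    move=> y; congr (_ * _); elim: (n.+1) => [|m IHm]; first by rewrite !expr0.
    by rewrite !exprS -IHm.
  have E : ((id : R -> R) ^+ n) x = x ^+ n.
    by elim: (n) => [|m IHm]; rewrite ?expr0// !exprS -IHm.
  rewrite /GRing.scale/= ?E factS natrM; field.
  by rewrite pnatr_eq0 -lt0n fact_gt0/= nat1r pnatr_eq0.
apply: deriv_ext (is_deriveD IH h) _ => y.
by rewrite big_ord_recr/=; congr (_ + _); rewrite mulrAC.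
Qed.

(** Induction on the order: the remainder of [f 1] is bounded by [M], and the mean value theorem
    carries the bound over to [f 0]. The factor [1 / n!] is given away. *)
Lemma real_taylor_bound n (f : nat -> R -> R) (M : R) :
  (forall i x, (i < n)%N -> 0 <= x <= 1 -> is_derive x 1 (f i) (f i.+1 x)) ->
  (forall x, 0 <= x <= 1 -> `|f n x| <= M) ->
  forall x, 0 <= x <= 1 -> `|f 0%N x - \sum_(i < n) f i 0 * x ^+ i / i`!%:R| <= M.
Proof.
elim: n f => [|n IH] f hf hM x hx.
  by rewrite big_ord0 subr0; exact: hM.
pose F (y : R) := f 0%N y - \sum_(i < n.+1) f i 0 * y ^+ i / i`!%:R.
pose dF (y : R) := f 1%N y - \sum_(i < n) f i.+1 0 * y ^+ i / i`!%:R.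
have M0 : 0 <= M by apply: le_trans (hM 0 _); rewrite ?lexx ?ler01.
have hdF (y : R) : 0 <= y <= 1 -> `|dF y| <= M.
  apply: (IH (fun i => f i.+1)) => // i z hi hz; exact: hf.
have hF (y : R) : 0 <= y <= 1 -> is_derive y 1 F (dF y).
  move=> hy.
  have H := is_deriveB (hf 0%N y (ltn0Sn _) hy) (taylor_sum_deriv (fun i => f i.+1 0) n y).
  have := is_deriveB H (is_derive_cst (f 0%N 0) y 1); rewrite subr0 => H2.
  apply: deriv_ext H2 _ => z.
  rewrite /F big_ord_recl/= expr0 fact0 divr1 mulr1 /cst/=.
  by rewrite opprD addrA addrAC.
move: hx => /andP[x0 x1].
have cF : {within `[0, x], continuous F}.
  apply: derivable_within_continuous => y; rewrite in_itv/= => /andP[y0 yx].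
  by apply: ex_derive; apply: hF; rewrite y0 (le_trans yx).
have hF' (y : R) : y \in `]0, x[ -> is_derive y 1 F (dF y).
  rewrite in_itv/= => /andP[y0 yx]; apply: hF.
  by rewrite !ltW// (lt_le_trans yx).
have [c cI] := MVT_segment x0 hF' cF.
have F0 : F 0 = 0.
  rewrite /F big_ord_recl/= expr0 fact0 divr1 mulr1 big1 ?addr0 ?subrr// => i _.
  by rewrite expr0n/= mulr0 mul0r.
rewrite F0 subr0 subr0 -/(F x) => ->.
rewrite normrM (ger0_norm x0) -[leRHS]mulr1 ler_pM//.
apply: hdF; move: cI; rewrite in_itv/= => /andP[c0 cx].
by rewrite c0 (le_trans cx).
Qed.

(** The mean value theorem fails for complex values; the bound is applied to both components, at the
    price of a factor 2. *)
Lemma taylor_bound n (f : nat -> R -> R[i]) (M : R) :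
  (forall i x, (i < n)%N -> 0 <= x <= 1 -> cD (f i) x (f i.+1 x)) ->
  (forall x, 0 <= x <= 1 -> md (f n x) <= M) ->
  md (f 0%N 1 - \sum_(i < n) f i 0 / i`!%:R) <= 2 * M.
Proof.
move=> hf hM; apply: (le_trans (ler_md_ReIm _)).
have i01 : (0 : R) <= (1 : R) <= (1 : R) by rewrite ler01/= lexx.
have E (T : R[i] -> R) (TD : forall u v, T (u - v) = T u - T v)
    (TS : forall (F : 'I_n -> R[i]), T (\sum_i F i) = \sum_i T (F i))
    (TZ : forall r u, T (r%:C * u) = r * T u)
    (TM : forall u, `|T u| <= md u)
    (TC : forall i x, (i < n)%N -> 0 <= x <= 1 ->
       is_derive x 1 (fun y => T (f i y)) (T (f i.+1 x))) :
  `|T (f 0%N 1 - \sum_(i < n) f i 0 / i`!%:R)| <= M.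
  have := @real_taylor_bound n (fun i x => T (f i x)) M TC _ 1 i01.
  rewrite TD TS.
  under [in X in _ -> X]eq_bigr => i _.
    have -> : f i 0 / i`!%:R = (i`!%:R^-1 : R)%:C * f i 0.
      by rewrite mulrC natrC fmorphV.
    rewrite TZ mulrC; over.
  under [in X in X -> _]eq_bigr do rewrite expr1n mulr1.
  by apply=> x hx; rewrite (le_trans (TM _))// hM.
rewrite mulrDl mul1r; apply: lerD; apply: E.
- by move=> u v; rewrite ReD ReN.
- by move=> F; rewrite Re_sum.
- by move=> r u; rewrite ReMr.
- exact: ler_Re_md.
- by move=> i x hi hx; have [] := hf i x hi hx.
- by move=> u v; rewrite ImD ImN.
- by move=> F; rewrite Im_sum.
- by move=> r u; rewrite ImMr.
- exact: ler_Im_md.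
- by move=> i x hi hx; have [] := hf i x hi hx.
Qed.

End ComplexDerivative.

(** * Local Euler-Maclaurin correction of the logarithm *)

Section Branches.
Context {R : realType}.
Implicit Types (t a u m tau w l : R[i]).

(* The logarithm with imaginary part in [0, pi], for [0 <= Im t]. *)
Definition clog t : R[i] := (ln (md t)) +i* (acos (Re t / md t)).

Lemma Re_div_md t : t != 0 -> -1 <= Re t / md t <= 1.
Proof.
move=> t0; have := ler_Re_md t; rewrite ler_norml => /andP[h1 h2].
rewrite ler_pdivlMr ?md_gt0// ler_pdivrMr ?md_gt0// mulN1r mul1r.
by rewrite h1 h2.
Qed.

Lemma Im_clog t : t != 0 -> 0 <= Im (clog t) <= pi.
Proof. by move=> /Re_div_md h; rewrite /= acos_ge0// acos_lepi. Qed.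

Lemma cexp_clog t : t != 0 -> 0 <= Im t -> cexp (clog t) = t.
Proof.
move=> t0 it; have m0 : 0 < md t by rewrite md_gt0.
have h := Re_div_md t0.
rewrite /cexp/= lnK// acosK ?in_itv//= sin_acos//.
have -> : 1 - (Re t / md t) ^+ 2 = (Im t / md t) ^+ 2.
  have := sqr_md t; rewrite !expr_div_n => E.
  apply: (mulIf (x := md t ^+ 2)); first by rewrite sqrf_eq0 gt_eqF.
  by rewrite mulrBl !divfK ?sqrf_eq0 ?gt_eqF// E; ring.
rewrite sqrtr_sqr ger0_norm ?divr_ge0 ?md_ge0//.
by apply: eqC; rewrite (ReMr, ImMr)/=; field; rewrite gt_eqF.
Qed.

Lemma Im_cLn t : - (pi / 2) < Im (cLn t) < pi / 2.
Proof. by rewrite atan_gtNpi2 atan_ltpi2. Qed.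

Lemma clog_cLn t : 0 < Re t -> 0 <= Im t -> clog t = cLn t.
Proof.
move=> rt it.
have t0 : t != 0 by apply: contraTneq rt => ->; rewrite ltxx.
apply: cexp_inj; first by rewrite cexp_clog// cexp_cLn.
have /andP[h1 h2] := Im_clog t0; have /andP[h3 h4] := Im_cLn t.
have := @pi_gt0 R; rewrite ltr_norml => p0; apply/andP; split; lra.
Qed.

Lemma Re_1Dgt0 u : md u <= 1 / 2 -> 0 < Re (1 + u).
Proof.
move=> hu; rewrite ReD/=; have := ler_Re_md u; rewrite ler_norml => /andP[h _]; lra.
Qed.

Lemma md_div_half t a : t != 0 -> md a <= md t / 2 -> md (a / t) <= 1 / 2.
Proof.
by move=> t0 h; rewrite mdM mdV ler_pdivrMr ?md_gt0// mul1r mulrC.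
Qed.

(** No multiple of [2 pi i] intervenes: two arguments lie in [[0, pi]] and the third in []- pi/2,
    pi/2[], so the two sides differ by less than [3 pi / 2]. *)
Lemma clog_shift t a : t != 0 -> 0 <= Im t -> 0 <= Im (t + a) ->
  md a <= md t / 2 -> clog (t + a) = clog t + cLn (1 + a / t).
Proof.
move=> t0 it ita ha.
have h1 := Re_1Dgt0 (md_div_half t0 ha).
have ta0 : t + a != 0.
  have : 1 + a / t != 0 by apply: contraTneq h1 => ->; rewrite ltxx.
  apply: contra_neq => H.
  by apply: (mulfI t0); rewrite mulr0 mulrDr mulr1 mulrCA mulfV// mulr1.
apply: cexp_inj.
  rewrite cexpD !cexp_clog// cexp_cLn// mulrDr mulr1; field => //.
have /andP[h2 h3] := Im_clog ta0; have /andP[h4 h5] := Im_clog t0.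
have /andP[h6 h7] := Im_cLn (1 + a / t).
rewrite ImD; have := @pi_gt0 R; rewrite ltr_norml => p0; apply/andP; split; lra.
Qed.

Lemma cLn_shift t a : 0 < Re t -> 0 < Re (t + a) ->
  md a <= md t / 2 -> cLn (t + a) = cLn t + cLn (1 + a / t).
Proof.
move=> rt rta ha.
have t0 : t != 0 by apply: contraTneq rt => ->; rewrite ltxx.
have h1 := Re_1Dgt0 (md_div_half t0 ha).
apply: cexp_inj.
  rewrite cexpD !cexp_cLn// mulrDr mulr1; field => //.
have /andP[h2 h3] := Im_cLn (t + a); have /andP[h4 h5] := Im_cLn t.
have /andP[h6 h7] := Im_cLn (1 + a / t).
rewrite ImD; have := @pi_gt0 R; rewrite ltr_norml => p0; apply/andP; split; lra.
Qed.

(* With [l] a logarithm of [u]: a second primitive of the logarithm followed by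
   its successive derivatives, the logarithm itself having index 2. *)
Definition Elog l u (j : nat) : R[i] :=
  match j with
  | 0 => u ^+ 2 / 2 * l - 3 / 4 * u ^+ 2
  | 1 => u * l - u
  | 2 => l
  | 3 => u^-1
  | 4 => - u^-1 ^+ 2
  | 5 => 2 * u^-1 ^+ 3
  | _ => - 6 * u^-1 ^+ 4
  end.

(* Coefficients of [X^2 exp(w X) / (4 sinh(X/2) sinh(tau X/2))]. *)
Definition gam tau w (j : nat) : R[i] :=
  match j with
  | 0 => tau^-1
  | 1 => w / tau
  | 2 => (w ^+ 2 / 2 - (1 + tau ^+ 2) / 24) / tau
  | _ => (w ^+ 3 / 6 - w * (1 + tau ^+ 2) / 24) / tau
  end.

Definition Gp (L : R[i] -> R[i]) tau w u : R[i] :=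
  \sum_(j < 4) gam tau w j * Elog (L u) u j.

(* What is left of the logarithm at [u + w] after subtracting the second
   difference of the local correction [Gp], [u] being taken from the corner of
   its lattice cell. *)
Definition rho (L : R[i] -> R[i]) tau w u : R[i] :=
  L ((1 + tau) / 2 + w + u) -
    (Gp L tau w u - Gp L tau w (u + 1) - Gp L tau w (u + tau)
     + Gp L tau w (u + 1 + tau)).

Lemma cD_line m a (x : R) : cD (fun y => m + y%:C * a) x a.
Proof.
apply: cD_eq (cDD (cD_cst m x) (cDM (cD_id x) (cD_cst a x))) _; ring.
Qed.

(** The logarithm is continued along the segment from its value [l] at [m], so the formula holds for
    every branch. *)
Lemma cD_Elog l m a (x : R) j : (j < 6)%N -> m != 0 -> md a <= md m / 2 ->
  0 <= x <= 1 ->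
  cD (fun y => Elog (l + cLn (1 + y%:C * (a / m))) (m + y%:C * a) j) x
     (a * Elog (l + cLn (1 + x%:C * (a / m))) (m + x%:C * a) j.+1).
Proof.
move=> hj m0 ha /andP[x0 x1].
have hx : md (x%:C * (a / m)) <= 1 / 2.
  rewrite mdM md_real ger0_norm//.
  rewrite -[leRHS]mul1r ler_pM ?md_ge0//; exact: md_div_half.
have r0 := Re_1Dgt0 hx.
have n1 : 1 + x%:C * (a / m) != 0.
  by apply: contraTneq r0 => ->; rewrite ltxx.
have mE : m + x%:C * a = m * (1 + x%:C * (a / m)) by field.
have u0 : m + x%:C * a != 0 by rewrite mE mulf_neq0.
have em_delta : cD (fun y => l + cLn (1 + y%:C * (a / m))) x (a / (m + x%:C * a)).
  apply: cD_eq (cDD (cD_cst l x) (cD_cLn r0 (cD_line 1 (a / m) x))) _.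
  by rewrite add0r mE; field; rewrite m0.
have du := cD_line m a x.
have dv := cDV u0 du.
case: j hj => [|[|[|[|[|[|//]]]]]] _ /=.
- apply: cD_eq (cD_ext (cDB (cDM (cDZ (2^-1) (cDM du du)) em_delta) (cDZ (3 / 4) (cDM du du))) _) _.
    by move=> y /=; field.
  by field.
- apply: cD_eq (cDB (cDM du em_delta) du) _; by field.
- apply: cD_eq em_delta _; by [].
- apply: cD_eq dv _; by field.
- apply: cD_eq (cDN (cDM dv dv)) _; by field.
- apply: cD_eq (cD_ext (cDZ 2 (cDM dv (cDM dv dv))) _) _.
    by move=> y /=; rewrite !exprS expr0 mulr1.
  by field.
Qed.

(** Expanding [Elog j] to [6 - j] terms makes every remainder involve [Elog 6], of size [6 |u| ^ -4]
    with [|u| >= |m| / 2]; hence [192 = 2 * 6 * 16]. *)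
Lemma Elog_taylor (K : R) l m a j : 1 <= K -> (j < 4)%N -> md a <= K ->
  2 * K <= md m ->
  md (Elog (l + cLn (1 + a / m)) (m + a) j -
      \sum_(i < 6 - j) a ^+ i / i`!%:R * Elog l m (j + i)) <= 192 * K ^+ 6 / md m ^+ 4.
Proof.
move=> K1 hj ha hm.
have m0 : m != 0 by rewrite -md_gt0; lra.
have ha2 : md a <= md m / 2 by lra.
pose f i (x : R) := a ^+ i * Elog (l + cLn (1 + x%:C * (a / m))) (m + x%:C * a) (j + i).
have hf i x : (i < 6 - j)%N -> 0 <= x <= 1 -> cD (f i) x (f i.+1 x).
  move=> hi hx; rewrite /f addnS exprSr -mulrA.
  apply: cDZ; apply: cD_Elog => //; lia.
have hM x : 0 <= x <= 1 -> md (f (6 - j)%N x) <= 96 * K ^+ 6 / md m ^+ 4.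
  move=> /andP[x0 x1].
  rewrite /f subnKC /=; last by lia.
  have hx : md (m + x%:C * a) >= md m / 2.
    have := lerB_md m (- (x%:C * a)); rewrite opprK mdN mdM md_real ger0_norm//.
    have : x * md a <= md a by rewrite ler_piMl// md_ge0.
    lra.
  rewrite !mdM mdN !mdX mdV md_nat.
  have h1 : (md (m + x%:C * a))^-1 ^+ 4 <= 16 / md m ^+ 4.
    have -> : 16 / md m ^+ 4 = (md m / 2)^-1 ^+ 4.
      by field; rewrite md_eq0.
    have h2 : 0 < md m / 2 by lra.
    rewrite lerXn2r ?nnegrE ?invr_ge0 ?md_ge0 ?(ltW h2)//.
    by rewrite lef_pV2// posrE; exact: lt_le_trans h2 hx.
  have h3 : md a ^+ (6 - j) <= K ^+ 6.
    apply: (le_trans (lerXn2r _ _ _ ha)); rewrite ?nnegrE ?md_ge0//; first by lra.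
    by rewrite ler_weXn2l// leq_subr.
  have -> : 96 * K ^+ 6 / md m ^+ 4 = K ^+ 6 * (6 * (16 / md m ^+ 4)) by ring.
  apply: ler_pM => //; rewrite ?exprn_ge0 ?md_ge0 ?mulr_ge0 ?exprn_ge0 ?invr_ge0 ?md_ge0//.
  by rewrite ler_pM2l.
have := taylor_bound hf hM.
have -> : 2 * (96 * K ^+ 6 / md m ^+ 4) = 192 * K ^+ 6 / md m ^+ 4 by ring.
apply: le_trans; rewrite le_eqVlt; apply/orP; left; apply/eqP.
rewrite /f addn0 expr0 !mul1r; congr (md (_ - _)).
apply: eq_bigr => i _; rewrite -[0%:C]/(0 : R[i]) !mul0r !addr0.
have -> : cLn 1 = 0 :> R[i].
  by apply: eqC; rewrite /= ?(expr1n, expr0n)/= ?addr0 ?ln1 ?mul0r ?atan0.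
by rewrite addr0; ring.
Qed.

Lemma gam_bound (K : R) tau w j : 1 <= K -> md tau <= K -> md tau^-1 <= K ->
  md w <= K -> md (gam tau w j) <= K ^+ 4.
Proof.
move=> K1 h1 h2 h3.
have K0 : 0 <= K by lra.
have hS : md (1 + tau ^+ 2) <= 2 * K ^+ 2.
  apply: (le_trans (ler_mdD _ _)); rewrite md1 mdX.
  have : md tau ^+ 2 <= K ^+ 2 by rewrite lerXn2r ?nnegrE ?md_ge0.
  have : 1 <= K ^+ 2 by rewrite exprn_ege1.
  lra.
have hw2 : md w ^+ 2 <= K ^+ 2 by rewrite lerXn2r ?nnegrE ?md_ge0.
have hw3 : md w ^+ 3 <= K ^+ 3 by rewrite lerXn2r ?nnegrE ?md_ge0.
have e1 : K ^+ 1 <= K ^+ 4 by rewrite ler_weXn2l.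
have e2 : K ^+ 2 <= K ^+ 4 by rewrite ler_weXn2l.
have e3 : K ^+ 3 <= K ^+ 4 by rewrite ler_weXn2l.
case: j => [|[|[|j]]] /=.
- by rewrite (le_trans h2)// -[X in X <= _]expr1.
- rewrite mdM (le_trans _ e2)// expr2; apply: ler_pM; rewrite ?md_ge0//.
- rewrite mdM (le_trans _ e3)// [leRHS]exprSr; apply: ler_pM; rewrite ?md_ge0//.
  apply: (le_trans (ler_mdB _ _)); rewrite mdM (mdM (1 + tau ^+ 2)) !mdV mdX !md_nat.
  have := md_ge0 (1 + tau ^+ 2); lra.
- rewrite mdM [leRHS]exprSr; apply: ler_pM; rewrite ?md_ge0//.
  apply: (le_trans (ler_mdB _ _)).
  rewrite mdM (mdM (w * _)) (mdM w) !mdV mdX !md_nat.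
  have : md w * md (1 + tau ^+ 2) <= K * (2 * K ^+ 2).
    by apply: ler_pM; rewrite ?md_ge0.
  have -> : K * (2 * K ^+ 2) = 2 * K ^+ 3 by ring.
  have := exprn_ge0 3 K0; lra.
Qed.

Definition taylor6 (e : nat -> R[i]) a j :=
  \sum_(i < 6 - j) a ^+ i / i`!%:R * e (j + i)%N.

Lemma taylor6E (e : nat -> R[i]) a :
  [/\ taylor6 e a 0 = e 0%N + a * e 1%N + a ^+ 2 / 2 * e 2%N + a ^+ 3 / 6 * e 3%N
        + a ^+ 4 / 24 * e 4%N + a ^+ 5 / 120 * e 5%N,
      taylor6 e a 1 = e 1%N + a * e 2%N + a ^+ 2 / 2 * e 3%N + a ^+ 3 / 6 * e 4%N
        + a ^+ 4 / 24 * e 5%N,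
      taylor6 e a 2 = e 2%N + a * e 3%N + a ^+ 2 / 2 * e 4%N + a ^+ 3 / 6 * e 5%N
    & taylor6 e a 3 = e 3%N + a * e 4%N + a ^+ 2 / 2 * e 5%N].
Proof.
have F0 : 0`! = 1%N by [].
have F1 : 1`! = 1%N by [].
have F2 : 2`! = 2%N by [].
have F3 : 3`! = 6%N by [].
have F4 : 4`! = 24%N by [].
have F5 : 5`! = 120%N by [].
by split; rewrite /taylor6 !big_ord_recr big_ord0 /= ?(F0, F1, F2, F3, F4, F5); field.
Qed.

(** With [D] raising the index of [e], the four-corner difference is [4 sinh(D/2) sinh(tau D/2)].
    Multiplied by the series of [gam] it gives [D^2 exp(w D)], and this is the identity truncated
    after [e 5]. *)
Lemma gam_cancel (e : nat -> R[i]) tau w : tau != 0 ->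
  let c := (1 + tau) / 2 in
  taylor6 e w 2 = \sum_(j < 4) gam tau w j *
    (taylor6 e (- c) j - taylor6 e (1 - c) j - taylor6 e (tau - c) j + taylor6 e c j).
Proof.
move=> tau0 c; rewrite !big_ord_recr big_ord0 /=.
have [_ _ -> _] := taylor6E e w.
have [-> -> -> ->] := taylor6E e (- c); have [-> -> -> ->] := taylor6E e (1 - c).
have [-> -> -> ->] := taylor6E e (tau - c); have [-> -> -> ->] := taylor6E e c.
by rewrite /c; field.
Qed.

(** All that the remainder estimate has to know about a branch; it lets the estimate serve [cLn] on
    the right and [clog] on the upper half-plane. *)
Definition local_log (L : R[i] -> R[i]) m l a := L (m + a) = l + cLn (1 + a / m).

Lemma rho_bound (K : R) (L : R[i] -> R[i]) tau w u l : 1 <= K ->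
  tau != 0 -> md tau <= K -> md tau^-1 <= K -> md w <= K ->
  let c := (1 + tau) / 2 in let m := c + u in
  2 * K <= md m ->
  local_log L m l w -> local_log L m l (- c) -> local_log L m l (1 - c) ->
  local_log L m l (tau - c) -> local_log L m l c ->
  md (rho L tau w u) <= 3264 * K ^+ 10 / md m ^+ 4.
Proof.
move=> K1 tau0 ht htv hw c m hm lw l1 l2 l3 l4.
have two0 : (2 : R[i]) != 0 by rewrite pnatr_eq0.
have K0 : 0 <= K by lra.
have hc : md c <= K.
  rewrite /c mdM mdV md_nat; have := ler_mdD 1 tau; rewrite md1; lra.
have hc1 : md (1 - c) <= K.
  have -> : 1 - c = (1 - tau) / 2 by rewrite /c; field.
  rewrite mdM mdV md_nat; have := ler_mdB 1 tau; rewrite md1; lra.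
have hc2 : md (tau - c) <= K.
  have -> : tau - c = - (1 - c) by rewrite /c; field.
  by rewrite mdN.
have hcN : md (- c) <= K by rewrite mdN.
set B := 192 * K ^+ 6 / md m ^+ 4.
have B0 : 0 <= B by rewrite /B divr_ge0 ?mulr_ge0 ?exprn_ge0 ?md_ge0.
pose rem a j := Elog (L (m + a)) (m + a) j - taylor6 (Elog l m) a j.
have hrem a j : (j < 4)%N -> md a <= K -> local_log L m l a -> md (rem a j) <= B.
  by move=> hj ha hl; rewrite /rem hl; exact: Elog_taylor.
pose q j := rem (- c) j - rem (1 - c) j - rem (tau - c) j + rem c j.
have E : rho L tau w u = rem w 2%N - \sum_(j < 4) gam tau w j * q j.
  have u1 : u = m + - c by rewrite /m; ring.
  have u2 : u + 1 = m + (1 - c) by rewrite /m; ring.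
  have u3 : u + tau = m + (tau - c) by rewrite /m; ring.
  have u4 : u + 1 + tau = m + c by rewrite /m /c; field.
  have uw : (1 + tau) / 2 + w + u = m + w by rewrite /m /c; ring.
  have key := gam_cancel (Elog l m) w tau0; rewrite /= -/c in key.
  have -> : \sum_(j < 4) gam tau w j * q j =
      Gp L tau w (m - c) - Gp L tau w (m + (1 - c)) - Gp L tau w (m + (tau - c))
      + Gp L tau w (m + c) - taylor6 (Elog l m) w 2.
    rewrite key /Gp -!sumrB -big_split -sumrB/=.
    by apply: eq_bigr => j _; rewrite /q /rem; ring.
  by rewrite /rho uw u4 u3 u2 u1 /rem /=; ring.
rewrite E; apply: (le_trans (ler_mdB _ _)).
have h1 : md (\sum_(j < 4) gam tau w j * q j) <= 16 * K ^+ 4 * B.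
  apply: (le_trans (ler_md_sum _ _ _)).
  have hj (j : 'I_4) : md (gam tau w j * q j) <= K ^+ 4 * (4 * B).
    rewrite mdM; apply: ler_pM; rewrite ?md_ge0//; first exact: gam_bound.
    apply: (le_trans (ler_mdD _ _)).
    have -> : 4 * B = B + B + B + B by ring.
    apply: lerD; last exact: hrem.
    apply: (le_trans (ler_mdB _ _)); apply: lerD; last exact: hrem.
    by apply: (le_trans (ler_mdB _ _)); apply: lerD; exact: hrem.
  apply: (le_trans (ler_sum _ (fun j _ => hj j))).
  by rewrite sumr_const card_ord -mulr_natl; nra.
have h2 := hrem _ 2%N isT hw lw.
have e4 : 1 <= K ^+ 4 by rewrite exprn_ege1.
(* [3264 = 17 * 192]: one remainder at [w], and four coefficients bounded by [K ^+ 4] with four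
   corners each. *)
have -> : 3264 * K ^+ 10 / md m ^+ 4 = 17 * K ^+ 4 * B by rewrite /B; ring.
nra.
Qed.

End Branches.

(** * Sums over the quarter lattice *)

Section Lattice.
Context {R : realType}.
Implicit Types (tau w u : R[i]).

(** A telescoping substitute for [1 / n^2]: the tail from [a] on is at most [1 / (a + 1)], which
    yields explicit rates of convergence. *)
Definition mj (n : nat) : R := (n.+1%:R * n.+2%:R)^-1.

Lemma mj_ge0 n : 0 <= mj n.
Proof. by rewrite invr_ge0 mulr_ge0. Qed.

Lemma sum_mj a b : (a <= b)%N ->
  \sum_(a <= i < b) mj i = a.+1%:R^-1 - b.+1%:R^-1.
Proof.
move=> ab; rewrite -[RHS]opprB -(telescope_sumr (fun n : nat => n.+1%:R^-1 : R) ab) -sumrN.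
apply: eq_bigr => i _; rewrite /mj -!natr1; field.
by rewrite !(natr1, nat1r) -?natrD ?pnatr_eq0 ?addn1 -?natrD ?pnatr_eq0.
Qed.

Lemma sum_mj_le a b : \sum_(a <= i < b) mj i <= a.+1%:R^-1.
Proof.
case: (leqP a b) => ab; last by rewrite big_geq ?invr_ge0// ltnW.
by rewrite sum_mj// gerBl invr_ge0.
Qed.

Lemma sum_mj_le1 a b : \sum_(a <= i < b) mj i <= 1.
Proof. by rewrite (le_trans (sum_mj_le a b))// invf_le1// ler1n. Qed.

(** From [(1 + i + j)^2 >= (1 + i)(1 + j)]; the factor 4 comes from [2 + i <= 2 (1 + i)], used for
    both indices. *)
Lemma quartic_mj (k r : R) i j : 0 < k -> k * (1 + i%:R + j%:R) <= r ->
  1 / r ^+ 4 <= 4 / k ^+ 4 * (mj i * mj j).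
Proof.
move=> k0 h.
have i0 : 0 <= i%:R :> R by [].
have j0 : 0 <= j%:R :> R by [].
have s0 : 0 < k * (1 + i%:R + j%:R) by apply: mulr_gt0 => //; lra.
have r0 : 0 < r by lra.
apply: (@le_trans _ _ (1 / (k * (1 + i%:R + j%:R)) ^+ 4)).
  rewrite ler_pM2l// lef_pV2 ?posrE ?exprn_gt0//.
  by rewrite lerXn2r// ?nnegrE ltW.
have -> : mj i * mj j = ((1 + i%:R) * (2 + i%:R) * ((1 + j%:R) * (2 + j%:R)))^-1.
  by rewrite /mj -invfM; congr (_^-1); rewrite -!natr1; ring.
set D := (X in _ <= _ / X).
have D0 : 0 < D by rewrite /D !mulr_gt0//; lra.
have t0 : 0 < 1 + i%:R + j%:R :> R by lra.
have -> : 1 / (k * (1 + i%:R + j%:R)) ^+ 4 = k ^- 4 * (1 / (1 + i%:R + j%:R) ^+ 4).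
  by field; rewrite !gt_eqF.
have -> : 4 / k ^+ 4 / D = k ^- 4 * (4 / D) by ring.
rewrite ler_wpM2l ?invr_ge0 ?exprn_ge0 ?(ltW k0)// ler_pdivrMr ?exprn_gt0//.
rewrite mulrAC ler_pdivlMr// mul1r.
have -> : (1 + i%:R + j%:R) ^+ 4 = (1 + i%:R + j%:R) ^+ 2 * (1 + i%:R + j%:R) ^+ 2 :> R by ring.
have h1 : (1 + i%:R) * (1 + j%:R) <= (1 + i%:R + j%:R) ^+ 2 :> R.
  by rewrite expr2; nra.
have p1 : 0 <= (1 + i%:R) * (1 + j%:R) :> R by apply: mulr_ge0; lra.
have h2 : ((1 + i%:R) * (1 + j%:R)) * ((1 + i%:R) * (1 + j%:R)) <=
  (1 + i%:R + j%:R) ^+ 2 * (1 + i%:R + j%:R) ^+ 2 :> R by apply: ler_pM.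
apply: (le_trans _ (ler_wpM2l (ler0n _ 4) h2)).
have -> : D = 4 * (((1 + i%:R) * (1 + j%:R)) * ((1 + i%:R / 2) * (1 + j%:R / 2))) :> R.
  by rewrite /D; field.
rewrite ler_pM2l// ler_wpM2l//; apply: ler_pM; lra.
Qed.

(** The difference of the boxes is two strips, and in each of them one index is at least [K]. *)
Lemma rect_bound (a : nat -> nat -> R[i]) (C : R) K0 : 0 <= C ->
  (forall i j, (K0 <= i)%N || (K0 <= j)%N -> md (a i j) <= C * (mj i * mj j)) ->
  forall K M N, (K0 <= K)%N -> (K <= M)%N -> (K <= N)%N ->
  md (\sum_(0 <= i < M) \sum_(0 <= j < N) a i j -
      \sum_(0 <= i < K) \sum_(0 <= j < K) a i j) <= 2 * C / K.+1%:R.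
Proof.
move=> C0 h K M N K0K KM KN.
rewrite (big_cat_nat (leq0n K) KM)/=.
have -> : \sum_(0 <= i < K) \sum_(0 <= j < N) a i j =
    \sum_(0 <= i < K) \sum_(0 <= j < K) a i j +
    \sum_(0 <= i < K) \sum_(K <= j < N) a i j.
  by rewrite -big_split/=; apply: eq_bigr => i _; rewrite (big_cat_nat (leq0n K) KN).
set S1 := (X in md (X + _ + _ - _)).
have E3 (x y z : R[i]) : x + y + z - x = y + z by ring.
rewrite E3.
apply: (le_trans (ler_mdD _ _)).
have hb a1 b1 a2 b2 : (K0 <= a1)%N || (K0 <= a2)%N ->
   md (\sum_(a1 <= i < b1) \sum_(a2 <= j < b2) a i j) <=
   C * ((\sum_(a1 <= i < b1) mj i) * (\sum_(a2 <= j < b2) mj j)).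
  move=> hK; apply: (le_trans (ler_md_sum _ _ _)).
  rewrite mulr_suml mulr_sumr big_nat [leRHS]big_nat; apply: ler_sum => i /andP[i1 _].
  apply: (le_trans (ler_md_sum _ _ _)).
  rewrite mulr_sumr mulr_sumr big_nat [leRHS]big_nat; apply: ler_sum => j /andP[j1 _].
  apply: h; case/orP: hK => hK; apply/orP; [left | right]; exact: leq_trans hK _.
have s0 a1 b1 : 0 <= \sum_(a1 <= i < b1) mj i by apply: sumr_ge0 => *; exact: mj_ge0.
have -> : 2 * C / K.+1%:R = C * (1 * K.+1%:R^-1) + C * (K.+1%:R^-1 * 1) by ring.
apply: lerD.
  apply: (le_trans (hb _ _ _ _ _)); first by rewrite K0K orbT.
  by apply: ler_wpM2l => //; apply: ler_pM => //; rewrite ?sum_mj_le1 ?sum_mj_le.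
apply: (le_trans (hb _ _ _ _ _)); first by rewrite K0K.
by apply: ler_wpM2l => //; apply: ler_pM => //; rewrite ?sum_mj_le1 ?sum_mj_le.
Qed.

(** The lattice may live in any commutative ring: complex here, real for the expansion of arbitrary
    order. *)
Lemma telescope2 (V : comNzRingType) (g : V -> R[i]) (tau u : V) M N :
  \sum_(0 <= i < M) \sum_(0 <= j < N)
     (g (u + (i%:R + j%:R * tau)) - g (u + (i%:R + j%:R * tau) + 1)
      - g (u + (i%:R + j%:R * tau) + tau) + g (u + (i%:R + j%:R * tau) + 1 + tau))
  = g u - g (u + M%:R) - g (u + N%:R * tau) + g (u + M%:R + N%:R * tau).
Proof.
pose h (i : nat) := g (u + i%:R + N%:R * tau) - g (u + i%:R).
have -> : g u - g (u + M%:R) - g (u + N%:R * tau) + g (u + M%:R + N%:R * tau) = h M - h 0.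
  by rewrite /h addr0; ring.
rewrite -(telescope_sumr h (leq0n M)); apply: eq_bigr => i _.
pose k (j : nat) := g (u + i.+1%:R + j%:R * tau) - g (u + i%:R + j%:R * tau).
have -> : h i.+1 - h i = k N - k 0 by rewrite /h /k !mul0r !addr0; ring.
rewrite -(telescope_sumr k (leq0n N)); apply: eq_bigr => j _.
have e1 : u + (i%:R + j%:R * tau) = u + i%:R + j%:R * tau by ring.
have e2 : u + (i%:R + j%:R * tau) + 1 = u + i.+1%:R + j%:R * tau by ring.
have e3 : u + (i%:R + j%:R * tau) + tau = u + i%:R + j.+1%:R * tau by ring.
have e4 : u + (i%:R + j%:R * tau) + 1 + tau = u + i.+1%:R + j.+1%:R * tau by ring.
by rewrite e4 e3 e2 e1 /k; ring.
Qed.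

(* [Psi] converges, and for real [tau] its limit is minus the derivative at 0
   of the double zeta function at [(1 + tau) / 2 + w]. *)
Definition Psi tau w N : R[i] :=
  \sum_(0 <= i < N) \sum_(0 <= j < N) cLn ((1 + tau) / 2 + w + (i%:R + j%:R * tau))
  + Gp cLn tau w N%:R + Gp cLn tau w (N%:R * tau) - Gp cLn tau w (N%:R + N%:R * tau).

(** At the origin the logarithm has only a default value; [Gp cLn tau w 0] does not depend on [N]
    and drops out of differences. *)
Lemma Psi_rho tau w N :
  Psi tau w N = \sum_(0 <= i < N) \sum_(0 <= j < N) rho cLn tau w (i%:R + j%:R * tau)
    + Gp cLn tau w 0.
Proof.
have := telescope2 (Gp cLn tau w) tau 0 N N.
under eq_bigr do under eq_bigr do rewrite !add0r.
rewrite !add0r => E.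
have -> : \sum_(0 <= i < N) \sum_(0 <= j < N) rho cLn tau w (i%:R + j%:R * tau) =
  \sum_(0 <= i < N) \sum_(0 <= j < N) cLn ((1 + tau) / 2 + w + (i%:R + j%:R * tau))
  - (Gp cLn tau w 0 - Gp cLn tau w N%:R - Gp cLn tau w (N%:R * tau)
     + Gp cLn tau w (N%:R + N%:R * tau)).
  by rewrite -E -sumrB; apply: eq_bigr => i _; rewrite -sumrB.
rewrite /Psi; ring.
Qed.

(** The constants depend on [K] and [k] only. Nothing is asked of [Im tau], so the rate is uniform
    up to the positive real axis. *)
Lemma Psi_cauchy (K k : R) : 1 <= K -> 0 < k <= 1 ->
  exists C K0, forall tau w, k <= Re tau -> md tau <= K -> md tau^-1 <= K ->
    md w <= K -> forall L N, (K0 <= L)%N -> (L <= N)%N ->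
    md (Psi tau w N - Psi tau w L) <= C / L.+1%:R.
Proof.
move=> K1 /andP[k0 k1].
pose K0 := Num.bound (2 * K / k).
have hK0 : 2 * K / k < K0%:R.
  by apply: archi_boundP; rewrite divr_ge0//; lra.
pose C := 3264 * K ^+ 10 * (4 / k ^+ 4).
have Kp : 0 <= K by apply: le_trans K1.
have C0 : 0 <= C by rewrite /C; apply: mulr_ge0; [apply: mulr_ge0; [exact: ler0n | exact: exprn_ge0] | apply: divr_ge0; [exact: ler0n | exact: (exprn_ge0 _ (ltW k0))]].
exists (2 * C), K0 => tau w hk ht htv hw L N hL LN.
rewrite !Psi_rho opprD addrACA subrr addr0.
apply: (@rect_bound _ _ K0 C0) => // i j hij.
have tau0 : tau != 0 by apply: contraTneq hk => ->; rewrite -ltNge.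
set u := _ + _; set c := (1 + tau) / 2.
have rm : k * (1 + i%:R + j%:R) <= Re (c + u).
  have -> : Re (c + u) = (i%:R + 1 / 2) + (j%:R + 1 / 2) * Re tau.
    have -> : c + u = (i%:R + 1 / 2 : R)%:C + (j%:R + 1 / 2 : R)%:C * tau.
      by rewrite /c /u !(rmorphD, rmorphM, fmorphV, rmorph1, rmorph_nat)/=; field.
    by rewrite ReD ReMr.
  have i0 : 0 <= i%:R :> R by [].
  have j0 : 0 <= j%:R :> R by [].
  nra.
have hmR : Re (c + u) <= md (c + u) by rewrite (le_trans (ler_norm _) (ler_Re_md _)).
have h2K : 2 * K <= k * (1 + i%:R + j%:R).
  rewrite -ler_pdivrMl// mulrC (le_trans (ltW hK0))//.
  have i0 : 0 <= i%:R :> R by [].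
  have j0 : 0 <= j%:R :> R by [].
  by case/orP: hij => hh; rewrite -(ler_nat R) in hh; lra.
have hll a : md a <= K -> local_log cLn (c + u) (cLn (c + u)) a.
  move=> ha; apply: cLn_shift; first lra; last lra.
  rewrite ReD; have := ler_Re_md a; rewrite ler_norml => /andP[h _]; lra.
have hc : md c <= K.
  rewrite /c mdM mdV md_nat; have := ler_mdD 1 tau; rewrite md1; lra.
have hc1 : md (1 - c) <= K.
  have -> : 1 - c = (1 - tau) / 2 by rewrite /c; field.
  rewrite mdM mdV md_nat; have := ler_mdB 1 tau; rewrite md1; lra.
have hc2 : md (tau - c) <= K.
  have -> : tau - c = - (1 - c) by rewrite /c; field.
  by rewrite mdN.
have := rho_bound K1 tau0 ht htv hw (u := u) (l := cLn (c + u)) (L := cLn).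
move=> /(_ _ _ _ _ _ _) H.
apply: (le_trans (H _ _ _ _ _ _)); rewrite ?mdN//; first exact: le_trans h2K (le_trans rm hmR).
- exact: hll.
- by apply: hll; rewrite mdN.
- exact: hll.
- exact: hll.
- exact: hll.
have q := quartic_mj k0 (le_trans rm hmR).
have Cr0 : 0 <= 3264 * K ^+ 10 by apply: mulr_ge0; [exact: ler0n | exact: exprn_ge0].
have -> : C * (mj i * mj j) = 3264 * K ^+ 10 * (4 / k ^+ 4 * (mj i * mj j)) by rewrite /C !mulrA.
by apply: le_trans (ler_wpM2l Cr0 q); rewrite div1r.
Qed.

End Lattice.

(** * Algebra of limits *)

Lemma cvg_finsum (K : numFieldType) (V : normedModType K) (I : Type)
    (r : seq I) (f : I -> nat -> V) (l : I -> V) :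
  (forall i, f i @ \oo --> l i) ->
  (fun n => \sum_(i <- r) f i n) @ \oo --> \sum_(i <- r) l i.
Proof.
move=> h; elim: r => [|i r IH].
  rewrite big_nil (_ : (fun n => _) = fun=> 0); first exact: cvg_cst.
  by apply/funext => n; rewrite big_nil.
rewrite big_cons (_ : (fun n => _) = fun n => f i n + \sum_(j <- r) f j n).
  exact: cvgD.
by apply/funext => n; rewrite big_cons.
Qed.

Section ComplexLimits.
Context {R : realType}.
Implicit Types (u v : nat -> R[i]) (a b : R[i]).
Local Notation ccvg u l := ((u : nat -> R[i]^o) @ \oo --> (l : R[i]^o)).

Lemma ccvg_cst a : ccvg (fun=> a) a. Proof. exact: cvg_cst. Qed.

Lemma ccvgD u v a b : ccvg u a -> ccvg v b -> ccvg (fun n => u n + v n) (a + b).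
Proof. by move=> hu hv; exact: (cvgD hu hv). Qed.

Lemma ccvgN u a : ccvg u a -> ccvg (fun n => - u n) (- a).
Proof. by move=> hu; exact: (cvgN hu). Qed.

Lemma ccvgB u v a b : ccvg u a -> ccvg v b -> ccvg (fun n => u n - v n) (a - b).
Proof. by move=> hu hv; exact: (cvgB hu hv). Qed.

Lemma ccvgM u v a b : ccvg u a -> ccvg v b -> ccvg (fun n => u n * v n) (a * b).
Proof. by move=> hu hv; exact: (cvgM hu hv). Qed.

Lemma ccvgX u a k : ccvg u a -> ccvg (fun n => u n ^+ k) (a ^+ k).
Proof.
move=> hu; elim: k => [|k IH]; first exact: ccvg_cst.
rewrite exprS (_ : (fun n => _) = fun n => u n * u n ^+ k); first exact: ccvgM.
by apply/funext => n; rewrite exprS.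
Qed.

Lemma ccvgV u a : a != 0 -> ccvg u a -> ccvg (fun n => (u n)^-1) a^-1.
Proof. by move=> a0 hu; exact: (cvgV a0 hu). Qed.

End ComplexLimits.

Lemma cvg_scale0 (R : realType) (c : R) (u : nat -> R) :
  u @ \oo --> (0 : R) -> (fun n => c * u n) @ \oo --> (0 : R).
Proof.
move=> h; have := cvgM (@cvg_cst _ c _ _ _) h; rewrite mulr0; exact.
Qed.

(** * Euler's product for the sine *)

Section SineProduct.
Context {R : realType}.
Implicit Types (z v u : R[i]) (M m N k : nat).

Definition ci : R[i] := 0 +i* 1.
(** This is [2 i sin v]. *)
Definition csn v : R[i] := cexp (ci * v) - cexp (- (ci * v)).

Lemma ci2 : ci * ci = -1.
Proof. by apply: eqC; rewrite (ReM, ImM)/=; ring. Qed.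

Lemma md_ci : md ci = 1.
Proof. by rewrite /md/= expr0n expr1n add0r sqrtr1. Qed.

Lemma ci_neq0 : ci != 0.
Proof. by rewrite -md_gt0 md_ci. Qed.

Lemma cexp_2pi : cexp (ci * (2 * pi)%:C) = 1.
Proof.
rewrite /cexp ReM ImM/= !mul0r mul1r subrr expR0 add0r.
rewrite !mul1r (_ : 2 * pi = pi *+ 2) ?mulr_natl// cos2pi sin2pi.
by [].
Qed.

Lemma csn_real (x : R) : csn x%:C = 2 * ci * (sin x)%:C.
Proof.
rewrite /csn /cexp; apply: eqC; rewrite !(ReD, ImD, ReN, ImN, ReM, ImM)/=;
  rewrite ?(ReN, ImN, ReM, ImM)/= !(mul0r, mulr0, mul1r, subr0, addr0, add0r, oppr0, subrr, expR0) ?cosN ?sinN; ring.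
Qed.

Lemma cexp_taylor2 z : md (cexp z - 1 - z) <= 2 * (md z ^+ 2 * expR (md z)).
Proof.
pose f i (x : R) : R[i] := z ^+ i * cexp (x%:C * z).
have hf i x : (i < 2)%N -> 0 <= x <= 1 -> cD (f i) x (f i.+1 x).
  move=> _ _; rewrite /f exprSr -mulrA; apply: cDZ; apply: cD_cexp.
  apply: cD_eq (cDM (cD_id x) (cD_cst z x)) _; ring.
have hM x : 0 <= x <= 1 -> md (f 2%N x) <= md z ^+ 2 * expR (md z).
  move=> /andP[x0 x1]; rewrite /f mdM mdX cexp_md ler_wpM2l ?exprn_ge0 ?md_ge0//.
  rewrite ler_expR ReMr; have := ler_Re_md z; have := md_ge0 z.
  rewrite ler_norml => m0 /andP[h1 h2]; nra.
have := taylor_bound hf hM.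
rewrite big_ord_recr big_ord_recr big_ord0/= /f expr0 expr1 -[1%:C]/(1 : R[i]) mul1r.
by rewrite -[0%:C]/(0 : R[i]) mul0r cexp0 mul1r (_ : 1`! = 1%N)// (_ : 0`! = 1%N)// !divr1 !mulr1 add0r opprD addrA.
Qed.

Lemma csn_taylor v : md (csn v - 2 * ci * v) <= 4 * (md v ^+ 2 * expR (md v)).
Proof.
have -> : csn v - 2 * ci * v =
  (cexp (ci * v) - 1 - ci * v) - (cexp (- (ci * v)) - 1 - (- (ci * v))).
  by rewrite /csn; ring.
apply: (le_trans (ler_mdB _ _)).
have h1 := cexp_taylor2 (ci * v); have h2 := cexp_taylor2 (- (ci * v)).
rewrite mdN in h2; rewrite mdM md_ci mul1r in h1 h2; lra.
Qed.

(** This is [(M / pi) sin (pi v / M)], the counterpart of [v] in the finite form of Euler's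
    product. *)
Definition Sn M v : R[i] := M%:R * csn ((pi / M%:R)%:C * v) / (2 * ci * pi%:C).

Lemma pi_neq0 : (pi : R) != 0.
Proof. by rewrite gt_eqF// pi_gt0. Qed.

Lemma piC_neq0 : (pi%:C : R[i]) != 0.
Proof. by rewrite (inj_eq (@complexI _) _ 0) pi_neq0. Qed.

Lemma Sn_cvg v : ((fun M => Sn M.+1 v) : nat -> R[i]^o) @ \oo --> (v : R[i]^o).
Proof.
pose B := pi * md v.
apply/ccvgP; apply: (@cvg0_squeeze _ _ (fun M => (2 / pi * B ^+ 2 * expR B) * harmonic M)).
  move=> M; rewrite md_ge0/=.
  have M0 : (M.+1%:R : R) != 0 by rewrite pnatr_eq0.
  have M1 : (M.+1%:R : R[i]) != 0 by rewrite pnatr_eq0.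
  have E : Sn M.+1 v - v = M.+1%:R / (2 * ci * pi%:C) *
     (csn ((pi / M.+1%:R)%:C * v) - 2 * ci * ((pi / M.+1%:R)%:C * v)).
    rewrite /Sn; move: (csn _) => cs.
    have -> : (pi / M.+1%:R)%:C = pi%:C / M.+1%:R :> R[i].
      by rewrite (natrC M.+1) -fmorphV -rmorphM.
    have := piC_neq0; move: (pi%:C) => p p0.
    by field; rewrite nat1r M1 ci_neq0 p0.
  have h := csn_taylor ((pi / M.+1%:R)%:C * v).
  have p0 := @pi_gt0 R.
  have v0 := md_ge0 v.
  rewrite E mdM mdM mdV !mdM md_ci !md_nat md_real ger0_norm ?pi_ge0// mulr1.
  move: h; rewrite mdM md_real ger0_norm ?divr_ge0 ?pi_ge0// => h.
  have h1 : pi / M.+1%:R * md v = B / M.+1%:R by rewrite /B; ring.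
  rewrite h1 in h.
  have B0 : 0 <= B by rewrite /B mulr_ge0// ltW.
  have h2 : expR (B / M.+1%:R) <= expR B.
    by rewrite ler_expR ler_pdivrMr// ler_peMr// ler1n.
  have h3 : md (csn ((pi / M.+1%:R)%:C * v) - 2 * ci * ((pi / M.+1%:R)%:C * v)) <=
      4 * ((B / M.+1%:R) ^+ 2 * expR B).
    by apply: (le_trans h); rewrite ler_pM2l// ler_wpM2l// exprn_ge0// divr_ge0.
  apply: (le_trans (ler_wpM2l _ h3)).
    by rewrite divr_ge0// mulr_ge0// ltW.
  rewrite le_eqVlt; apply/orP; left; apply/eqP; rewrite /harmonic/=.
  have := pi_neq0; move: (expR B) => eB; move: (B) => B'.
  by move: pi => p p1; field; rewrite nat1r M0 p1.
rewrite -[0](mulr0 (2 / pi * B ^+ 2 * expR B)); apply: cvgMr; exact: cvg_harmonic.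
Qed.

Definition uroot M : R[i] := cexp (ci * (2 * pi / M%:R)%:C).

Lemma urootX M k : uroot M ^+ k = cexp (ci * (2 * pi / M%:R * k%:R)%:C).
Proof.
rewrite /uroot -cexp_natmul; congr cexp.
by rewrite (natrC k) [RHS]mulrC; rewrite rmorphM/=; ring.
Qed.

Lemma uroot_prim M : (0 < M)%N -> M.-primitive_root (uroot M).
Proof.
move=> M0; have M1 : (M%:R : R) != 0 by rewrite pnatr_eq0 -lt0n.
rewrite /primitive_root_of_unity M0/=; apply/forallP => i; apply/eqP.
rewrite unity_rootE urootX.
have [->|iM] := eqVneq i.+1 M.
  by rewrite divfK// cexp_2pi eqxx.
apply/negbTE/eqP => H.
have /(congr1 (@complex.Im R)) : ci * (2 * pi / M%:R * i.+1%:R)%:C = 0.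
  have ltiM : (i.+1 < M)%N by rewrite ltn_neqAle iM ltn_ord.
  apply: cexp_inj; first by rewrite H cexp0.
  rewrite ImM/= mul0r mul1r add0r subr0 ger0_norm ?mulr_ge0 ?divr_ge0 ?pi_ge0//.
  rewrite -mulrA gtr_pMr ?mulr_gt0 ?pi_gt0// mulrC ltr_pdivrMr ?ltr0n// mul1r ltr_nat.
  exact: ltiM.
rewrite ImM/= mul0r mul1r add0r => /eqP; apply/negP.
by rewrite !mulf_neq0 ?invr_eq0 ?pi_neq0// pnatr_eq0.
Qed.

Lemma prod_pair m (F : nat -> R[i]) :
  \prod_(0 <= k < m.*2.+1) F k =
  F 0%N * \prod_(1 <= k < m.+1) (F k * F (m.*2.+1 - k)%N).
Proof.
rewrite big_nat_recl//; congr (_ * _).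
rewrite big_split/= big_add1/= (big_cat_nat (n := m))//=; last by rewrite -addnn leq_addr.
congr (_ * _); rewrite big_nat_rev/= big_add1/=.
rewrite -{1}(add0n m) big_addn -addnn addnK big_nat [RHS]big_nat.
by apply: eq_bigr => i /andP[_ im]; congr F; lia.
Qed.

Lemma csn_sqr v : csn v ^+ 2 = cexp (ci * v) ^+ 2 + cexp (- (ci * v)) ^+ 2 - 2.
Proof.
have h : cexp (ci * v) * cexp (- (ci * v)) = 1.
  by rewrite -cexpD subrr cexp0.
rewrite /csn sqrrB h -mulr_natr; ring.
Qed.

(** Both sides are [2 cos (2 pi k / M) = 2 - 4 sin^2 (pi k / M)] with [M = 2 m + 1]. *)
Lemma uroot_pair m k : (0 < k)%N -> (k < m.+1)%N ->
  uroot m.*2.+1 ^+ k + uroot m.*2.+1 ^+ (m.*2.+1 - k) =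
    csn (pi / m.*2.+1%:R * k%:R)%:C ^+ 2 + 2.
Proof.
move=> k0 km; rewrite csn_sqr subrK.
set t := ci * _.
have E : uroot m.*2.+1 ^+ k = cexp t ^+ 2.
  rewrite urootX expr2 -cexpD; congr cexp; rewrite /t -mulrDr -rmorphD/=.
  by congr (_ * _%:C); ring.
have EM : uroot m.*2.+1 ^+ m.*2.+1 = 1.
  by apply: prim_expr_order; apply: uroot_prim.
have u0 : uroot m.*2.+1 ^+ k != 0 by rewrite expf_neq0// cexp_neq0.
congr (_ + _) => //.
apply: (mulfI u0); rewrite -exprD subnKC; last by lia.
by rewrite EM E -exprMn -cexpD subrr cexp0 expr1n.
Qed.

Lemma prod_uroot_sub m (X Y : R[i]) : Y != 0 ->
  X ^+ m.*2.+1 - Y ^+ m.*2.+1 =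
  (X - Y) * \prod_(1 <= k < m.+1)
    (X ^+ 2 + Y ^+ 2 - X * Y * (csn (pi / m.*2.+1%:R * k%:R)%:C ^+ 2 + 2)).
Proof.
move=> Y0; set M := m.*2.+1; set w := uroot M.
have hp : M.-primitive_root w by exact: uroot_prim.
have EM : w ^+ M = 1 by exact: prim_expr_order.
have -> : X ^+ M - Y ^+ M = \prod_(0 <= k < M) (X - w ^+ k * Y).
  have H := congr1 (fun p => p.[X / Y]) (factor_Xn_sub_1 hp).
  cbv beta in H; rewrite horner_prod hornerD hornerN hornerXn hornerC in H.
  have -> : X ^+ M - Y ^+ M = ((X / Y) ^+ M - 1) * Y ^+ M.
    by rewrite mulrBl mul1r -exprMn divfK.
  rewrite -H.
  have -> : Y ^+ M = \prod_(0 <= k < M) Y by rewrite big_const_nat subn0 iter_mulr_1.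
  rewrite -big_split/=; apply: eq_bigr => k _.
  by rewrite !hornerE mulrBl divfK.
rewrite prod_pair expr0 mul1r; congr (_ * _).
rewrite big_nat [RHS]big_nat; apply: eq_bigr => k /andP[k0 km].
rewrite -(uroot_pair k0 km) -/M -/w.
have Ek : w ^+ k * w ^+ (M - k) = 1.
  by rewrite -exprD subnKC ?EM// /M; lia.
rewrite -[Y ^+ 2]mul1r -Ek; ring.
Qed.

(** Value at 1 of [1 + X + ... + X^(M-1)], factored over the roots of unity other than 1, conjugate
    roots being paired. *)
Lemma prod_csn m : m.*2.+1%:R = \prod_(1 <= k < m.+1)
    - csn (pi / m.*2.+1%:R * k%:R)%:C ^+ 2.
Proof.
set M := m.*2.+1; set w := uroot M.
have hp : M.-primitive_root w by exact: uroot_prim.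
have EM : w ^+ M = 1 by exact: prim_expr_order.
have hP : \prod_(1 <= k < M) ('X - (w ^+ k)%:P) = \sum_(i < M) 'X^i :> {poly R[i]}.
  have X0 : 'X - 1 != 0 :> {poly R[i]} by rewrite -polyC1 polyXsubC_eq0.
  apply: (mulfI X0); rewrite -subrX1 -(factor_Xn_sub_1 hp) [RHS]big_nat_recl//.
  by rewrite expr0 polyC1 big_add1.
have := congr1 (horner^~ 1) hP; rewrite /= horner_prod horner_sum.
under [in X in _ = X]eq_bigr do rewrite hornerXn expr1n.
rewrite sumr_const card_ord => <-.
(* The pairing lemma includes the index 0, whose factor would vanish; it is replaced by 1. *)
have := prod_pair m (fun k => if k == 0%N then 1 else ('X - (w ^+ k)%:P).[1]).
rewrite big_nat_recl// eqxx !mul1r => E.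
rewrite big_add1/= E big_nat [RHS]big_nat; apply: eq_bigr => k /andP[k0 km].
have -> : (k == 0%N) = false by lia.
have -> : (m.*2.+1 - k == 0)%N = false by lia.
have Ek : w ^+ k * w ^+ (M - k) = 1.
  by rewrite -exprD subnKC ?EM// /M; lia.
have Es := uroot_pair k0 km; rewrite -/M -/w in Es.
rewrite !hornerE mulrBl mul1r mulrBr mulr1 Ek.
have -> : csn (pi / M%:R * k%:R)%:C ^+ 2 = w ^+ k + w ^+ (M - k) - 2 by rewrite Es; ring.
ring.
Qed.

(** Finite form of Euler's product: factor [X^M - Y^M] at [X = exp(i v)], [Y = exp(- i v)] and
    divide each factor by its value at [v = 0], the product of these values being [M]. *)
Lemma csn_natmul m v : csn (m.*2.+1%:R * v) = m.*2.+1%:R * csn v *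
  \prod_(1 <= k < m.+1) (1 - (csn v / csn (pi / m.*2.+1%:R * k%:R)%:C) ^+ 2).
Proof.
have -> : csn (m.*2.+1%:R * v) =
    cexp (ci * v) ^+ m.*2.+1 - cexp (- (ci * v)) ^+ m.*2.+1.
  by rewrite /csn -!cexp_natmul; congr (cexp _ - cexp _); ring.
rewrite prod_uroot_sub ?cexp_neq0//.
rewrite -/(csn v) [_ * csn v]mulrC -[RHS]mulrA; congr (_ * _).
rewrite [in RHS]prod_csn -big_split/=.
rewrite big_nat [RHS]big_nat; apply: eq_bigr => k /andP[k0 km].
set x := _%:C.
have h : cexp (ci * v) * cexp (- (ci * v)) = 1.
  by rewrite -cexpD subrr cexp0.
have x0 : csn x != 0.
  have M0 : (0 : R) < m.*2.+1%:R by rewrite ltr0n.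
  rewrite /x csn_real !mulf_neq0 ?ci_neq0 ?pnatr_eq0// (inj_eq (@complexI _) _ 0) gt_eqF//.
  apply: sin_gt0_pi; rewrite mulr_gt0 ?divr_gt0 ?pi_gt0 ?ltr0n//=.
  rewrite -mulrA gtr_pMr ?pi_gt0// mulrC ltr_pdivrMr// mul1r ltr_nat; lia.
rewrite h mul1r.
have -> : cexp (ci * v) ^+ 2 + cexp (- (ci * v)) ^+ 2 = csn v ^+ 2 + 2.
  by rewrite csn_sqr; ring.
by field.
Qed.

(** Factors are exchanged one at a time, and the untouched ones are bounded through
    [|1 + a| <= exp |a|]. *)
Lemma prod_dist (a b : nat -> R[i]) (al : nat -> R) n :
  (forall k, (k < n)%N -> md (a k) <= al k) ->
  (forall k, (k < n)%N -> md (b k) <= al k) ->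
  md (\prod_(0 <= k < n) (1 + a k) - \prod_(0 <= k < n) (1 + b k)) <=
  expR (\sum_(0 <= k < n) al k) * \sum_(0 <= k < n) md (a k - b k).
Proof.
have h1 (u : R[i]) (r : R) : md u <= r -> md (1 + u) <= expR r.
  move=> h; apply: (le_trans (ler_mdD _ _)); rewrite md1.
  by apply: le_trans (expR_ge1Dx r); lra.
elim: n => [|n IH] ha hb; first by rewrite !big_geq// subrr md0 mulr0.
have {}IH := IH (fun k hk => ha k (ltnW hk)) (fun k hk => hb k (ltnW hk)).
rewrite !big_nat_recr//=.
set P := \prod_(0 <= k < n) (1 + a k) in IH *.
set Q := \prod_(0 <= k < n) (1 + b k) in IH *.
set S := \sum_(0 <= k < n) al k in IH *.
set D := \sum_(0 <= k < n) _ in IH *.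
have hP : md P <= expR S.
  rewrite /P /S md_prod expR_sum big_nat [leRHS]big_nat.
  apply: ler_prod => k /andP[_ kn]; rewrite md_ge0 h1// ha// ltnW//.
have al0 : 0 <= al n := le_trans (md_ge0 _) (ha n (ltnSn _)).
have -> : P * (1 + a n) - Q * (1 + b n) = P * (a n - b n) + (P - Q) * (1 + b n) by ring.
apply: (le_trans (ler_mdD _ _)); rewrite !mdM mulrDr [leLHS]addrC.
have e1 : expR S <= expR (S + al n) by rewrite ler_expR lerDl.
apply: lerD.
  rewrite expRD mulrAC; apply: ler_pM; rewrite ?md_ge0//.
  by apply: h1; exact: hb.
by apply: ler_pM; rewrite ?md_ge0//; exact: le_trans hP e1.
Qed.

(** Dominated convergence for series: the tail is small uniformly in [m], and the head is a finite
    sum of null sequences. *)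
Lemma tannery0 (d : nat -> nat -> R) (C : R) :
  (forall m k, (k < m)%N -> 0 <= d m k <= C * mj k) ->
  (forall k, (fun m => d m k) @ \oo --> (0 : R)) ->
  (fun m => \sum_(0 <= k < m) d m k) @ \oo --> (0 : R).
Proof.
move=> hd hc.
have C0 : 0 <= C.
  have /andP[h1 h2] := hd 1%N 0%N isT; have := le_trans h1 h2.
  by rewrite pmulr_lge0// /mj invr_gt0 mulr_gt0.
apply/cvgr0Pnorm_le => e e0.
have [L hL] : exists L : nat, 2 * C / e < L%:R.
  exists (Num.bound (2 * C / e)).
  by apply: archi_boundP; rewrite divr_ge0 ?mulr_ge0// ltW.
have hs : (fun m => \sum_(0 <= k < L) d m k) @ \oo --> (0 : R).
  rewrite [X in _ --> X](_ : _ = \sum_(0 <= k < L) 0); last by rewrite big1_eq.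
  by apply: cvg_finsum => k; exact: hc.
have e2 : 0 < e / 2 by lra.
have /cvgr0Pnorm_le/(_ _ e2)[N _ HN] := hs.
exists (maxn N L) => // m /=; rewrite geq_max => /andP[Nm Lm].
have := HN m Nm; rewrite ler_norml => /andP[_ h1].
rewrite ger0_norm; last first.
  by rewrite big_nat; apply: sumr_ge0 => k /andP[_ km]; have /andP[] := hd _ _ km.
rewrite (big_cat_nat (leq0n L) Lm)/=.
have h2 : \sum_(L <= k < m) d m k <= C * L.+1%:R^-1.
  apply: (@le_trans _ _ (C * \sum_(L <= k < m) mj k)).
    rewrite mulr_sumr big_nat [leRHS]big_nat; apply: ler_sum => k /andP[_ km].
    by have /andP[] := hd _ _ km.
  by rewrite ler_wpM2l// sum_mj_le.
have h3 : C * L.+1%:R^-1 <= e / 2.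
  rewrite ler_pdivrMr ?ltr0n//.
  move: hL; rewrite ltr_pdivrMr// -[L.+1%:R]natr1; move: (L%:R) => r hL; nra.
by rewrite [e]splitr; apply: lerD => //; exact: le_trans h2 h3.
Qed.

(** Jordan's inequality with a crude constant: the mean value theorem up to 1, then
    [sin x >= sin 1 >= cos 1] together with [x < 2]. *)
Lemma sin_lower (x : R) : 0 <= x <= pi / 2 -> cos 1 / 2 * x <= sin x.
Proof.
move=> /andP[x0 x1].
have c1 := @cos1_gt0 R.
have p2 := @pihalf_ge1 R; have p3 := @pihalf_lt2 R.
have cle (y : R) : 0 <= y <= 1 -> cos 1 <= cos y.
  move=> /andP[y0 y1].
  have [->//|ny] := eqVneq y 1.
  by rewrite ltW// ltr_cos ?in_itv/= ?y0 ?ler01/=; try lra; rewrite lt_neqAle ny.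
have h1 (y : R) : 0 <= y <= 1 -> cos 1 * y <= sin y.
  move=> /andP[y0 y1].
  have hd (z : R) : z \in `]0, y[ -> is_derive z 1 (@sin R) (cos z) by move=> _; exact: is_derive_sin.
  have hc : {within `[0, y], continuous (@sin R)}.
    by apply: continuous_subspaceT; exact: continuous_sin.
  have [c] := MVT_segment y0 hd hc.
  rewrite in_itv/= sin0 !subr0 => /andP[c0 c2] ->.
  by rewrite ler_wpM2r// cle// c0 (le_trans c2).
have [xle1|x1'] := leP x 1.
  by apply: le_trans (h1 x _); rewrite ?x0//; nra.
have h2 : cos (1 : R) <= sin 1.
  by have := h1 1; rewrite mulr1 => h; apply: h; rewrite ler01/=.
have h3 : sin 1 <= sin x by rewrite ltW// ltr_sin ?in_itv/=; lra.
nra.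
Qed.

Definition Pm m z : R[i] := z * \prod_(0 <= k < m) (1 - (z / k.+1%:R) ^+ 2).

Lemma Sn_prod m z : Sn m.*2.+1 z *
    \prod_(0 <= k < m) (1 - (Sn m.*2.+1 z / Sn m.*2.+1 k.+1%:R) ^+ 2) =
  csn (pi%:C * z) / (2 * ci * pi%:C).
Proof.
set M := m.*2.+1.
have M0 : (M%:R : R) != 0 by rewrite pnatr_eq0.
have M1 : (M%:R : R[i]) != 0 by rewrite pnatr_eq0.
have -> : pi%:C * z = M%:R * ((pi / M%:R)%:C * z).
  have -> : (pi / M%:R)%:C = pi%:C / M%:R :> R[i].
    by rewrite (natrC M) -fmorphV -rmorphM.
  by field.
rewrite csn_natmul -/M big_add1/= /Sn.
have c0 : 2 * ci * pi%:C != 0 by rewrite !mulf_neq0 ?ci_neq0 ?piC_neq0 ?pnatr_eq0.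
move: c0; move: (2 * ci * pi%:C) => cc c0.
rewrite -!mulrA; congr (_ * _).
congr (_ * _); rewrite mulrC; congr (_ * _).
apply: eq_bigr => k _; congr (1 - _ ^+ 2).
have -> : (pi / M%:R)%:C * k.+1%:R = (pi / M%:R * k.+1%:R)%:C :> R[i].
  by rewrite (natrC k.+1) -rmorphM.
have [->|x0] := eqVneq (csn (pi / M%:R * k.+1%:R)%:C) 0.
  by rewrite mulr0 mul0r !invr0 !mulr0.
field.
by rewrite x0 c0 M1.
Qed.

(** The domination needed for Euler's product; [k < m] keeps the angle [pi (k + 1) / (2 m + 1)]
    below [pi / 2]. *)
Lemma Sn_nat_lower m k : (k < m)%N -> cos 1 / 2 * k.+1%:R <= md (Sn m.*2.+1 k.+1%:R).
Proof.
move=> km; set M := m.*2.+1.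
have M0 : (0 : R) < M%:R by rewrite ltr0n.
rewrite /Sn.
have -> : (pi / M%:R)%:C * k.+1%:R = (pi / M%:R * k.+1%:R)%:C :> R[i].
  by rewrite (natrC k.+1) -rmorphM.
rewrite csn_real !mdM mdV !mdM md_ci !md_nat !md_real mulr1 (ger0_norm (pi_ge0 _)).
set x := pi / M%:R * _.
have hx : 0 <= x <= pi / 2.
  rewrite /x mulr_ge0 ?divr_ge0 ?pi_ge0//=.
  rewrite -mulrA ler_pM2l ?pi_gt0// mulrC ler_pdivrMr// mulrC ler_pdivlMr//.
  rewrite -natrM ler_nat /M; lia.
have := sin_lower hx.
have s0 : 0 <= sin x.
  by apply: sin_ge0_pi; case/andP: hx => -> h2; have := @pi_ge0 R; lra.
rewrite (ger0_norm s0) => h.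
have -> : M%:R * (2 * sin x) / (2 * pi) = M%:R / pi * sin x.
  by have := pi_neq0; move: pi => p p0; field.
apply: le_trans (ler_wpM2l _ h); last by rewrite divr_ge0 ?pi_ge0.
rewrite le_eqVlt; apply/orP; left; apply/eqP; rewrite /x.
have := pi_neq0; move: pi => p p0; field.
by rewrite p0 gt_eqF.
Qed.

(** The product with [Sn] in place of its limits equals [sin (pi z) / pi] for every [m]; only the
    error of this replacement has to tend to 0. *)
Lemma Pm_cvg z : ((fun m => Pm m z) : nat -> R[i]^o) @ \oo -->
  (csn (pi%:C * z) / (2 * ci * pi%:C) : R[i]^o).
Proof.
have lek k : (k.+2 <= k.+1 * 2)%N by lia.
have lek' k : (k.+2 <= 2 * k.+1)%N by lia.
have c1 := @cos1_gt0 R.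
have hS u : ((fun m => Sn m.*2.+1 u) : nat -> R[i]^o) @ \oo --> (u : R[i]^o).
  have h : (fun m => m.*2) @ \oo --> \oo.
    apply/cvgnyPge => A; exists A => // n /= An; rewrite -addnn.
    exact: leq_trans An (leq_addr _ _).
  apply: (cvg_comp (fun m => m.*2) (fun M => (Sn M.+1 u : R[i]^o)) h).
  exact: Sn_cvg.
have [B B0 hB] : exists2 B : R, 0 < B & forall m, md (Sn m.*2.+1 z) <= B.
  have := cvg_seq_bounded (cvgP _ (ccvg_md (hS z))).
  move=> [A [_ /(_ (`|A| + 1))]].
  have AA : A < `|A| + 1 by have := ler_norm A; lra.
  move=> /(_ AA) hA; exists (`|A| + 1); first by have := normr_ge0 A; lra.
  by move=> m; have := hA m I; rewrite /= ger0_norm ?md_ge0.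
have hzB : md z <= B.
  have hc := ccvg_md (hS z).
  rewrite -(cvg_lim _ hc)//; apply: limr_le; first exact: cvgP hc.
  exact: nearW.
pose a m k : R[i] := - (Sn m.*2.+1 z / Sn m.*2.+1 k.+1%:R) ^+ 2.
pose b k : R[i] := - (z / k.+1%:R) ^+ 2.
(* [B] bounds numerators, [cos 1 / 2 * (k + 1)] bounds denominators from below, and the last 2 comes
   from [(k + 1) ^ -2 <= 2 * mj k]. *)
pose C := 2 * (2 * B / cos 1) ^+ 2.
have kC (x y : R) k : 0 <= x -> x <= B -> cos 1 / 2 * k.+1%:R <= y ->
    (x / y) ^+ 2 <= C * mj k.
  move=> x0 xB hy.
  have k0 : (0 : R) < k.+1%:R by rewrite ltr0n.
  have q0 : 0 < cos 1 / 2 * k.+1%:R :> R by rewrite mulr_gt0// divr_gt0.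
  have y0 : 0 < y by exact: lt_le_trans hy.
  have h1 : x / y <= B / (cos 1 / 2 * k.+1%:R).
    by apply: ler_pM => //; rewrite ?invr_ge0 ?(ltW y0)// lef_pV2.
  have h2 : (x / y) ^+ 2 <= (B / (cos 1 / 2 * k.+1%:R)) ^+ 2.
    by rewrite lerXn2r// nnegrE ?divr_ge0// ?(ltW y0)// ?(ltW q0)// ltW.
  apply: (le_trans h2).
  have -> : (B / (cos 1 / 2 * k.+1%:R)) ^+ 2 = (2 * B / cos 1) ^+ 2 * (k.+1%:R ^- 2).
    by field; rewrite nat1r !gt_eqF.
  have -> : C * mj k = (2 * B / cos 1) ^+ 2 * (k.+1%:R^-1 * (k.+2%:R^-1 * 2)).
    by rewrite /C /mj invfM; ring.
  rewrite ler_wpM2l ?sqr_ge0// expr2 invfM ler_wpM2l ?invr_ge0//.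
  by rewrite mulrC ler_pdivlMr ?ltr0n// mulrC ler_pdivrMr ?ltr0n// -natrM ler_nat ?lek ?lek'.
have ha m k : (k < m)%N -> md (a m k) <= C * mj k.
  move=> km; rewrite /a mdN mdX mdM mdV; apply: kC; rewrite ?md_ge0//.
  exact: Sn_nat_lower.
have hb k : md (b k) <= C * mj k.
  rewrite /b mdN mdX mdM mdV md_nat; apply: kC; rewrite ?md_ge0//.
  have : cos (1 : R) <= 1 by exact: cos_le1.
  have : (0 : R) <= k.+1%:R by [].
  nra.
have hd : (fun m => \sum_(0 <= k < m) md (a m k - b k)) @ \oo --> (0 : R).
  apply: (@tannery0 _ (C + C)).
    move=> m k km; rewrite md_ge0/= mulrDl; apply: (le_trans (ler_mdB _ _)).
    by apply: lerD; [exact: ha | exact: hb].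
  move=> k.
  have nz : (k.+1%:R : R[i]) != 0 by rewrite pnatr_eq0.
  have c2 := @ccvgX _ _ _ 2 (ccvgM (hS z) (ccvgV nz (hS k.+1%:R))).
  by have /ccvgP := ccvgN c2.
have hP : (fun m => md (\prod_(0 <= k < m) (1 + a m k) - \prod_(0 <= k < m) (1 + b k)))
    @ \oo --> (0 : R).
  apply: (@cvg0_squeeze _ _ (fun m => expR C * \sum_(0 <= k < m) md (a m k - b k))).
    move=> m; rewrite md_ge0/=; apply: le_trans (prod_dist (ha m) (fun k _ => hb k)) _.
    rewrite ler_wpM2r ?sumr_ge0// => [k _|]; first exact: md_ge0.
    rewrite ler_expR -mulr_sumr ler_piMr ?sum_mj_le1//.
    by rewrite /C mulr_ge0// sqr_ge0.
  exact: cvg_scale0 hd.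
apply/ccvgP.
apply: (@cvg0_squeeze _ _ (fun m => B *
   md (\prod_(0 <= k < m) (1 + a m k) - \prod_(0 <= k < m) (1 + b k)) +
   md (Sn m.*2.+1 z - z) * expR C)).
  move=> m; rewrite md_ge0/= -(Sn_prod m z) /Pm mdB.
  set P := \prod_(0 <= k < m) (1 + a m k).
  set Q := \prod_(0 <= k < m) (1 + b k).
  have -> : Sn m.*2.+1 z * P - z * Q = Sn m.*2.+1 z * (P - Q) + (Sn m.*2.+1 z - z) * Q.
    by ring.
  apply: (le_trans (ler_mdD _ _)); rewrite (mdM _ (P - Q)) (mdM _ Q); apply: lerD.
    by rewrite ler_wpM2r ?md_ge0.
  rewrite ler_wpM2l ?md_ge0// /Q md_prod.
  have := prod_dist (fun k (_ : (k < m)%N) => hb k)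
    (fun k (_ : (k < m)%N) => hb k).
  move=> _; apply: (@le_trans _ _ (\prod_(0 <= k < m) expR (C * mj k))).
    apply: ler_prod => k _; rewrite md_ge0/=.
    apply: (le_trans (ler_mdD _ _)); rewrite md1.
    by apply: le_trans (expR_ge1Dx _); have := hb k; lra.
  rewrite -expR_sum ler_expR -mulr_sumr ler_piMr ?sum_mj_le1//.
  by rewrite /C mulr_ge0// sqr_ge0.
under eq_fun do rewrite [X in _ + X]mulrC.
have h2 : (fun m => md (Sn m.*2.+1 z - z)) @ \oo --> (0 : R) by apply/ccvgP; exact: hS.
by have := cvgD (cvg_scale0 B hP) (cvg_scale0 (expR C) h2); rewrite addr0; exact.
Qed.

Definition ee z : R[i] := cexp ((0 +i* (2 * pi)) * z).

Lemma md_ee z : md (ee z) = expR (- (2 * pi * Im z)).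
Proof. by rewrite /ee cexp_md ReM/= mul0r sub0r. Qed.

Lemma eeD z v : ee (z + v) = ee z * ee v.
Proof. by rewrite /ee mulrDr cexpD. Qed.

Lemma md_ee_lt1 z : 0 < Im z -> md (ee z) < 1.
Proof.
by move=> h; rewrite md_ee -expR0 ltr_expR oppr_lt0 !mulr_gt0// pi_gt0.
Qed.

Lemma md_1ee_gt0 z : 0 < Im z -> 0 < md (1 - ee z).
Proof.
move=> /md_ee_lt1 h; have := lerB_md 1 (ee z); rewrite md1; lra.
Qed.

Lemma md_csn_pi z : md (csn (pi%:C * z)) = md (1 - ee z) * expR (pi * Im z).
Proof.
have -> : csn (pi%:C * z) = - (cexp (- (ci * (pi%:C * z))) * (1 - ee z)).
  have -> : ee z = cexp (ci * (pi%:C * z)) * cexp (ci * (pi%:C * z)).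
    rewrite /ee -cexpD; congr cexp; rewrite -mulrDr -mulrDl -rmorphD/=.
    rewrite mulrA; congr (_ * _); apply: eqC; rewrite (ReM, ImM)/=; ring.
  have h : cexp (ci * (pi%:C * z)) * cexp (- (ci * (pi%:C * z))) = 1.
    by rewrite -cexpD subrr cexp0.
  rewrite /csn; move: (cexp _) (cexp (- _)) h => A B h.
  have -> : - (B * (1 - A * A)) = (A * B) * A - B by ring.
  by rewrite h mul1r.
rewrite mdN mdM cexp_md mulrC; congr (_ * expR _).
by rewrite ReN ReM ImMr/= mul0r mul1r sub0r opprK.
Qed.

Lemma prod_shift_Pm N z :
  \prod_(0 <= i < N.+1) ((z + i%:R) * (z - i.+1%:R)) =
  (\prod_(0 <= i < N) - (i.+1%:R ^+ 2)) * Pm N z * (z - N.+1%:R).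
Proof.
rewrite big_split/=.
have -> : \prod_(0 <= i < N.+1) (z + i%:R) = z * \prod_(0 <= i < N) (z + i.+1%:R).
  by rewrite big_nat_recl// addr0.
rewrite [in LHS]big_nat_recr//= /Pm.
have -> : \prod_(0 <= i < N) (- (i.+1%:R ^+ 2)) *
    (z * \prod_(0 <= k < N) (1 - (z / k.+1%:R) ^+ 2)) * (z - N.+1%:R) =
  z * (\prod_(0 <= i < N) (- (i.+1%:R ^+ 2)) *
    \prod_(0 <= k < N) (1 - (z / k.+1%:R) ^+ 2)) * (z - N.+1%:R) by ring.
rewrite -big_split/= mulrA; congr (_ * _); rewrite -mulrA; congr (_ * _).
rewrite -big_split/=; apply: eq_bigr => i _.
by field; rewrite nat1r pnatr_eq0.
Qed.

Lemma ln_prod (I : Type) (r : seq I) (F : I -> R) : (forall i, 0 < F i) ->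
  ln (\prod_(i <- r) F i) = \sum_(i <- r) ln (F i).
Proof.
move=> h; elim: r => [|i r IH]; first by rewrite !big_nil ln1.
by rewrite !big_cons lnM ?posrE ?prodr_gt0// IH.
Qed.

Definition row_ln N z : R :=
  \sum_(0 <= i < N) (ln (md (z + i%:R)) + ln (md (z - i.+1%:R))).

Lemma Im_nat_neq0 z (n : nat) : 0 < Im z -> z + n%:R != 0 /\ z - n%:R != 0.
Proof.
move=> h; split; apply: contraTneq h => /(congr1 (@complex.Im R)).
  by rewrite ImD Im_nat addr0 => ->; rewrite ltxx.
by rewrite ImD ImN Im_nat subr0 => ->; rewrite ltxx.
Qed.

(** A row runs over the shifts from [- N] to [N - 1]; this disposes of the factor without partner in
    the symmetric product. *)
Lemma ratio_cvg1 (z v : R[i]) : 0 < Im z -> 0 < Im v ->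
  (fun N : nat => md (z - N.+1%:R) / md (v - N.+1%:R)) @ \oo --> (1 : R).
Proof.
move=> hz hv.
apply/subr_cvg0/norm_cvg0P.
apply: (@cvg0_squeeze _ _ (fun N => (md (z - v) * (md v + Im v + 2) / Im v) * harmonic N)); last first.
  by rewrite -[0](mulr0 (md (z - v) * (md v + Im v + 2) / Im v)); apply: cvgMr; exact: cvg_harmonic.
move=> N; rewrite normr_ge0/=.
have vN : 0 < md (v - N.+1%:R) by rewrite md_gt0 (Im_nat_neq0 _ hv).2.
have -> : md (z - N.+1%:R) / md (v - N.+1%:R) - 1 =
   (md (z - N.+1%:R) - md (v - N.+1%:R)) / md (v - N.+1%:R).
  by field; rewrite gt_eqF.
rewrite normrM normfV (ger0_norm (ltW vN)).
have h1 : `|md (z - N.+1%:R) - md (v - N.+1%:R)| <= md (z - v).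
  by apply: (le_trans (ler_dist_md _ _)); rewrite le_eqVlt; apply/orP; left; apply/eqP; congr md; ring.
rewrite ler_pdivrMr//; apply: (le_trans h1).
have m0 := md_ge0 (z - v).
rewrite /harmonic/= -!mulrA ler_peMr//.
have hI : Im v <= md (v - N.+1%:R).
  by apply: le_trans (ler_Im_md _); rewrite ImD ImN Im_nat subr0 ler_norm.
have hM : N.+1%:R - md v <= md (v - N.+1%:R).
  by have := lerB_md N.+1%:R v; rewrite md_nat mdB.
have N0 : (0 : R) < N.+1%:R by rewrite ltr0n.
have v0 := md_ge0 v.
move: (md (v - _)) hI hM => D hI hM.
have -> : (md v + Im v + 2) * ((Im v)^-1 * (N.+1%:R^-1 * D)) =
  ((md v + Im v + 2) * D) / (Im v * N.+1%:R).
  by field; rewrite nat1r !gt_eqF.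
rewrite ler_pdivlMr ?mulr_gt0// mul1r; nra.
Qed.

(** Only differences converge, the divergent product of the [i ^ 2] being common to both rows. The
    terms [pi * Im] come from [2 |sin (pi z)| = |1 - exp(2 pi i z)| exp(pi Im z)]. *)
Lemma row_ln_cvg z v : 0 < Im z -> 0 < Im v ->
  (fun N => row_ln N z - row_ln N v) @ \oo -->
  (ln (md (1 - ee z)) + pi * Im z - (ln (md (1 - ee v)) + pi * Im v)).
Proof.
move=> hz hv.
have cc0 : 2 * ci * pi%:C != 0 by rewrite !mulf_neq0 ?ci_neq0 ?piC_neq0 ?pnatr_eq0.
have hc (w : R[i]) : 0 < Im w -> 0 < md (csn (pi%:C * w)).
  by move=> h; rewrite md_csn_pi mulr_gt0 ?expR_gt0 ?md_1ee_gt0.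
have lc (w : R[i]) : 0 < Im w -> ln (md (csn (pi%:C * w))) = ln (md (1 - ee w)) + pi * Im w.
  by move=> h; rewrite md_csn_pi lnM ?posrE ?expR_gt0 ?md_1ee_gt0// expRK.
rewrite -(lc z hz) -(lc v hv) -ln_div; try by rewrite posrE hc.
rewrite -[X in _ --> X]/(ln _) -cvg_shiftS/=.
have E N : row_ln N.+1 z - row_ln N.+1 v =
  ln ((md (Pm N z) / md (Pm N v)) * (md (z - N.+1%:R) / md (v - N.+1%:R))).
  have R1 (w : R[i]) : 0 < Im w -> row_ln N.+1 w = ln (md (\prod_(0 <= i < N) - (i.+1%:R ^+ 2)) * (md (Pm N w) * md (w - N.+1%:R))).
    move=> hw; rewrite mulrA -!mdM -prod_shift_Pm md_prod ln_prod.
      rewrite /row_ln; apply: eq_bigr => i _.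
      by rewrite mdM lnM ?posrE ?md_gt0 ?(Im_nat_neq0 _ hw).1 ?(Im_nat_neq0 _ hw).2.
    by move=> i; rewrite mdM mulr_gt0 ?md_gt0 ?(Im_nat_neq0 _ hw).1 ?(Im_nat_neq0 _ hw).2.
  have A0 : 0 < md (\prod_(0 <= i < N) - (i.+1%:R ^+ 2 : R[i])).
    by rewrite md_prod prodr_gt0// => i _; rewrite md_gt0 oppr_eq0 expf_neq0.
  have P0 (w : R[i]) : 0 < Im w -> 0 < md (Pm N w).
    move=> hw; rewrite md_gt0 /Pm mulf_neq0//.
      by have := (Im_nat_neq0 0 hw).1; rewrite addr0.
    rewrite prodf_seq_neq0; apply/allP => i _; apply/implyP => _.
    have -> : 1 - (w / i.+1%:R) ^+ 2 = - ((w + i.+1%:R) * (w - i.+1%:R)) / i.+1%:R ^+ 2.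
      have : (i.+1%:R : R[i]) != 0 by rewrite pnatr_eq0.
      by move: (i.+1%:R) => q q0; field.
    rewrite mulf_neq0 ?invr_eq0 ?oppr_eq0 ?expf_neq0 ?pnatr_eq0//.
    by rewrite mulf_neq0 ?(Im_nat_neq0 _ hw).1 ?(Im_nat_neq0 _ hw).2.
  have Q0 (w : R[i]) : 0 < Im w -> 0 < md (w - N.+1%:R).
    by move=> hw; rewrite md_gt0 (Im_nat_neq0 _ hw).2.
  rewrite !R1// -ln_div ?posrE ?mulr_gt0 ?A0 ?P0 ?Q0//; congr ln.
  by field; rewrite !gt_eqF ?A0 ?P0 ?Q0.
under eq_fun do rewrite E.
apply: continuous_cvg; first by apply: continuous_ln; rewrite divr_gt0 ?hc.
rewrite -[X in _ --> X]mulr1; apply: cvgM; last exact: ratio_cvg1.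
have hP w := ccvg_md (@Pm_cvg w).
have -> : md (csn (pi%:C * z)) / md (csn (pi%:C * v)) =
  md (csn (pi%:C * z) / (2 * ci * pi%:C)) / md (csn (pi%:C * v) / (2 * ci * pi%:C)).
  rewrite !(mdM (csn _)) !mdV; field.
  by rewrite !gt_eqF ?hc// md_gt0.
apply: cvgM; first exact: hP.
apply: cvgV; last exact: hP.
by rewrite gt_eqF// mdM mulr_gt0 ?hc// mdV invr_gt0 md_gt0.
Qed.

End SineProduct.

Lemma cvg_eqfun (T : topologicalType) (u v : nat -> T) (l l' : T) :
  u @ \oo --> l -> (forall n, u n = v n) -> l = l' -> v @ \oo --> l'.
Proof. by move=> h /funext <- <-. Qed.

Lemma rcvgD (R : realType) (u v : nat -> R) (a b : R) : u @ \oo --> a ->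
  v @ \oo --> b -> (fun n => u n + v n) @ \oo --> a + b.
Proof. by move=> hu hv; exact: cvgD. Qed.

Lemma rcvgB (R : realType) (u v : nat -> R) (a b : R) : u @ \oo --> a ->
  v @ \oo --> b -> (fun n => u n - v n) @ \oo --> a - b.
Proof. by move=> hu hv; exact: cvgB. Qed.

(** * Lattice sums in the upper half-plane *)

Section UpperHalf.
Context {R : realType}.
Implicit Types (tau w z u : R[i]).
Local Notation ccvg u l := ((u : nat -> R[i]^o) @ \oo --> (l : R[i]^o)).

Lemma ccvg_cLn (u : nat -> R[i]) l : 0 < Re l -> ccvg u l -> ccvg (fun n => cLn (u n)) (cLn l).
Proof.
move=> l0 hu.
have hr := ccvg_Re hu.
have hi : (fun n => Im (u n)) @ \oo --> Im l.
  move: hu => /ccvgP h; apply/subr_cvg0/norm_cvg0P.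
  apply: cvg0_squeeze h => n.
  by rewrite normr_ge0/= -ImN -ImD ler_Im_md.
apply: ccvg_ReIm => /=.
  apply: cvgMl; apply: continuous_cvg.
    by apply: continuous_ln; rewrite ltr_wpDr ?sqr_ge0// exprn_gt0.
  under eq_fun do rewrite !expr2.
  by rewrite !expr2; apply: cvgD; apply: cvgM.
apply: continuous_cvg; first exact: continuous_atan.
by apply: cvgM => //; apply: cvgV => //; rewrite gt_eqF.
Qed.

Lemma expRN_mj (s : R) : 0 < s -> exists2 C : R, 0 <= C & forall k : nat,
  expR (- (s * k%:R)) <= C * mj k.
Proof.
(* Chosen so that [q (k + 1) <= 1 + s k / 2 <= exp(s k / 2)]; squaring gives quadratic decay. *)
move=> s0; pose q := Num.min 1 (s / 2).
have q0 : 0 < q by rewrite /q lt_min ltr01/= divr_gt0.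
have q1 : q <= 1 by rewrite /q ge_min lexx.
have q2 : q <= s / 2 by rewrite /q ge_min lexx orbT.
clearbody q; exists (2 / q ^+ 2) => [|k]; first by rewrite divr_ge0// sqr_ge0.
have k0 : 0 <= k%:R :> R by [].
have h1 : q * k.+1%:R <= expR (s * k%:R / 2).
  by apply: le_trans (expR_ge1Dx _); rewrite -natr1; nra.
have h2 : (q * k.+1%:R) ^+ 2 <= expR (s * k%:R).
  have -> : s * k%:R = 2%:R * (s * k%:R / 2) by field.
  by rewrite expRM_natl lerXn2r ?nnegrE ?expR_ge0// mulr_ge0// ltW.
have e0 : 0 < (q * k.+1%:R) ^+ 2 by rewrite exprn_gt0// mulr_gt0.
rewrite expRN.
apply: (@le_trans _ _ ((q * k.+1%:R) ^+ 2)^-1).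
  by rewrite lef_pV2// posrE expR_gt0.
have -> : 2 / q ^+ 2 * mj k = q ^- 2 * (k.+1%:R^-1 * (k.+2%:R^-1 * 2)).
  by rewrite /mj [(k.+1%:R * _)^-1]invfM; ring.
rewrite exprMn invfM ler_wpM2l ?invr_ge0 ?sqr_ge0// expr2 invfM ler_wpM2l ?invr_ge0//.
rewrite mulrC ler_pdivlMr ?ltr0n// mulrC ler_pdivrMr ?ltr0n// -natrM ler_nat; lia.
Qed.

Lemma ee_mj z tau : 0 < Im tau -> exists2 C : R, 0 <= C & forall k : nat,
  md (ee (z + k%:R * tau)) <= C * mj k.
Proof.
move=> t0.
have s0 : 0 < 2 * pi * Im tau :> R by rewrite !mulr_gt0// pi_gt0.
have [C C0 hC] := expRN_mj s0.
exists (md (ee z) * C) => [|k]; first by rewrite mulr_ge0 ?md_ge0.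
rewrite eeD mdM -mulrA ler_wpM2l ?md_ge0// md_ee.
apply: le_trans (hC k); rewrite ler_expR natrC ImMr le_eqVlt; apply/orP; left.
by apply/eqP; ring.
Qed.

Lemma ln_1B_bound (a : R[i]) : md a <= 1 / 2 -> `|ln (md (1 - a))| <= 2 * md a.
Proof.
move=> h.
have h1 := ler_mdB 1 a; have h2 := lerB_md 1 a; rewrite md1 in h1 h2.
have m0 := md_ge0 a.
have p0 : 0 < md (1 - a) by lra.
have E x : 1 + (x - 1) = x :> R by ring.
rewrite ler_norml; apply/andP; split.
  have v0 : 0 < (md (1 - a))^-1 by rewrite invr_gt0.
  have hx : -1 < (md (1 - a))^-1 - 1 by lra.
  have := le_ln1Dx hx; rewrite E lnV ?posrE//.
  have : (md (1 - a))^-1 <= 1 + 2 * md a.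
    rewrite -div1r ler_pdivrMr//; nra.
  lra.
have hx : -1 < md (1 - a) - 1 by lra.
have := le_ln1Dx hx; rewrite E; lra.
Qed.

Definition qprod z tau N : R[i] := \prod_(0 <= k < N) (1 - ee (z + k%:R * tau)).

Lemma bound_mj_lt (C e : R) : 0 <= C -> 0 < e -> exists K0 : nat, forall k, (K0 <= k)%N ->
  C / k.+1%:R <= e.
Proof.
move=> C0 e0; exists (Num.bound (C / e)) => k hk.
rewrite ler_pdivrMr ?ltr0n//.
have : C / e < k.+1%:R.
  apply: lt_le_trans (archi_boundP _) _; first by rewrite divr_ge0// ltW.
  by rewrite ler_nat (leq_trans hk).
by rewrite ltr_pdivrMr// mulrC => /ltW.
Qed.

Lemma mj_le k : mj k <= k.+1%:R^-1 :> R.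
Proof. by rewrite /mj invfM ler_piMr ?invr_ge0// invf_le1// ler1n. Qed.

Lemma lnee_mj z tau : 0 < Im tau -> exists C K0, 0 <= C /\ forall k : nat, (K0 <= k)%N ->
  `|ln (md (1 - ee (z + k%:R * tau)))| <= C * mj k.
Proof.
move=> t0; have [C C0 hC] := ee_mj z t0.
have [K0 hK] := bound_mj_lt C0 (ltac:(lra) : 0 < 1 / 2 :> R).
exists (2 * C), K0; split; first by rewrite mulr_ge0.
move=> k hk; apply: (le_trans (ln_1B_bound _)).
  apply: (le_trans (hC k)); apply: le_trans (hK k hk).
  by rewrite ler_wpM2l// mj_le.
by rewrite -mulrA ler_pM2l.
Qed.

(** The logarithmic sum converges along with the product, so [md P = expR L] also shows that the
    q-product does not vanish. *)
Lemma qprod_cvg z tau : 0 < Im tau -> 0 < Im z ->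
  exists P L, [/\ ccvg (qprod z tau) P,
    (fun N => \sum_(0 <= k < N) ln (md (1 - ee (z + k%:R * tau)))) @ \oo --> L
    & md P = expR L].
Proof.
move=> t0 z0.
have [C C0 hC] := ee_mj z t0.
have [C1 [K0 [C10 hC1]]] := lnee_mj z t0.
have Im0 k : 0 < Im (z + k%:R * tau).
  by rewrite ImD natrC ImMr ltr_wpDr// mulr_ge0// ltW.
have [P hP _] : exists2 l : R[i], ccvg (qprod z tau) l &
    forall K, (0 <= K)%N -> md (l - qprod z tau K) <= 2 * (expR C * C) / K.+1%:R.
  apply: ccvg_rate => K N _ KN.
  pose a k : R[i] := - ee (z + k%:R * tau).
  (* Padding with factors 1 lets two partial products of different lengths be compared by
     [prod_dist]. *)
  pose b k : R[i] := if (k < K)%N then a k else 0.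
  have -> : qprod z tau N = \prod_(0 <= k < N) (1 + a k) by [].
  have -> : qprod z tau K = \prod_(0 <= k < N) (1 + b k).
    rewrite (big_cat_nat (leq0n K) KN)/= [X in _ * X]big_nat [X in _ * X]big1 ?mulr1.
      by rewrite /qprod big_nat [RHS]big_nat; apply: eq_bigr => k /andP[_ kK]; rewrite /b kK.
    by move=> k /andP[Kk _]; rewrite /b ltnNge Kk addr0.
  have ha k : md (a k) <= C * mj k by rewrite /a mdN.
  have hb k : md (b k) <= C * mj k.
    by rewrite /b; case: ifP => // _; rewrite md0 mulr_ge0 ?mj_ge0.
  apply: (le_trans (prod_dist (fun k _ => ha k) (fun k _ => hb k))).
  rewrite -mulr_sumr -[leRHS]mulrA; apply: ler_pM; rewrite ?expR_ge0//.
  - by apply: sumr_ge0 => *; exact: md_ge0.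
  - by rewrite ler_expR ler_piMr// sum_mj_le1.
  rewrite (big_cat_nat (leq0n K) KN)/= [X in X + _]big_nat [X in X + _]big1 ?add0r; last first.
    by move=> k /andP[_ kK]; rewrite /b kK subrr md0.
  apply: (@le_trans _ _ (C * \sum_(K <= k < N) mj k)).
    rewrite mulr_sumr big_nat [leRHS]big_nat; apply: ler_sum => k /andP[Kk _].
    by rewrite /b ltnNge Kk subr0.
  by rewrite ler_wpM2l// sum_mj_le.
have [L hL _] : exists2 L : R, (fun N => \sum_(0 <= k < N) ln (md (1 - ee (z + k%:R * tau)))) @ \oo --> L &
    forall K, (K0 <= K)%N -> `|L - \sum_(0 <= k < K) ln (md (1 - ee (z + k%:R * tau)))| <= C1 / K.+1%:R.
  apply: cvg_rate => K N K0K KN.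
  rewrite (big_cat_nat (leq0n K) KN)/= addrAC subrr add0r.
  apply: (le_trans (ler_norm_sum _ _ _)).
  apply: (@le_trans _ _ (C1 * \sum_(K <= k < N) mj k)).
    rewrite mulr_sumr big_nat [leRHS]big_nat; apply: ler_sum => k /andP[Kk _].
    by apply: hC1; exact: leq_trans Kk.
  by rewrite ler_wpM2l// sum_mj_le.
exists P, L; split => //.
have h1 := ccvg_md hP.
have h2 : (fun N => md (qprod z tau N)) @ \oo --> expR L.
  have E N : md (qprod z tau N) = expR (\sum_(0 <= k < N) ln (md (1 - ee (z + k%:R * tau)))).
    rewrite expR_sum /qprod md_prod; apply: eq_bigr => k _.
    by rewrite lnK// posrE md_1ee_gt0.
  under eq_fun do rewrite E.
  by apply: continuous_cvg => //; exact: continuous_expR.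
by rewrite -(cvg_lim _ h1)// -(cvg_lim _ h2).
Qed.

Section Fixed.
Context (tau w : R[i]) (tau_gt0 : 0 < Im tau) (z_gt0 : 0 < Im ((1 + tau) / 2 + w)).

Let K : R := 1 + md tau + md tau^-1 + md w.

Lemma K_bounds : [/\ 1 <= K, md tau <= K, md tau^-1 <= K & md w <= K].
Proof.
have := md_ge0 tau; have := md_ge0 tau^-1; have := md_ge0 w.
by move=> *; rewrite /K; split; lra.
Qed.

Lemma tau_neq0 : tau != 0.
Proof. by apply: contraTneq tau_gt0 => ->; rewrite ltxx. Qed.

(** Since 1 and [tau] are independent over the reals, the modulus controls both coordinates: [b]
    through the imaginary part, then [a]. *)
Lemma half_plane_bound : exists2 k : R, 0 < k & forall a b : R,
  k * (`|a| + `|b|) <= md (a%:C + b%:C * tau).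
Proof.
pose k := Im tau / (Im tau + md tau + 1).
have m0 := md_ge0 tau.
have Imt := tau_gt0.
have d0 : 0 < Im tau + md tau + 1 by lra.
exists k => [|a b]; first exact: divr_gt0.
have hb : `|b| * Im tau <= md (a%:C + b%:C * tau).
  apply: le_trans (ler_Im_md _); rewrite ImD ImMr/= add0r normrM.
  by rewrite (ger0_norm (ltW tau_gt0)).
have ha : `|a| <= md (a%:C + b%:C * tau) + `|b| * md tau.
  rewrite -md_real -[X in _ + X * _]md_real -mdM; apply: le_trans (ler_mdB _ _).
  by rewrite addrK.
rewrite /k mulrAC ler_pdivrMr//.
have := normr_ge0 a; have := normr_ge0 b; nra.
Qed.

(** The columns [i] and [- (i + 1)] have cell midpoints at the same distance [i + 1/2] from the
    axis, so one bound serves both quadrants. All corners have nonnegative imaginary part, where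
    [clog] is a local logarithm. *)
Lemma rho_clog_bound : exists C K0, 0 <= C /\ forall i j, (K0 <= i)%N || (K0 <= j)%N ->
  md (rho clog tau w (i%:R + j%:R * tau)) <= C * (mj i * mj j) /\
  md (rho clog tau w (- i.+1%:R + j%:R * tau)) <= C * (mj i * mj j).
Proof.
have [k k0 hk] := half_plane_bound.
have [K1 ht htv hw] := K_bounds.
have [K0 hK0] : exists K0 : nat, 2 * K / k < K0%:R.
  exists (Num.bound (2 * K / k)); apply: archi_boundP.
  by rewrite divr_ge0 ?mulr_ge0// ?(ltW k0)//; lra.
have Cr0 : 0 <= 3264 * K ^+ 10.
  by apply: mulr_ge0; [exact: ler0n | apply: exprn_ge0; lra].
pose C := 3264 * K ^+ 10 * (4 / k ^+ 4).
have C0 : 0 <= C.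
  by apply: mulr_ge0 => //; apply: divr_ge0; [exact: ler0n | exact: (exprn_ge0 _ (ltW k0))].
exists C, K0; split=> // i j hij.
set c := (1 + tau) / 2.
have cE : c = (1 / 2 : R)%:C + (1 / 2 : R)%:C * tau.
  by rewrite /c !(rmorphM, fmorphV, rmorph1, rmorph_nat)/=; field.
have main (a : R) : `|a + 1 / 2| = i%:R + 1 / 2 ->
   md (rho clog tau w (a%:C + j%:R * tau)) <= C * (mj i * mj j).
  move=> ha.
  set u := _ + _.
  have j0 : 0 <= j%:R :> R by [].
  have i0 : 0 <= i%:R :> R by [].
  have mE : c + u = (a + 1 / 2)%:C + (j%:R + 1 / 2)%:C * tau.
    by rewrite cE /u !(rmorphD, rmorph_nat)/=; ring.
  have rm : k * (1 + i%:R + j%:R) <= md (c + u).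
    rewrite mE; apply: le_trans (hk _ _); rewrite ha (ger0_norm (_ : 0 <= j%:R + 1 / 2 :> R)); last lra.
    by apply: ler_wpM2l; [exact: ltW | lra].
  have h2K : 2 * K <= md (c + u).
    apply: le_trans rm; rewrite -ler_pdivrMl// mulrC (le_trans (ltW hK0))//.
    by case/orP: hij => hh; rewrite -(ler_nat R) in hh; lra.
  have m0 : c + u != 0 by rewrite -md_gt0; lra.
  have Imm : Im (c + u) = (j%:R + 1 / 2) * Im tau by rewrite mE ImD ImMr/= add0r.
  have Imt := tau_gt0.
  have im0 : 0 <= Im (c + u) by rewrite Imm mulr_ge0 ?(ltW Imt)//; lra.
  have hll b : md b <= K -> 0 <= Im (c + u + b) -> local_log clog (c + u) (clog (c + u)) b.
    by move=> hb ib; apply: clog_shift => //; lra.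
  have Imc : Im c = 1 / 2 * Im tau by rewrite cE ImD ImMr/= add0r.
  have hc : md c <= K.
    rewrite /c mdM mdV md_nat; have := ler_mdD 1 tau; rewrite md1; lra.
  have hc1 : md (1 - c) <= K.
    have -> : 1 - c = (1 - tau) / 2 by rewrite /c; field.
    rewrite mdM mdV md_nat; have := ler_mdB 1 tau; rewrite md1; lra.
  have hc2 : md (tau - c) <= K.
    have -> : tau - c = - (1 - c) by rewrite /c; field.
    by rewrite mdN.
  have jt : 0 <= j%:R * Im tau by rewrite mulr_ge0// ltW.
  have Imu : Im u = j%:R * Im tau by rewrite /u ImD natrC ImMr/= add0r.
  have := @rho_bound R K clog tau w u (clog (c + u)) K1 tau_neq0 ht htv hw.
  rewrite /= -/c => H.
  apply: (le_trans (H h2K _ _ _ _ _)).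
  - apply: hll => //; rewrite addrAC ImD Imu.
    by rewrite addr_ge0// ltW.
  - by apply: hll; rewrite ?mdN// (_ : c + u - c = u) ?Imu //; ring.
  - by apply: hll => //; rewrite (_ : c + u + (1 - c) = u + 1); [by rewrite (ImD u) Imu addr0 | ring].
  - apply: hll => //; rewrite (_ : c + u + (tau - c) = u + tau); last by ring.
    rewrite (ImD u) Imu; by rewrite addr_ge0// ltW.
  - by apply: hll => //; rewrite ImD Imc addr_ge0// mulr_ge0// ltW.
  have q := quartic_mj k0 rm.
  have -> : C * (mj i * mj j) = 3264 * K ^+ 10 * (4 / k ^+ 4 * (mj i * mj j)) by rewrite /C !mulrA.
  by apply: le_trans (ler_wpM2l Cr0 q); rewrite div1r.
have i0 : 0 <= i%:R :> R by [].
split.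
  rewrite (natrC i); apply: main; rewrite ger0_norm//; lra.
have -> : - i.+1%:R = (- i.+1%:R : R)%:C :> R[i] by rewrite rmorphN rmorph_nat.
apply: main; rewrite -natr1 ler0_norm; lra.
Qed.

Let g := Gp clog tau w.
Let zj (j : nat) : R[i] := (1 + tau) / 2 + w + j%:R * tau.

Definition row N j : R[i] := \sum_(0 <= i < N)
  (rho clog tau w (i%:R + j%:R * tau) + rho clog tau w (- i.+1%:R + j%:R * tau)).

(** What the corrections of row [j] leave after telescoping along the row. *)
Definition rowcorner N (j : nat) : R[i] :=
  g (- N%:R + j%:R * tau) - g (N%:R + j%:R * tau)
  - g (- N%:R + j.+1%:R * tau) + g (N%:R + j.+1%:R * tau).

Lemma Im_zj j : 0 < Im (zj j).
Proof.
by rewrite /zj ImD natrC ImMr ltr_wpDr// mulr_ge0// ltW.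
Qed.

Lemma Re_row N j : Re (row N j) = row_ln N (zj j) - Re (rowcorner N j).
Proof.
have hE : row N j = \sum_(0 <= i < N) (clog (zj j + i%:R) + clog (zj j - i.+1%:R))
    - rowcorner N j.
  pose h (x : R[i]) := g (x + j%:R * tau) - g (x + j.+1%:R * tau).
  have e (x : R[i]) : rho clog tau w (x + j%:R * tau) = clog (zj j + x) - (h x - h (x + 1)).
    rewrite /rho /h /g /zj.
    have -> : (1 + tau) / 2 + w + (x + j%:R * tau) = (1 + tau) / 2 + w + j%:R * tau + x by ring.
    have -> : x + j%:R * tau + 1 + tau = x + 1 + j.+1%:R * tau by rewrite -natr1; ring.
    have -> : x + j%:R * tau + 1 = x + 1 + j%:R * tau by ring.
    have -> : x + j%:R * tau + tau = x + j.+1%:R * tau by rewrite -natr1; ring.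
    by ring.
  have -> : rowcorner N j = h (- N%:R) - h N%:R by rewrite /rowcorner /h; ring.
  elim: (N) => [|n IH]; first by rewrite /row !big_geq// oppr0 subrr subr0.
  rewrite /row !big_nat_recr//= -/(row n j) IH !e.
  have -> : - n.+1%:R + 1 = - n%:R :> R[i] by rewrite -natr1; ring.
  have -> : n%:R + 1 = n.+1%:R :> R[i] by rewrite natr1.
  by ring.
rewrite hE ReD ReN Re_sum; congr (_ - _).
Qed.

(** The operator [4 sinh^2(tau D/2)], applied to the correction, leaves [D^2 exp(w D) sinh(tau D/2)
    / sinh(D/2) = tau D^2 + O(D^3)]; here [D^2] produces the logarithm and higher powers of [D]
    produce [O(1/|m|)]. *)
Lemma second_diff : exists C, 0 <= C /\ forall m, 2 * K <= md m ->
  0 <= Im (m - tau) -> 0 <= Im m ->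
  md (g (m + tau) + g (m - tau) - 2 * g m - tau * clog m) <= C / md m.
Proof.
have [K1 ht htv hw] := K_bounds.
have t0 := tau_neq0.
exists (2000 * K ^+ 10); split.
  by apply: mulr_ge0; [exact: ler0n | apply: exprn_ge0; lra].
move=> m hm im1 im2.
have Imt := tau_gt0.
have K0 : 0 <= K by lra.
have m0 : m != 0 by rewrite -md_gt0; lra.
pose l := clog m.
have hp : clog (m + tau) = l + cLn (1 + tau / m).
  by apply: clog_shift => //; [rewrite ImD addr_ge0// ltW | lra].
have hn : clog (m - tau) = l + cLn (1 + (- tau) / m).
  by apply: clog_shift => //; rewrite mdN; lra.
pose T := taylor6 (Elog l m).
pose B := 192 * K ^+ 6 / md m ^+ 4.
pose rp j := Elog (clog (m + tau)) (m + tau) j - T tau j.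
pose rn j := Elog (clog (m - tau)) (m - tau) j - T (- tau) j.
have hrp j : (j < 4)%N -> md (rp j) <= B.
  by move=> hj; rewrite /rp hp; apply: Elog_taylor.
have hrn j : (j < 4)%N -> md (rn j) <= B.
  by move=> hj; rewrite /rn hn; apply: Elog_taylor; rewrite ?mdN.
pose M j := T tau j + T (- tau) j - 2 * Elog l m j.
have E : g (m + tau) + g (m - tau) - 2 * g m =
  \sum_(j < 4) gam tau w j * (rp j + rn j) + \sum_(j < 4) gam tau w j * M j.
  rewrite /g /Gp mulr_sumr -!big_split -sumrB /=; apply: eq_bigr => j _.
  by rewrite /rp /rn /M -/l; ring.
have [T0 T1 T2 T3] := taylor6E (Elog l m) tau.
have [N0 N1 N2 N3] := taylor6E (Elog l m) (- tau).
have E2 : \sum_(j < 4) gam tau w j * M j = tau * l +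
  (gam tau w 0 * (tau ^+ 4 / 12) * Elog l m 4 + gam tau w 1 * tau ^+ 2 * Elog l m 3 +
   gam tau w 1 * (tau ^+ 4 / 12) * Elog l m 5 +
   gam tau w 2 * tau ^+ 2 * Elog l m 4 + gam tau w 3 * tau ^+ 2 * Elog l m 5).
  have El : Elog l m 2 = l by [].
  rewrite -[in RHS]El !big_ord_recr big_ord0 /M /T.
  rewrite [nat_of_ord _]/= T0 N0 [nat_of_ord _]/= T1 N1 [nat_of_ord _]/= T2 N2 [nat_of_ord _]/= T3 N3.
  move: (Elog l m) => e /=.
  by field.
rewrite E E2 -/l; set S1 := \sum_(j < 4) _; set S2 := (X in tau * l + X).
have -> : S1 + (tau * l + S2) - tau * l = S1 + S2 by ring.
have r1 : 1 <= md m by lra.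
have r0 : 0 < md m by lra.
have iv : (md m)^-1 <= 1 by rewrite invf_le1.
have iv0 : 0 <= (md m)^-1 by rewrite invr_ge0 ltW.
have iv2 : (md m)^-1 ^+ 2 <= (md m)^-1 by rewrite expr2 ler_piMr.
have iv3 : (md m)^-1 ^+ 3 <= (md m)^-1 by rewrite exprS ler_piMr// exprn_ile1.
have iv4 : (md m)^-1 ^+ 4 <= (md m)^-1 by rewrite exprS ler_piMr// exprn_ile1.
have hg j := gam_bound j K1 ht htv hw.
have K40 : 0 <= K ^+ 4 by rewrite exprn_ge0.
have K41 : 1 <= K ^+ 4 by rewrite exprn_ege1.
have e4 : md (Elog l m 4) <= (md m)^-1 by rewrite /= mdN mdX mdV.
have e3 : md (Elog l m 3) <= (md m)^-1 by rewrite /= mdV.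
have e5 : md (Elog l m 5) <= 2 * (md m)^-1.
  by rewrite /= mdM mdX mdV md_nat ler_pM2l.
have t4 : md (tau ^+ 4 / 12) <= K ^+ 4.
  rewrite mdM mdX mdV md_nat.
  have : md tau ^+ 4 <= K ^+ 4 by rewrite lerXn2r// nnegrE ?md_ge0.
  have : 0 <= md tau ^+ 4 by rewrite exprn_ge0 ?md_ge0.
  lra.
have t2 : md (tau ^+ 2) <= K ^+ 4.
  rewrite mdX; apply: (@le_trans _ _ (K ^+ 2)); last by rewrite ler_weXn2l.
  by rewrite lerXn2r// nnegrE ?md_ge0.
have p3 (x y v : R[i]) (d : R) : md x <= K ^+ 4 -> md y <= K ^+ 4 -> md v <= d ->
    md (x * y * v) <= K ^+ 8 * d.
  move=> hx hy hv; rewrite !mdM (exprD K 4 4).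
  by apply: ler_pM; rewrite ?mulr_ge0 ?md_ge0//; apply: ler_pM; rewrite ?md_ge0.
have b2 : md S2 <= K ^+ 8 * (8 * (md m)^-1).
  have -> : K ^+ 8 * (8 * (md m)^-1) = K ^+ 8 * (md m)^-1 + K ^+ 8 * (md m)^-1 +
    K ^+ 8 * (2 * (md m)^-1) + K ^+ 8 * (2 * (md m)^-1) + K ^+ 8 * (2 * (md m)^-1) by ring.
  rewrite /S2; apply: (le_trans (ler_mdD _ _)); apply: lerD; last exact: p3.
  apply: (le_trans (ler_mdD _ _)); apply: lerD; last first.
    by apply: p3 => //; lra.
  apply: (le_trans (ler_mdD _ _)); apply: lerD; last exact: p3.
  by apply: (le_trans (ler_mdD _ _)); apply: lerD; exact: p3.
have b1 : md S1 <= 4 * (K ^+ 4 * (2 * B)).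
  apply: (le_trans (ler_md_sum _ _ _)).
  have hj (j : 'I_4) : md (gam tau w j * (rp j + rn j)) <= K ^+ 4 * (2 * B).
    rewrite mdM; apply: ler_pM; rewrite ?md_ge0//.
    apply: (le_trans (ler_mdD _ _)); rewrite mulrDl mul1r.
    by apply: lerD; [exact: hrp | exact: hrn].
  apply: (le_trans (ler_sum _ (fun j _ => hj j))).
  by rewrite sumr_const card_ord -[leLHS]mulr_natl.
apply: (le_trans (ler_mdD _ _)).
have -> : 2000 * K ^+ 10 / md m = 1536 * (K ^+ 10 * (md m)^-1) + 464 * (K ^+ 10 * (md m)^-1).
  by ring.
have K108 : K ^+ 8 <= K ^+ 10 by rewrite ler_weXn2l.
apply: lerD.
  apply: (le_trans b1).
  have -> : 4 * (K ^+ 4 * (2 * B)) = 1536 * (K ^+ 10 * (md m)^-1 ^+ 4).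
    by rewrite /B -exprVn; ring.
  rewrite ler_wpM2l ?ler0n// ler_wpM2l// exprn_ge0//.
apply: (le_trans b2).
have -> : K ^+ 8 * (8 * (md m)^-1) = 8 * (K ^+ 8 * (md m)^-1) by ring.
apply: ler_pM; rewrite ?ler0n ?ler_nat//.
  by rewrite mulr_ge0// exprn_ge0.
by rewrite ler_wpM2r.
Qed.

Lemma ccvg_nat_div (a : R[i]) : ccvg (fun N => 1 + a / N.+1%:R) 1.
Proof.
rewrite -[X in _ --> X](addr0 (1 : R[i])); apply: ccvgD; first exact: ccvg_cst.
apply/ccvgP; apply: (@cvg0_squeeze _ _ (fun N => md a * harmonic N)).
  by move=> N; rewrite md_ge0/= subr0 mdM mdV md_nat.
by apply: cvg_scale0; exact: cvg_harmonic.
Qed.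

Lemma clog_nat (N : nat) : clog N.+1%:R = (ln N.+1%:R)%:C :> R[i].
Proof.
by rewrite /clog md_nat Re_nat divff ?pnatr_eq0// acos1.
Qed.

Lemma clog_natN (N : nat) : clog (- N.+1%:R) = (ln N.+1%:R)%:C + ci * pi%:C :> R[i].
Proof.
rewrite /clog mdN md_nat ReN Re_nat mulNr divff ?pnatr_eq0// acosN1.
by apply: eqC; rewrite !(ReD, ImD, ReM, ImM)/=; ring.
Qed.

(** With arguments in [[0, pi]], the far left of the upper half-plane has argument [pi] and the far
    right argument 0. *)
Lemma clog_diff_cvg (a : R[i]) : 0 <= Im a ->
  ccvg (fun N => clog (- N.+1%:R + a) - clog (N.+1%:R + a)) (ci * pi%:C).
Proof.
move=> ia.
have L1 : cLn 1 = 0 :> R[i].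
  by apply: eqC; rewrite /= ?(expr1n, expr0n)/= ?addr0 ?ln1 ?mul0r ?atan0.
have h : ccvg (fun N => ci * pi%:C + (cLn (1 + (- a) / N.+1%:R) - cLn (1 + a / N.+1%:R)))
    (ci * pi%:C).
  rewrite -[X in _ --> X]addr0; apply: ccvgD; first exact: ccvg_cst.
  rewrite -(subrr (cLn 1)); apply: ccvgB; apply: ccvg_cLn; rewrite ?ltr01//;
    exact: ccvg_nat_div.
apply: cvg_trans h; apply: near_eq_cvg.
exists (Num.bound (2 * md a)) => // N /= hN.
have hN2 : 2 * md a <= N.+1%:R.
  have : 2 * md a < (Num.bound (2 * md a))%:R.
    by apply: archi_boundP; rewrite mulr_ge0 ?md_ge0.
  have : (Num.bound (2 * md a))%:R <= N.+1%:R :> R by rewrite ler_nat (leq_trans hN).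
  lra.
have n0 : (N.+1%:R : R[i]) != 0 by rewrite pnatr_eq0.
rewrite (@clog_shift _ (- N.+1%:R)) ?oppr_eq0 ?ImN ?Im_nat ?oppr0//; last 2 first.
- by rewrite ImD ImN Im_nat oppr0 add0r.
- by rewrite mdN md_nat; lra.
rewrite (@clog_shift _ N.+1%:R) ?Im_nat//; last 2 first.
- by rewrite ImD Im_nat add0r.
- by rewrite md_nat; lra.
rewrite clog_nat clog_natN invrN mulrN -mulNr; ring.
Qed.

Lemma md_cvg_infty (a : R[i]) (s : R[i]) : md s = 1 ->
  (fun N => (md (s * N.+1%:R + a))^-1) @ \oo --> (0 : R).
Proof.
move=> hs; have a0 := md_ge0 a.
have h := cvg_scale0 2 (@cvg_harmonic R).
apply/cvgr0Pnorm_le => e e0.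
have /cvgr0Pnorm_le/(_ _ e0)[M _ HM] := h.
exists (maxn M (Num.bound (2 * md a))) => // N /=; rewrite geq_max => /andP[MN hN].
have hN2 : 2 * md a <= N.+1%:R.
  have : 2 * md a < (Num.bound (2 * md a))%:R.
    by apply: archi_boundP; rewrite mulr_ge0 ?md_ge0.
  have : (Num.bound (2 * md a))%:R <= N.+1%:R :> R by rewrite ler_nat (leq_trans hN).
  lra.
have N0 : 0 < N.+1%:R :> R by rewrite ltr0n.
have h1 : N.+1%:R / 2 <= md (s * N.+1%:R + a).
  have := lerB_md (s * N.+1%:R) (- a); rewrite opprK mdN mdM hs mul1r md_nat; lra.
rewrite ger0_norm ?invr_ge0 ?md_ge0//; apply: le_trans (HM N MN).
rewrite ger0_norm ?mulr_ge0 ?invr_ge0// /harmonic/=.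
have -> : 2 / N.+1%:R = (N.+1%:R / 2)^-1 :> R by rewrite invf_div.
by rewrite lef_pV2 ?posrE; lra.
Qed.

(** Consecutive corner terms differ by second differences at [- N + a] and [N + a], that is by
    [tau (log(- N + a) - log(N + a))] up to [o(1)]. The limit offsets the change of [pi * Im z]
    between two rows in [row_ln_cvg]. *)
Lemma rowcorner_diff j :
  (fun N => Re (rowcorner N.+1 j - rowcorner N.+1 j.+1)) @ \oo --> (- (pi * Im tau) : R).
Proof.
have [C [C0 hC]] := second_diff.
have [K1 _ _ _] := K_bounds.
have Imt := tau_gt0.
pose a : R[i] := j.+1%:R * tau.
have Ima n : 0 <= Im (n%:R * tau) by rewrite natrC ImMr mulr_ge0// ltW.
pose sd m := g (m + tau) + g (m - tau) - 2 * g m.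
have E N : rowcorner N j - rowcorner N j.+1 = sd (- N%:R + a) - sd (N%:R + a).
  rewrite /rowcorner /sd /a.
  have e (x : R[i]) : x + j%:R * tau = x + j.+1%:R * tau - tau by rewrite -[j.+1%:R]natr1; ring.
  have e' (x : R[i]) : x + j.+2%:R * tau = x + j.+1%:R * tau + tau by rewrite -[j.+2%:R]natr1; ring.
  rewrite !e !e'; ring.
have main : ccvg (fun N => rowcorner N.+1 j - rowcorner N.+1 j.+1) (tau * (ci * pi%:C)).
  have hs (s : R[i]) : s = 1 \/ s = -1 ->
      ccvg (fun N => sd (s * N.+1%:R + a) - tau * clog (s * N.+1%:R + a)) 0.
    move=> hs.
    have ms : md s = 1 by case: hs => ->; rewrite ?mdN md1.
    apply/ccvgP.
    have Is N : Im (s * N.+1%:R) = 0.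
      by case: hs => ->; rewrite ?mul1r ?mulN1r ?ImN Im_nat// oppr0.
    have hinf := md_cvg_infty a ms.
    have e0 : 0 < (2 * K)^-1 :> R by rewrite invr_gt0; lra.
    have /cvgr0Pnorm_le/(_ _ e0) hev := hinf.
    apply: (@squeeze_cvgr _ _ _ _ (fun=> 0) (fun N => C * (md (s * N.+1%:R + a))^-1)).
    - apply: filterS hev => N; rewrite ger0_norm ?invr_ge0 ?md_ge0// => hN.
      rewrite /= subr0; apply: hC.
      + have [z0|nz] := eqVneq (md (s * N.+1%:R + a)) 0.
          exfalso; move: z0 => /eqP; rewrite md_eq0 => /eqP /(congr1 (@complex.Im R)).
          rewrite ImD Is add0r /a natrC ImMr => /eqP.
          by rewrite mulf_eq0 pnatr_eq0/= gt_eqF.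
        by rewrite -lef_pV2 ?posrE// ?lt0r ?nz ?md_ge0//; lra.
      + rewrite !ImD ImN Is add0r /a natrC ImMr -natr1 mulrDl mul1r addrK.
        by rewrite mulr_ge0// ltW.
      + by rewrite ImD Is add0r; exact: Ima.
    - exact: cvg_cst.
    - exact: cvg_scale0.
  have h1 := hs _ (or_intror erefl); have h2 := hs _ (or_introl erefl).
  have h3 := ccvgM (@ccvg_cst _ tau) (clog_diff_cvg (Ima j.+1)).
  have := ccvgD (ccvgB h1 h2) h3; rewrite subrr add0r.
  apply: cvg_trans; apply: near_eq_cvg; apply: nearW => N.
  by rewrite E !mulN1r !mul1r -/a; ring.
have := ccvg_Re main.
have -> : Re (tau * (ci * pi%:C)) = - (pi * Im tau).
  by rewrite !(ReM, ImM)/=; ring.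
exact.
Qed.

Let v j : R := ln (md (1 - ee (zj j))).

Lemma row_step j :
  (fun N => Re (row N j) - v j - (Re (row N j.+1) - v j.+1)) @ \oo --> (0 : R).
Proof.
rewrite -cvg_shiftS/=.
have h1 : (fun N => row_ln N.+1 (zj j) - row_ln N.+1 (zj j.+1)) @ \oo -->
    (v j + pi * Im (zj j) - (v j.+1 + pi * Im (zj j.+1))).
  have := row_ln_cvg (Im_zj j) (Im_zj j.+1).
  by rewrite -cvg_shiftS.
apply: (cvg_eqfun (rcvgB (rcvgB h1 (rowcorner_diff j)) (@cvg_cst _ (v j - v j.+1) _ _ _))).
  by move=> N; rewrite !Re_row !(ReD, ReN) /cst/=; ring.
rewrite /zj !(ImD ((1 + tau) / 2 + w)) !natrC !ImMr -[j.+1%:R]natr1; ring.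
Qed.

Lemma row_bound : exists C K0, 0 <= C /\ forall N j, (K0 <= j)%N ->
  `|Re (row N j)| <= C * mj j.
Proof.
have [C [K0 [C0 hC]]] := rho_clog_bound.
exists (2 * C), K0; split; first by rewrite mulr_ge0.
move=> N j hj; apply: (le_trans (ler_Re_md _)); apply: (le_trans (ler_md_sum _ _ _)).
apply: (@le_trans _ _ (2 * C * mj j * \sum_(0 <= i < N) mj i)).
  rewrite mulr_sumr; apply: ler_sum => i _.
  have [h1 h2] : _ /\ _ := hC i j (introT orP (or_intror hj)).
  by apply: (le_trans (ler_mdD _ _)); lra.
by rewrite ler_piMr ?sum_mj_le1// !mulr_ge0 ?mj_ge0.
Qed.

(** The steps between rows give [Re (row N j) - v j] only up to a quantity independent of [j]. It is
    found to be 0 by moving to a far row, where [Re (row N j)] and [v j] are both small uniformly in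
    [N]. *)
Lemma row_cvg j : (fun N => Re (row N j)) @ \oo --> v j.
Proof.
have [C [K0 [C0 hC]]] := row_bound.
have [C1 [K1 [C10 hC1]]] := lnee_mj ((1 + tau) / 2 + w) tau_gt0.
have hM M : (fun N => Re (row N j) - v j - (Re (row N (j + M)%N) - v (j + M)%N)) @ \oo --> (0 : R).
  elim: M => [|M IH].
    by rewrite addn0; under eq_fun do rewrite subrr; exact: cvg_cst.
  apply: (cvg_eqfun (rcvgD IH (row_step (j + M)))); last by rewrite addr0.
  by move=> N; rewrite addnS; ring.
apply/subr_cvg0/cvgr0Pnorm_le => e e0.
have e2 : 0 < e / 2 by apply: divr_gt0.
have [K2 hK2] := bound_mj_lt (addr_ge0 C0 C10) e2.
pose M := maxn (maxn K0 K1) K2.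
have /cvgr0Pnorm_le/(_ _ e2) := hM M.
apply: filterS => N hN.
have jM : (M <= j + M)%N by exact: leq_addl.
have a1 := hC N (j + M)%N (leq_trans (leq_trans (leq_maxl _ _) (leq_maxl _ _)) jM).
have a2 := hC1 (j + M)%N (leq_trans (leq_trans (leq_maxr _ _) (leq_maxl _ _)) jM).
have a3 := hK2 (j + M)%N (leq_trans (leq_maxr _ _) jM).
have a4 : (C + C1) * mj (j + M) <= e / 2.
  by apply: le_trans a3; rewrite ler_wpM2l ?mj_le// addr_ge0.
rewrite -[Re (row N j) - v j](subrK (Re (row N (j + M)%N) - v (j + M)%N)).
rewrite [leRHS]splitr; apply: (le_trans (ler_normD _ _)); apply: lerD => //.
apply: (le_trans (ler_normB _ _)); apply: le_trans a4; rewrite mulrDl.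
exact: lerD.
Qed.

Definition UPbox N : R := \sum_(0 <= j < N) row_ln N (zj j) -
  Re (g (- N%:R) - g N%:R - g (- N%:R + N%:R * tau) + g (N%:R + N%:R * tau)).

Lemma UPbox_row N : UPbox N = \sum_(0 <= j < N) Re (row N j).
Proof.
pose h j := g (- N%:R + j%:R * tau) - g (N%:R + j%:R * tau).
have E : \sum_(0 <= j < N) rowcorner N j = h 0%N - h N.
  rewrite -opprB -(telescope_sumr h (leq0n N)) -sumrN.
  by apply: eq_bigr => j _; rewrite /rowcorner /h; ring.
under [RHS]eq_bigr do rewrite Re_row.
rewrite sumrB -Re_sum E /UPbox /h !mul0r !addr0; congr (_ - Re _); ring.
Qed.

(* Summing along a whole row [i in Z] turns the regularised sum of [ln |z + i|]
   into [ln |1 - exp(2 pi i z)|] by Euler's product, so that the sum over the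
   upper half lattice is the logarithm of the q-product. *)
Lemma UPbox_cvg (L : R) :
  (fun N => \sum_(0 <= k < N) ln (md (1 - ee ((1 + tau) / 2 + w + k%:R * tau)))) @ \oo --> L ->
  UPbox @ \oo --> L.
Proof.
move=> hL.
have [C [K0 [C0 hC]]] := row_bound.
apply/cvgrPdist_le => e e0.
have e3 : 0 < e / 3 by apply: divr_gt0.
have [K2 hK2] := bound_mj_lt C0 e3.
have /cvgrPdist_le/(_ _ e3)[K3 _ hK3] := hL.
pose M := maxn (maxn K0 K2) K3.
have h1 : `|L - \sum_(0 <= k < M) v k| <= e / 3 by apply: hK3; rewrite /= leq_maxr.
have h2 : (fun N => \sum_(0 <= j < M) Re (row N j)) @ \oo --> \sum_(0 <= j < M) v j.
  by apply: cvg_finsum => j; exact: row_cvg.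
have /cvgrPdist_le/(_ _ e3)[K4 _ hK4] := h2.
exists (maxn M K4) => // N /=; rewrite geq_max => /andP[MN K4N].
have h3 := hK4 N K4N; rewrite /= in h3.
rewrite UPbox_row (big_cat_nat (leq0n M) MN)/=.
have h4 : `|\sum_(M <= j < N) Re (row N j)| <= e / 3.
  apply: (le_trans (ler_norm_sum _ _ _)).
  apply: (@le_trans _ _ (C * \sum_(M <= j < N) mj j)).
    rewrite mulr_sumr big_nat [leRHS]big_nat; apply: ler_sum => j /andP[Mj _].
    by apply: hC; rewrite (leq_trans _ Mj)// /M -maxnA leq_maxl.
  apply: (@le_trans _ _ (C / M.+1%:R)); first by rewrite ler_wpM2l// sum_mj_le.
  by apply: hK2; rewrite /M maxnAC leq_maxr.
move: h1 h3 h4; set S0 := \sum_(0 <= k < M) v k.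
set S1 := \sum_(0 <= i < M) Re _; set S2 := \sum_(M <= i < N) _ => h1 h3 h4.
have -> : L - (S1 + S2) = (L - S0) + (S0 - S1) + - S2 by ring.
apply: (le_trans (ler_normD _ _)); rewrite normrN.
have -> : e = e / 3 + e / 3 + e / 3 by field.
by apply: lerD => //; apply: (le_trans (ler_normD _ _)); exact: lerD.
Qed.

End Fixed.
End UpperHalf.

(** * The inversion, and its limit at a positive real point *)

Section Modular.
Context {R : realType}.
Implicit Types (t tau w z u l : R[i]).
Local Notation ccvg u l := ((u : nat -> R[i]^o) @ \oo --> (l : R[i]^o)).

(** The value of the logarithm is an argument, so that a change of branch is an additive change of
    [l]. *)
Definition Gl l tau w u : R[i] := \sum_(j < 4) gam tau w j * Elog l u j.

Lemma GpE (L : R[i] -> R[i]) tau w u : Gp L tau w u = Gl (L u) tau w u.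
Proof. by []. Qed.

(** Half the double Bernoulli polynomial [B_{2,2}] with periods 1 and [tau], at
    [u + w + (1 + tau) / 2]. *)
Definition bpol tau w u : R[i] := gam tau w 0 * u ^+ 2 / 2 + gam tau w 1 * u + gam tau w 2.

Lemma Gl_shift a l tau w u : Gl (l + a) tau w u = Gl l tau w u + a * bpol tau w u.
Proof.
rewrite /Gl /bpol !big_ord_recr !big_ord0 /=; move: (tau^-1) (u^-1) => ti ui.
by field.
Qed.

Lemma Gl_opp l tau w u : Gl l tau w (- u) = Gl l tau (- w) u.
Proof.
rewrite /Gl !big_ord_recr !big_ord0 /= invrN.
by have [->|t0] := eqVneq tau 0; [rewrite invr0; ring | move: (u^-1) => v; field].
Qed.

(** Dividing everything by [tau] exchanges the two periods, and the sign of [- tau^-1] reverses one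
    of them, hence the minus. The value [l] is kept; the shift by [log tau] is accounted for
    separately. *)
Lemma Gl_modular l tau w u : tau != 0 -> u != 0 ->
  Gl l (- tau^-1) (w / tau) (u / tau) = - Gl l tau w u.
Proof.
move=> t0 u0; rewrite /Gl !big_ord_recr !big_ord0 /=.
by field; rewrite ?t0 ?u0.
Qed.

Lemma bpol_corner tau w (N : R[i]) : tau != 0 ->
  bpol tau w (- N * tau) - bpol tau w (N * tau) - bpol tau w (- N - N * tau)
    + bpol tau w (N * tau - N) = - 2 * N ^+ 2.
Proof. by move=> t0; rewrite /bpol /=; field. Qed.

Lemma bpol_corner2 tau w (N : R[i]) : tau != 0 ->
  bpol tau w (- N) + bpol tau w (- (N * tau)) - bpol tau w (- (N + N * tau)) =
  gam tau w 2 - N ^+ 2.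
Proof. by move=> t0; rewrite /bpol /=; field. Qed.

Lemma clog_scale (r : R) t : 0 < r -> t != 0 -> clog (r%:C * t) = (ln r)%:C + clog t.
Proof.
move=> r0 t0; rewrite /clog mdM md_real (ger0_norm (ltW r0)) ReMr.
have -> : r * Re t / (r * md t) = Re t / md t.
  by field; rewrite md_eq0 t0 gt_eqF.
by apply: eqC; rewrite (ReD, ImD)/= ?add0r// lnM ?posrE ?md_gt0.
Qed.

Section Fixed.
Context (tau w : R[i]) (tau_gt0 : 0 < Im tau) (tauR_gt0 : 0 < Re tau).

Let t0 : tau != 0 := tau_neq0 tau_gt0.

Lemma Im_Nv : 0 < Im (- tau^-1).
Proof.
rewrite ImN ImV opprK divr_gt0//.
by rewrite ltr_wpDr ?sqr_ge0// exprn_gt0.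
Qed.

Lemma Im_clog_small t : t != 0 -> 0 < Re t -> 0 <= Im t -> 0 <= Im (clog t) < pi / 2.
Proof.
move=> tn rt it; have /andP[-> _] := Im_clog tn.
by rewrite clog_cLn//; have /andP[_ ->] := Im_cLn t.
Qed.

(** As [s] and [tau] lie in the first quadrant, the two sides have arguments less than [2 pi]
    apart. *)
Lemma clog_div_opp s : 0 < Re s -> 0 <= Im s -> 0 <= Im (- s / tau) ->
  clog (- s / tau) = clog s + ci * pi%:C - clog tau.
Proof.
move=> rs is1 is2.
have s0 : s != 0 by apply: contraTneq rs => ->; rewrite ltxx.
have q0 : - s / tau != 0 by rewrite mulf_neq0 ?oppr_eq0 ?invr_eq0.
have p0 := @pi_gt0 R.
have ep : cexp (ci * pi%:C) = -1 :> R[i].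
  rewrite /cexp ReM ImM/= !mul0r mul1r subrr expR0 add0r mul1r cospi sinpi.
  by apply: eqC; rewrite !(ReM, ImM, ReN, ImN)/=; ring.
apply: cexp_inj.
  by rewrite cexpD cexpN cexpD !cexp_clog ?(ltW tau_gt0)// ep mulrN1.
have /andP[h1 h2] := Im_clog q0.
have /andP[h3 h4] := Im_clog_small s0 rs is1.
have /andP[h5 h6] := Im_clog_small t0 tauR_gt0 (ltW tau_gt0).
rewrite !ImD ImN.
have -> : Im (ci * pi%:C : R[i]) = pi by rewrite ImM/= mul0r mul1r add0r.
by rewrite ltr_norml; apply/andP; split; lra.
Qed.

Lemma clog_div s : s != 0 -> 0 <= Im s -> 0 <= Im (s / tau) ->
  clog (s / tau) = clog s - clog tau.
Proof.
move=> s0 is1 is2.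
have q0 : s / tau != 0 by rewrite mulf_neq0 ?invr_eq0.
have p0 := @pi_gt0 R.
apply: cexp_inj.
  by rewrite cexpD cexpN !cexp_clog ?(ltW tau_gt0).
have /andP[h1 h2] := Im_clog q0.
have /andP[h3 h4] := Im_clog s0.
have /andP[h5 h6] := Im_clog_small t0 tauR_gt0 (ltW tau_gt0).
by rewrite ImD ImN ltr_norml; apply/andP; split; lra.
Qed.

Definition UPcorner tau w (N : R[i]) : R[i] :=
  Gp clog tau w (- N) - Gp clog tau w N - Gp clog tau w (- N + N * tau)
  + Gp clog tau w (N + N * tau).

(** Multiplied by [tau], the corners for [- tau^-1] become [- N tau], [N tau], [- N - N tau] and
    [N tau - N]. Corners in the left quadrant are reflected, which turns [w] into [- w] and adds
    [pi i] to the logarithm. The factors of [pi i] and of [log tau] are then the combinations of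
    [bpol] in [bpol_corner2] and [bpol_corner]. *)
Lemma corner_left (n : nat) : let N : R[i] := n.+1%:R in
  UPcorner tau w N - UPcorner (- tau^-1) (w / tau) N =
  (Gp cLn tau (- w) N + Gp cLn tau (- w) (N * tau) - Gp cLn tau (- w) (N + N * tau))
  - (Gp cLn tau w N + Gp cLn tau w (N * tau) - Gp cLn tau w (N + N * tau))
  + ci * pi%:C * (gam tau w 2 - N ^+ 2) + clog tau * (2 * N ^+ 2).
Proof.
move=> N.
have nr0 : (0 : R) < n.+1%:R by rewrite ltr0n.
have NE : N = (n.+1%:R : R)%:C by rewrite /N natrC.
have N0 : N != 0 by rewrite pnatr_eq0.
have ReN' : Re N = n.+1%:R by rewrite NE.
have ImN' : Im N = 0 by rewrite NE.
have ImNt : Im (N * tau) = n.+1%:R * Im tau by rewrite NE ImMr.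
have ReNt : Re (N * tau) = n.+1%:R * Re tau by rewrite NE ReMr.
have iNt : 0 < Im (N * tau) by rewrite ImNt mulr_gt0.
have rNt : 0 < Re (N * tau) by rewrite ReNt mulr_gt0.
have iNv : 0 < Im (- N / tau) by rewrite mulNr -mulrN NE ImMr mulr_gt0// Im_Nv.
have Nt0 : N * tau != 0 by rewrite mulf_neq0.
have r1 : 0 < Re (N + N * tau) by rewrite ReD ReN' addr_gt0.
have i1 : 0 <= Im (N + N * tau) by rewrite ImD ImN' add0r ltW.
have S0 : N + N * tau != 0 by apply: contraTneq r1 => ->; rewrite ltxx.
have D0 : N * tau - N != 0.
  by apply: contraTneq iNt => /(congr1 (@complex.Im R)); rewrite ImD (ImN N) ImN' subr0 => ->; rewrite ltxx.
pose ip : R[i] := ci * pi%:C.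
pose la := clog tau.
have cN : clog (- N) = clog N + ip.
  by rewrite /N clog_nat clog_natN.
have cNt : clog (N * tau) = clog N + la by rewrite NE clog_scale// -NE /N clog_nat.
have c1 : clog (- N + N * - tau^-1) = clog (N + N * tau) + ip - la.
  have -> : - N + N * - tau^-1 = - (N + N * tau) / tau by field.
  apply: clog_div_opp => //.
  have -> : - (N + N * tau) / tau = - N / tau - N by field.
  by rewrite ImD (ImN N) ImN' subr0 ltW.
have c2 : clog (N + N * - tau^-1) = clog (N * tau - N) - la.
  have -> : N + N * - tau^-1 = (N * tau - N) / tau by field.
  apply: clog_div => //; first by rewrite ImD (ImN N) ImN' subr0 ltW.
  have -> : (N * tau - N) / tau = - N / tau + N by field.
  by rewrite ImD ImN' addr0 ltW.
have eqs : [/\ clog N = cLn N, clog (N * tau) = cLn (N * tau)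
   & clog (N + N * tau) = cLn (N + N * tau)].
  by split; apply: clog_cLn; rewrite ?ReN' ?ImN' ?ltr0n// ltW.
have left_term (r u l : R[i]) : u != 0 -> r = u / tau -> clog r = l - la ->
    Gp clog (- tau^-1) (w / tau) r = - (Gl l tau w u) + la * bpol tau w u.
  move=> u0 -> hl; rewrite GpE hl Gl_modular// -[l - la]/(l + - la) Gl_shift.
  by rewrite opprD mulNr opprK.
rewrite /UPcorner.
rewrite (@left_term (- N) (- N * tau) (clog N + ip + la)); last 3 first.
- by rewrite mulf_neq0// oppr_eq0.
- by rewrite mulfK.
- by rewrite cN addrK.
rewrite (@left_term N (N * tau) (clog N + la)); last 3 first.
- by [].
- by rewrite mulfK.
- by rewrite addrK.
rewrite (@left_term (- N + N * - tau^-1) (- N - N * tau) (clog (N + N * tau) + ip)); last 3 first.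
- by rewrite -opprD oppr_eq0.
- by field.
- by rewrite c1.
rewrite (@left_term (N + N * - tau^-1) (N * tau - N) (clog (N * tau - N))); last 3 first.
- by [].
- by field.
- by rewrite c2.
have hb := bpol_corner w N t0; have hb2 := bpol_corner2 w N t0.
have [<- <- <-] : [/\ Gp clog tau (- w) N = Gp cLn tau (- w) N,
   Gp clog tau (- w) (N * tau) = Gp cLn tau (- w) (N * tau)
   & Gp clog tau (- w) (N + N * tau) = Gp cLn tau (- w) (N + N * tau)].
  by case: eqs => e1 e2 e3; rewrite !GpE e1 e2 e3.
have [<- <- <-] : [/\ Gp clog tau w N = Gp cLn tau w N,
   Gp clog tau w (N * tau) = Gp cLn tau w (N * tau)
   & Gp clog tau w (N + N * tau) = Gp cLn tau w (N + N * tau)].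
  by case: eqs => e1 e2 e3; rewrite !GpE e1 e2 e3.
rewrite !GpE cN cNt.
have e1 : Gl (clog N + ip) tau w (- N) = Gl (clog N) tau (- w) N + ip * bpol tau w (- N).
  by rewrite Gl_shift Gl_opp.
have e2 : Gl (clog N + ip + la) tau w (- N * tau) =
    Gl (clog N + la) tau (- w) (N * tau) + ip * bpol tau w (- (N * tau)).
  have -> : clog N + ip + la = (clog N + la) + ip by ring.
  by rewrite Gl_shift [- N * tau]mulNr Gl_opp.
have e3 : Gl (clog (N + N * tau) + ip) tau w (- N - N * tau) =
    Gl (clog (N + N * tau)) tau (- w) (N + N * tau) + ip * bpol tau w (- (N + N * tau)).
  by rewrite Gl_shift -opprD Gl_opp.
rewrite e1 e2 e3 -hb2.
have -> : 2 * N ^+ 2 = - (bpol tau w (- N * tau) - bpol tau w (N * tau)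
  - bpol tau w (- N - N * tau) + bpol tau w (N * tau - N)) by rewrite hb; ring.
rewrite [- N + N * tau]addrC -/ip -/la; ring.
Qed.

Context (zR_gt0 : 0 < Re ((1 + tau) / 2 + w)) (zRN_gt0 : 0 < Re ((1 + tau) / 2 - w)).
Context (z_gt0 : 0 < Im ((1 + tau) / 2 + w)).
Context (z'_gt0 : 0 < Im ((1 + - tau^-1) / 2 + w / tau)).

(* Dividing by [tau] rotates the half lattice by a quarter turn: the first
   quadrant is common to both sides, and what is left are the two quadrants
   that make up [Psi tau w] and [Psi tau (- w)]. *)
Lemma UPbox_left (n : nat) :
  UPbox tau w n.+1 - UPbox (- tau^-1) (w / tau) n.+1 =
  Re (Psi tau w n.+1 - Psi tau (- w) n.+1) + pi * Im (gam tau w 2).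
Proof.
set N := n.+1.
have N0 : (N%:R : R[i]) != 0 by rewrite pnatr_eq0.
pose z := (1 + tau) / 2 + w.
have hz' : (1 + - tau^-1) / 2 + w / tau = (z - 1) / tau by rewrite /z; field.
pose S1 := \sum_(0 <= i < N) \sum_(0 <= j < N) ln (md (z + (i%:R + j%:R * tau))).
pose S2 := \sum_(0 <= i < N) \sum_(0 <= j < N) ln (md ((1 + tau) / 2 - w + (i%:R + j%:R * tau))).
pose S3 := \sum_(0 <= i < N) \sum_(0 <= j < N) ln (md (z - i.+1%:R + j%:R * tau)).
have Rij (i j : nat) : Re (i%:R + j%:R * tau) = i%:R + j%:R * Re tau.
  by rewrite ReD Re_nat (natrC j) ReMr.
have RP (v : R[i]) : 0 < Re ((1 + tau) / 2 + v) ->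
   Re (\sum_(0 <= i < N) \sum_(0 <= j < N) cLn ((1 + tau) / 2 + v + (i%:R + j%:R * tau))) =
   \sum_(0 <= i < N) \sum_(0 <= j < N) ln (md ((1 + tau) / 2 + v + (i%:R + j%:R * tau))).
  move=> hv; rewrite Re_sum; apply: eq_bigr => i _; rewrite Re_sum; apply: eq_bigr => j _.
  rewrite Re_cLn//.
  have : 0 < Re ((1 + tau) / 2 + v + (i%:R + j%:R * tau)).
    rewrite (ReD ((1 + tau) / 2 + v)) Rij ltr_wpDr//.
    by rewrite addr_ge0// mulr_ge0// ltW.
  by apply: contraTneq => ->; rewrite ltxx.
have U1 : \sum_(0 <= j < N) row_ln N (z + j%:R * tau) = S1 + S3.
  rewrite /row_ln exchange_big/= /S1 /S3 -big_split/=; apply: eq_bigr => i _.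
  rewrite -big_split/=; apply: eq_bigr => j _.
  by congr (ln (md _) + ln (md _)); ring.
have U2 : \sum_(0 <= j < N) row_ln N ((z - 1) / tau + j%:R * - tau^-1) =
    S3 + S2 - (2 * (N%:R ^+ 2)) * ln (md tau).
  have E (j i : nat) : ln (md ((z - 1) / tau + j%:R * - tau^-1 + i%:R)) +
      ln (md ((z - 1) / tau + j%:R * - tau^-1 - i.+1%:R)) =
    ln (md (z - j.+1%:R + i%:R * tau)) + ln (md ((1 + tau) / 2 - w + (j%:R + i%:R * tau))) - 2 * ln (md tau).
    have e1 : (z - 1) / tau + j%:R * - tau^-1 + i%:R = (z - j.+1%:R + i%:R * tau) / tau.
      by rewrite -[j.+1%:R]natr1; field.
    have e2 : (z - 1) / tau + j%:R * - tau^-1 - i.+1%:R =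
       - ((1 + tau) / 2 - w + (j%:R + i%:R * tau)) / tau.
      by rewrite /z -[i.+1%:R]natr1; field.
    have n2 : (1 + tau) / 2 - w + (j%:R + i%:R * tau) != 0.
      have : 0 < Re ((1 + tau) / 2 - w + (j%:R + i%:R * tau)).
        rewrite (ReD ((1 + tau) / 2 - w)) Rij ltr_wpDr//.
        by rewrite addr_ge0// mulr_ge0// ltW.
      by apply: contraTneq => ->; rewrite ltxx.
    have n1 : z - j.+1%:R + i%:R * tau != 0.
      have : 0 < Im (z - j.+1%:R + i%:R * tau).
        rewrite (ImD (z - j.+1%:R)) (ImD z) ImN Im_nat oppr0 addr0 natrC ImMr ltr_wpDr//.
        by rewrite mulr_ge0// ltW.
      by apply: contraTneq => ->; rewrite ltxx.
    rewrite e1 e2 !(mdM _ tau^-1) mdN mdV !ln_div ?posrE ?md_gt0//; ring.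
  rewrite /row_ln; under eq_bigr do under eq_bigr do rewrite E.
  under eq_bigr do rewrite sumrB big_split/= sumr_const_nat subn0.
  rewrite sumrB big_split/= sumr_const_nat subn0 -/S3 -/S2; congr (_ - _).
  rewrite -mulrnA -[LHS]mulr_natr natrM; move: (N%:R : R) (ln _) => p q.
  by ring.
rewrite /UPbox hz' -!/z U1 U2.
have hc := corner_left n; rewrite /= /UPcorner -/N in hc.
have -> : S1 + S3 - Re (Gp clog tau w (- N%:R) - Gp clog tau w N%:R -
      Gp clog tau w (- N%:R + N%:R * tau) + Gp clog tau w (N%:R + N%:R * tau)) -
   (S3 + S2 - 2 * N%:R ^+ 2 * ln (md tau) - Re (Gp clog (- tau^-1) (w / tau) (- N%:R) -
       Gp clog (- tau^-1) (w / tau) N%:R - Gp clog (- tau^-1) (w / tau) (- N%:R + N%:R * - tau^-1)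
       + Gp clog (- tau^-1) (w / tau) (N%:R + N%:R * - tau^-1))) =
  S1 - S2 + 2 * N%:R ^+ 2 * ln (md tau) - Re ((Gp clog tau w (- N%:R) - Gp clog tau w N%:R -
      Gp clog tau w (- N%:R + N%:R * tau) + Gp clog tau w (N%:R + N%:R * tau)) -
     (Gp clog (- tau^-1) (w / tau) (- N%:R) -
       Gp clog (- tau^-1) (w / tau) N%:R - Gp clog (- tau^-1) (w / tau) (- N%:R + N%:R * - tau^-1)
       + Gp clog (- tau^-1) (w / tau) (N%:R + N%:R * - tau^-1))).
  by rewrite (ReD _ (- _)) ReN; ring.
rewrite hc.
have q1 : Re (clog tau * (2 * N%:R ^+ 2)) = 2 * N%:R ^+ 2 * ln (md tau).
  have -> : 2 * N%:R ^+ 2 = (2 * N%:R ^+ 2 : R)%:C :> R[i] by rewrite rmorphM rmorphXn !rmorph_nat.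
  by rewrite mulrC ReMr.
have q2 : Re (ci * pi%:C * (gam tau w 2 - N%:R ^+ 2)) = - (pi * Im (gam tau w 2)).
  have -> : N%:R ^+ 2 = (N%:R ^+ 2 : R)%:C :> R[i] by rewrite rmorphXn rmorph_nat.
  by move: (gam tau w 2) => [g1 g2]; rewrite !(ReM, ImM, ReD, ImD, ReN, ImN)/=; ring.
have q3 (A B C D : R[i]) : Re (A - B + C + D) = Re (A - B) + Re C + Re D by rewrite !ReD.
rewrite q3 q1 q2 /Psi -/N.
rewrite !(ReD, ReN) RP// RP// -/z -/S1 -/S2; ring.
Qed.

Lemma theta_quot P P' :
  ccvg (qprod ((1 + tau) / 2 + w) tau) P ->
  ccvg (qprod ((1 + - tau^-1) / 2 + w / tau) (- tau^-1)) P' ->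
  (fun N => Re (Psi tau w N.+1 - Psi tau (- w) N.+1)) @ \oo -->
    ln (md P) - ln (md P') - pi * Im (gam tau w 2).
Proof.
move=> hP hP'.
have aux (t z Q : R[i]) : 0 < Im t -> 0 < Im z -> ccvg (qprod z t) Q ->
    (fun N => \sum_(0 <= k < N) ln (md (1 - ee (z + k%:R * t)))) @ \oo --> ln (md Q).
  move=> ht hz hQ; have [Q' [L [h1 h2 h3]]] := qprod_cvg ht hz.
  by rewrite (ccvg_unique hQ h1) h3 expRK.
have h1 := UPbox_cvg tau_gt0 z_gt0 (aux _ _ _ tau_gt0 z_gt0 hP).
have h2 := UPbox_cvg Im_Nv z'_gt0 (aux _ _ _ Im_Nv z'_gt0 hP').
rewrite -cvg_shiftS in h1; rewrite -cvg_shiftS in h2.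
apply: (cvg_eqfun (rcvgB (rcvgB h1 h2) (@cvg_cst _ (pi * Im (gam tau w 2)) _ _ _))) => // N.
by rewrite /cst/= UPbox_left addrK.
Qed.

End Fixed.

(* A record, and not an abbreviation, so that proof search by head symbol never
   unfolds the filters. *)
Record clim (u : nat -> R[i]) (l : R[i]) : Prop := Clim {climP : ccvg u l}.

Lemma clim_cst a : clim (fun=> a) a. Proof. by split; exact: ccvg_cst. Qed.
Lemma climD (u v : nat -> R[i]) a b : clim u a -> clim v b -> clim (fun n => u n + v n) (a + b).
Proof. by move=> [hu] [hv]; split; exact: ccvgD. Qed.
Lemma climN (u : nat -> R[i]) a : clim u a -> clim (fun n => - u n) (- a).
Proof. by move=> [hu]; split; exact: ccvgN. Qed.
Lemma climM (u v : nat -> R[i]) a b : clim u a -> clim v b -> clim (fun n => u n * v n) (a * b).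
Proof. by move=> [hu] [hv]; split; exact: ccvgM. Qed.
Lemma climX (u : nat -> R[i]) a k : clim u a -> clim (fun n => u n ^+ k) (a ^+ k).
Proof. by move=> [hu]; split; exact: ccvgX. Qed.
Lemma climV (u : nat -> R[i]) a : a != 0 -> clim u a -> clim (fun n => (u n)^-1) a^-1.
Proof. by move=> a0 [hu]; split; exact: ccvgV. Qed.
Lemma clim_cLn (u : nat -> R[i]) l : 0 < Re l -> clim u l -> clim (fun n => cLn (u n)) (cLn l).
Proof. by move=> l0 [hu]; split; exact: ccvg_cLn. Qed.
Lemma clim_sum (I : Type) (r : seq I) (f : I -> nat -> R[i]) (l : I -> R[i]) :
  (forall i, clim (f i) (l i)) -> clim (fun n => \sum_(i <- r) f i n) (\sum_(i <- r) l i).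
Proof. by move=> h; split; apply: cvg_finsum => i; case: (h i). Qed.

Ltac clim_tac := repeat lazymatch goal with
  | |- clim (fun _ => ?a) _ => exact (clim_cst a)
  | |- clim (fun n => @GRing.add _ _ _) _ => apply climD
  | |- clim (fun n => @GRing.opp _ _) _ => apply climN
  | |- clim (fun n => @GRing.mul _ _ _) _ => apply climM
  | |- clim (fun n => @GRing.exp _ _ _) _ => apply climX
  | |- clim (fun n => @GRing.inv _ _) _ => apply climV
  | |- clim (fun n => ?u n) _ => assumption
  | |- clim (fun n => cLn _) _ => apply clim_cLn
  | |- _ => assumption
  end.

Section Limit.
Context (tau w : nat -> R[i]) (t0 w0 : R[i]).
Context (cvg_tau : clim tau t0) (cvg_w : clim w w0).
Context (t0_gt0 : 0 < Re t0) (zw_gt0 : 0 < Re ((1 + t0) / 2 + w0)).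

Let t0n : t0 != 0.
Proof. by apply: contraTneq t0_gt0 => ->; rewrite ltxx. Qed.

Lemma gam_cvg j : clim (fun n => gam (tau n) (w n) j) (gam t0 w0 j).
Proof.
by case: j => [|[|[|j]]] /=; clim_tac.
Qed.

Lemma Gp_cvg (u : nat -> R[i]) u0 : 0 < Re u0 -> clim u u0 ->
  clim (fun n => Gp cLn (tau n) (w n) (u n)) (Gp cLn t0 w0 u0).
Proof.
move=> ru cu.
have un : u0 != 0 by apply: contraTneq ru => ->; rewrite ltxx.
have cL : clim (fun n => cLn (u n)) (cLn u0) := clim_cLn ru cu.
rewrite /Gp; apply: clim_sum => -[j /= _]; apply: climM; first exact: gam_cvg.
by case: j => [|[|[|[|[|[|j]]]]]] /=; clim_tac.
Qed.

Lemma Psi_cvg N : clim (fun n => Psi (tau n) (w n) N.+1) (Psi t0 w0 N.+1).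
Proof.
have N0 : 0 < N.+1%:R :> R by rewrite ltr0n.
have rN : Re (N.+1%:R * t0) = N.+1%:R * Re t0 by rewrite natrC ReMr.
apply: climD; last first.
  apply: climN; apply: Gp_cvg; first by rewrite ReD Re_nat rN addr_gt0// mulr_gt0.
  by clim_tac.
apply: climD; last by apply: Gp_cvg; [rewrite rN mulr_gt0 | clim_tac].
apply: climD; last by apply: Gp_cvg; [rewrite Re_nat | clim_tac].
apply: clim_sum => i; apply: clim_sum => j; apply: clim_cLn.
  rewrite (ReD ((1 + t0) / 2 + w0)) (ReD i%:R) Re_nat natrC ReMr ltr_wpDr//.
  by rewrite addr_ge0// mulr_ge0// ltW.
by clim_tac.
Qed.

End Limit.

(** Exchange of two limits under a rate in [N] that is uniform for large [n]. *)
Lemma interchange_limit (Phi : nat -> nat -> R) (phi A : nat -> R) (S C : R) K0 :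
  (\forall n \near \oo, forall L N, (K0 <= L)%N -> (L <= N)%N ->
     `|Phi n N - Phi n L| <= C / L.+1%:R) ->
  (forall n, Phi n @ \oo --> A n) -> (forall N, (fun n => Phi n N) @ \oo --> phi N) ->
  phi @ \oo --> S -> A @ \oo --> S.
Proof.
move=> hC hA hphi hS.
have hA' : \forall n \near \oo, forall L, (K0 <= L)%N -> `|A n - Phi n L| <= C / L.+1%:R.
  apply: filterS hC => n hn L hL.
  have h : (fun N => `|Phi n N - Phi n L|) @ \oo --> `|A n - Phi n L|.
    by apply: cvg_norm; apply: rcvgB (hA n) _; exact: cvg_cst.
  apply: (@ler_cvg_to _ _ _ _ _ (fun=> C / L.+1%:R) _ _ h); first exact: cvg_cst.
  by exists L => // N /= LN; exact: hn.
have C0 : 0 <= C.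
  case: hA' => n0 _ /(_ n0 (leqnn _) K0 (leqnn _)) h.
  have : 0 <= C / K0.+1%:R by apply: le_trans h.
  by rewrite pmulr_lge0 ?invr_gt0 ?ltr0n.
apply/cvgrPdist_le => e e0.
have e3 : 0 < e / 3 by apply: divr_gt0.
have [K2 hK2] := bound_mj_lt C0 e3.
have /cvgrPdist_le/(_ _ e3)[K3 _ hK3] := hS.
pose L := maxn (maxn K0 K2) K3.
have l0 : (K0 <= L)%N by rewrite /L -maxnA leq_maxl.
have l2 : C / L.+1%:R <= e / 3 by apply: hK2; rewrite /L maxnAC leq_maxr.
have l3 : `|S - phi L| <= e / 3 by apply: hK3; rewrite /= leq_maxr.
have /cvgrPdist_le/(_ _ e3) h4 := hphi L.
apply: filterS2 hA' h4 => n h1 h2.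
have {}h1 := le_trans (h1 L l0) l2.
have -> : S - A n = (S - phi L) + (phi L - Phi n L) - (A n - Phi n L) by ring.
apply: (le_trans (ler_normB _ _)).
have -> : e = e / 3 + e / 3 + e / 3 by field.
by apply: lerD => //; apply: (le_trans (ler_normD _ _)); exact: lerD.
Qed.

Lemma gam2_real (r s : R) : gam r%:C s%:C 2 = ((s ^+ 2 / 2 - (1 + r ^+ 2) / 24) / r)%:C.
Proof.
by rewrite !(rmorphN, rmorphD, rmorphM, rmorphXn, fmorphV, rmorph_nat, rmorph1).
Qed.

Lemma bound3 (p q r : R) : 0 <= p -> 0 <= q -> 0 <= r ->
  exists K, [/\ 1 <= K, p < K, q < K & r < K].
Proof. by move=> p0 q0 r0; exists (p + q + r + 1); split; lra. Qed.

Lemma half_bound (r : R) : 0 < r -> exists k, 0 < k <= 1 /\ k < r.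
Proof.
move=> r0; exists (Num.min (r / 2) 1); rewrite lt_min ge_min lexx orbT ltr01 divr_gt0//.
by split=> //; rewrite gt_min; apply/orP; left; lra.
Qed.

Section RealLimit.
Context (tau : nat -> R[i]) (om x y : R).
Context (cvg_tau : clim tau om%:C) (om_gt0 : 0 < om).
Context (tau_gt0 : forall n, 0 < Im (tau n)) (tauR_gt0 : forall n, 0 < Re (tau n)).
Context (x_gt0 : 0 < x) (x_le1 : x <= 1) (y_ge0 : 0 <= y) (y_lt1 : y < 1).

Definition shifted_pt (t : R[i]) : R[i] := (x - 2^-1)%:C * t + (y - 2^-1)%:C.

Lemma wptE t : (1 + t) / 2 + shifted_pt t = x%:C * t + y%:C.
Proof.
have e : (2^-1 : R)%:C = 2^-1 :> R[i] by rewrite fmorphV rmorph_nat.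
by rewrite /shifted_pt !rmorphB/= e; field.
Qed.

Lemma wptNE t : (1 + t) / 2 - shifted_pt t = (1 - x)%:C * t + (1 - y)%:C.
Proof.
have e : (2^-1 : R)%:C = 2^-1 :> R[i] by rewrite fmorphV rmorph_nat.
by rewrite /shifted_pt !rmorphB/= e rmorph1; field.
Qed.

(** With respect to [- t^-1] the point has coordinates [(1 - y, x)]. *)
Lemma wptVE t : t != 0 -> (1 + - t^-1) / 2 + shifted_pt t / t = x%:C + (y - 1)%:C / t.
Proof.
move=> t0; have e : (2^-1 : R)%:C = 2^-1 :> R[i] by rewrite fmorphV rmorph_nat.
by rewrite /shifted_pt !rmorphB/= e rmorph1; field.
Qed.

Lemma Re_lin_gt0 (r s : R) t : 0 <= r -> 0 <= s -> 0 < r + s -> 0 < Re t ->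
  0 < Re (r%:C * t + s%:C).
Proof.
move=> r0 s0 rs rt; rewrite ReD ReMr/=.
have [r1|r1] := ltP 0 r; first by rewrite ltr_wpDr// mulr_gt0.
have -> : r = 0 by apply/eqP; rewrite eq_le r0 r1.
by rewrite mul0r add0r; lra.
Qed.

(** For fixed [N], [Psi] is continuous up to the real point, and the uniform rate exchanges this
    limit with [N -> oo]. The bounds on [x] and [y] keep both q-product points in the upper and both
    [Psi] points in the right half-plane. *)
Lemma theta_limit (P P' : nat -> R[i]) (S : R) :
  (forall n, ccvg (qprod (x%:C * tau n + y%:C) (tau n)) (P n)) ->
  (forall n, ccvg (qprod (x%:C + (y - 1)%:C / tau n) (- (tau n)^-1)) (P' n)) ->
  (fun N => Re (Psi om%:C (shifted_pt om%:C) N - Psi om%:C (- shifted_pt om%:C) N)) @ \oo --> S ->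
  (fun n => ln (md (P n)) - ln (md (P' n))) @ \oo --> S.
Proof.
move=> hP hP' hS.
have x0 : 0 <= x by exact: ltW.
have [x1 y1] : 0 <= 1 - x /\ 0 <= 1 - y by split; rewrite subr_ge0// ltW.
have [xy xy1] : 0 < x + y /\ 0 < 1 - x + (1 - y).
  by rewrite ltr_wpDr// ltr_wpDl// subr_gt0.
have tn n : tau n != 0 by apply: tau_neq0.
have on : om%:C != 0 :> R[i] by apply: contraTneq om_gt0 => -[->]; rewrite ltxx.
have cw : clim (fun n => shifted_pt (tau n)) (shifted_pt om%:C) by rewrite /shifted_pt; clim_tac.
have cwN : clim (fun n => - shifted_pt (tau n)) (- shifted_pt om%:C) by clim_tac.
have ro : 0 < Re (om%:C : R[i]) by [].
have c1 N : clim (fun n => Psi (tau n) (shifted_pt (tau n)) N.+1) (Psi om%:C (shifted_pt om%:C) N.+1).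
  by apply: Psi_cvg => //; rewrite wptE; exact: Re_lin_gt0.
have c2 N : clim (fun n => Psi (tau n) (- shifted_pt (tau n)) N.+1) (Psi om%:C (- shifted_pt om%:C) N.+1).
  by apply: Psi_cvg => //; rewrite wptNE; exact: Re_lin_gt0.
pose Phi t N := Re (Psi t (shifted_pt t) N.+1 - Psi t (- shifted_pt t) N.+1).
pose Phi' n N := Phi (tau n) N.
pose A n := ln (md (P n)) - ln (md (P' n)).
pose B n := pi * Im (gam (tau n) (shifted_pt (tau n)) 2).
have lim n : (fun N => Phi' n N) @ \oo --> A n - B n.
  apply: theta_quot => //.
  - by rewrite wptE; exact: Re_lin_gt0.
  - by rewrite wptNE; exact: Re_lin_gt0.
  - by rewrite wptE ImD ImMr/= addr0 mulr_gt0.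
  - rewrite wptVE// ImD ImMr/= add0r.
    have hy : y - 1 < 0 by rewrite subr_lt0.
    have hi : Im (tau n)^-1 < 0.
      have hi := Im_Nv (tau_gt0 n).
      rewrite ImN oppr_gt0 in hi.
      exact: hi.
    by rewrite nmulr_lgt0.
  - by rewrite wptE.
  - by rewrite wptVE.
have Bc : B @ \oo --> (0 : R).
  apply: cvg_scale0.
  have : (fun n => Im (gam (tau n) (shifted_pt (tau n)) 2)) @ \oo --> Im (gam om%:C (shifted_pt om%:C) 2).
    (* The imaginary part is read off as the real part after multiplication by [- i]. *)
    have := ccvg_Re (climP (climM (clim_cst (- ci)) (gam_cvg cvg_tau cw ro 2))).
    by under eq_fun do rewrite ReM ReN ImN/= oppr0 mul0r sub0r mulN1r opprK; rewrite ReM ReN ImN/= oppr0 mul0r sub0r mulN1r opprK.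
  have -> : shifted_pt om%:C = ((x - 2^-1) * om + (y - 2^-1))%:C by rewrite /shifted_pt !(rmorphD, rmorphM).
  by rewrite gam2_real.
have Phic N : (fun n => Phi' n N) @ \oo --> Phi om%:C N.
  by apply/ccvg_Re/climP/climD => //; exact: climN.
have [K [K1 Ko KoV Kw]] : exists K, [/\ 1 <= K, md (om%:C : R[i]) < K, md (om%:C^-1 : R[i]) < K
    & md (shifted_pt om%:C) < K].
  by apply: bound3; exact: md_ge0.
have [k [k01 ko]] : exists k, 0 < k <= 1 /\ k < om.
  exact: half_bound.
have [C [K0 hC]] := Psi_cauchy K1 k01.
have ev (u : nat -> R) (l : R) : u @ \oo --> l -> forall c, l < c -> \forall n \near \oo, u n <= c.
  move=> hu c lc; have := @cvgr_le _ _ _ _ _ _ hu c lc; exact.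
have ev' (u : nat -> R) (l : R) : u @ \oo --> l -> forall c, c < l -> \forall n \near \oo, c <= u n.
  move=> hu c lc; have := @cvgr_ge _ _ _ _ _ _ hu c lc; exact.
have e1 := ev' _ _ (ccvg_Re (climP cvg_tau)) k ko.
have e2 := ev _ _ (ccvg_md (climP cvg_tau)) K Ko.
have e3 := ev _ _ (ccvg_md (climP (climV on cvg_tau))) K KoV.
have e4 := ev _ _ (ccvg_md (climP cw)) K Kw.
have hAB : (fun n => A n - B n) @ \oo --> S.
  apply: (@interchange_limit Phi' (fun N => Phi om%:C N) _ S (C + C) K0).
  - near=> n => L N hL LN; rewrite /Phi' /Phi -ReN -ReD.
    apply: (le_trans (ler_Re_md _)).
    have -> (a b c d : R[i]) : a - b - (c - d) = (a - c) - (b - d) by ring.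
    apply: (le_trans (ler_mdB _ _)); rewrite mulrDl.
    have hr : [/\ k <= Re (tau n), md (tau n) <= K, md (tau n)^-1 <= K & md (shifted_pt (tau n)) <= K].
      by split; near: n.
    case: hr => r1 r2 r3 r4; have LN' : (L.+1 <= N.+1)%N by [].
    have hL' : (K0 <= L.+1)%N by rewrite (leq_trans hL).
    have h1 := hC _ _ r1 r2 r3 r4 _ _ hL' LN'.
    rewrite -[md (shifted_pt _)]mdN in r4.
    have h2 := hC _ _ r1 r2 r3 r4 _ _ hL' LN'.
    have h3 : C / L.+2%:R <= C / L.+1%:R.
      have C0 : 0 <= C.
        have := le_trans (md_ge0 _) h1; by rewrite pmulr_lge0 ?invr_gt0 ?ltr0n.
      by rewrite ler_wpM2l// lef_pV2 ?posrE ?ltr0n// ler_nat.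
    by apply: lerD; apply: le_trans h3.
  - exact: lim.
  - exact: Phic.
  - by move: hS; rewrite -cvg_shiftS.
apply: (cvg_eqfun (rcvgD hAB Bc)); last by rewrite addr0.
by move=> n; rewrite subrK.
Unshelve. all: by end_near. Qed.

End RealLimit.
End Modular.

(** * Euler-Maclaurin expansion of arbitrary order *)

Section EMcoef.
Context {F : numFieldType}.
Implicit Types (om w : F).

Definition em_delta om (i : nat) : F :=
  (((1 + om) / 2) ^+ i + (- ((1 + om) / 2)) ^+ i
   - ((1 - om) / 2) ^+ i - (- ((1 - om) / 2)) ^+ i) / i`!%:R.

Lemma dl0 om : em_delta om 0 = 0. Proof. by rewrite /em_delta !expr0; ring. Qed.
Lemma dl1 om : em_delta om 1 = 0. Proof. by rewrite /em_delta !expr1; ring. Qed.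
Lemma dl2 om : em_delta om 2 = om. Proof. by rewrite /em_delta -[2`!]/2%N; field. Qed.

(* Triangular system for the coefficients of
   [X^2 exp(w X) / (4 sinh(X/2) sinh(om X/2))], which [gam] lists up to order 3;
   [em_delta] are those of [4 sinh(X/2) sinh(om X/2)]. *)
Fixpoint emseq om w n : seq F :=
  if n is m.+1 then
    rcons (emseq om w m)
      ((w ^+ m / m`!%:R - \sum_(j < m) em_delta om (m.+2 - j)%N * (emseq om w m)`_j) / om)
  else [::].

Definition em_coef om w j : F := (emseq om w j.+1)`_j.

Lemma size_emseq om w n : size (emseq om w n) = n.
Proof. by elim: n => //= n IH; rewrite size_rcons IH. Qed.

Lemma nth_emseq om w n j : (j < n)%N -> (emseq om w n)`_j = em_coef om w j.
Proof.
elim: n => // n IH; rewrite ltnS leq_eqVlt => /predU1P[->//|jn].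
by rewrite [emseq _ _ _]/= nth_rcons size_emseq jn IH.
Qed.

Lemma em_rec om w m : om != 0 ->
  \sum_(j < m.+1) em_delta om (m.+2 - j)%N * em_coef om w j = w ^+ m / m`!%:R.
Proof.
move=> om0; rewrite big_ord_recr/=.
have -> : (m.+2 - m = 2)%N by rewrite -addn2 addKn.
rewrite dl2 {2}/em_coef [emseq _ _ _]/= nth_rcons size_emseq ltnn eqxx.
have -> : \sum_(j < m) em_delta om (m.+2 - j) * (emseq om w m)`_j =
   \sum_(j < m) em_delta om (m.+2 - j) * em_coef om w j.
  by apply: eq_bigr => j _; rewrite nth_emseq.
by rewrite [om * _]mulrC divfK// addrC subrK.
Qed.

(** The cancellation of [gam_cancel] at any order: passing from [J] to [J + 1] adds only terms in
    [e J.+2], and [em_rec] evaluates their coefficient. *)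
Lemma em_sum om w (e : nat -> F) J : om != 0 ->
  \sum_(j < J) em_coef om w j * \sum_(i < J.+2 - j) e (j + i)%N * em_delta om i =
  \sum_(k < J) e k.+2 * (w ^+ k / k`!%:R).
Proof.
move=> om0; elim: J => [|J IH]; first by rewrite !big_ord0.
rewrite [RHS]big_ord_recr/= -IH big_ord_recr/= -(em_rec w J om0) big_ord_recr/=.
rewrite -[in \sum_(i < J.+3 - J) _](addn3 J) addKn !big_ord_recr/= big_ord0 dl0 dl1.
have -> : (J.+2 - J = 2)%N by rewrite -addn2 addKn.
rewrite dl2 addn2 [in RHS]mulrDr mulr_sumr addrA -big_split/=.
have -> : forall x y : F, x + em_coef om w J * (0 + e (J + 0)%N * 0 + e (J + 1)%N * 0 + y * om) =
   x + y * (om * em_coef om w J) by move=> x y; ring.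
congr (_ + _); apply: eq_bigr => j _.
have jJ : (j <= J.+2)%N by rewrite (leq_trans (ltnW (ltn_ord j)))// (leq_trans (leqnSn _)).
by rewrite subSn// big_ord_recr/= subnKC//; ring.
Qed.

End EMcoef.

Section EM.
Context {R : realType}.

Lemma gam_em (om w : R[i]) j : om != 0 -> (j < 4)%N -> gam om w j = em_coef om w j.
Proof.
move=> om0; have [r0 r1 r2 r3] := And4 (em_rec w 0 om0) (em_rec w 1 om0) (em_rec w 2 om0) (em_rec w 3 om0).
rewrite !big_ord_recr !big_ord0/= in r0 r1 r2 r3.
have d3 : em_delta om 3 = 0 by rewrite /em_delta; field.
have d4 : em_delta om 4 = om * (1 + om ^+ 2) / 24 by rewrite /em_delta -[4`!]/24%N; field.
have d5 : em_delta om 5 = 0 by rewrite /em_delta; field.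
rewrite !(dl2, d3, d4, d5) in r0 r1 r2 r3.
have s0 : em_coef om w 0 = om^-1.
  apply: (mulfI om0); rewrite mulfV//; transitivity (w ^+ 0 / 0`!%:R); first by rewrite -r0; ring.
  by rewrite expr0 fact0 divr1.
have s1 : em_coef om w 1 = w / om.
  apply: (mulfI om0); transitivity (w ^+ 1 / 1`!%:R); first by rewrite -r1; ring.
  by rewrite expr1 divr1 mulrC divfK.
have s2 : em_coef om w 2 = (w ^+ 2 / 2 - (1 + om ^+ 2) / 24) / om.
  apply: (mulfI om0); transitivity (w ^+ 2 / 2`!%:R - om * (1 + om ^+ 2) / 24 * em_coef om w 0).
    by rewrite -r2; ring.
  by rewrite s0 -[2`!]/2%N; field.
have s3 : em_coef om w 3 = (w ^+ 3 / 6 - w * (1 + om ^+ 2) / 24) / om.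
  apply: (mulfI om0); transitivity (w ^+ 3 / 3`!%:R - om * (1 + om ^+ 2) / 24 * em_coef om w 1).
    by rewrite -r3; ring.
  by rewrite s1 -[3`!]/6%N; field.
by case: j => [|[|[|[|j]]]] //= _.
Qed.

Lemma md_sum4 (x y z t : R[i]) (M : R) : md x <= M -> md y <= M -> md z <= M ->
  md t <= M -> md (x + y - z - t) <= M + M + M + M.
Proof.
move=> hx hy hz ht; apply: (le_trans (ler_mdB _ _)); apply: lerD ht.
apply: (le_trans (ler_mdB _ _)); apply: lerD hz.
by apply: (le_trans (ler_mdD _ _)); apply: lerD.
Qed.

Lemma cD_affine (g : R -> R[i]) (m al x : R) l : cD g (m + al * x) l ->
  cD (fun y => g (m + al * y)) x (al%:C * l).
Proof.
move=> [h1 h2].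
have ha : is_derive x 1 (fun y : R => m + al * y) al.
  have := is_deriveD (is_derive_cst m x 1) (is_deriveZ al (is_derive_id x (1 : R))).
  by rewrite add0r /GRing.scale/= mulr1.
split.
  have := @is_derive1_comp _ (fun y => Re (g y)) (fun y => m + al * y) x _ _ h1 ha.
  by rewrite ReMr mulrC.
have := @is_derive1_comp _ (fun y => Im (g y)) (fun y => m + al * y) x _ _ h2 ha.
by rewrite ImMr mulrC.
Qed.

Lemma chain_taylor (e : nat -> R -> R[i]) (n j : nat) (m al M : R) :
  (forall i u, 0 < u -> cD (e i) u (e i.+1 u)) ->
  (forall x, 0 <= x <= 1 -> 0 < m + al * x) ->
  (forall x, 0 <= x <= 1 -> md (e (j + n)%N (m + al * x)) <= M) ->
  md (e j (m + al) - \sum_(i < n) e (j + i)%N m * (al%:C ^+ i / i`!%:R)) <=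
    2 * (`|al| ^+ n * M).
Proof.
move=> he hp hM.
have := @taylor_bound R n (fun i x => al%:C ^+ i * e (j + i)%N (m + al * x)) (`|al| ^+ n * M).
rewrite mulr1 expr0 mul1r addn0.
under eq_bigr => i _.
  have -> : al%:C ^+ i * e (j + i)%N (m + al * 0) / i`!%:R =
     e (j + i)%N m * (al%:C ^+ i / i`!%:R) by rewrite mulr0 addr0; ring.
  over.
apply.
  move=> i x _ hx; rewrite exprSr -mulrA; apply: cDZ.
  by rewrite addnS; apply: cD_affine; apply: he; exact: hp.
move=> x hx; rewrite mdM mdX md_real ler_wpM2l ?exprn_ge0//; exact: hM.
Qed.

Context (om w : R) (om_gt0 : 0 < om) (J : nat).

Let om0 : om%:C != 0 :> R[i].
Proof. by apply: contraTneq om_gt0 => -[->]; rewrite ltxx. Qed.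

Let g j : R[i] := em_coef om%:C w%:C j.
Let c : R := (1 + om) / 2.
Let c0 : R := c + `|w|.
(** [32 = 2 * 16]: the factor of the Taylor bound, and [2 ^ 4] from evaluating the last derivative
    at no less than half the midpoint. [128] counts four corners. *)
Let CJ : R := 32 * c0 ^+ J + \sum_(j < J) md (g j) * (128 * c0 ^+ (J.+2 - j)).

Let c0_ge0 : 0 <= c0.
Proof. by rewrite addr_ge0// divr_ge0// addr_ge0// ltW. Qed.

Let CJ_ge0 : 0 <= CJ.
Proof.
rewrite addr_ge0 ?mulr_ge0 ?exprn_ge0//; apply: sumr_ge0 => j _.
by rewrite !mulr_ge0 ?exprn_ge0 ?md_ge0.
Qed.

Definition emD (e : R -> R[i]) (n : R) : R[i] :=
  e n - e (n + 1) - e (n + om) + e (n + 1 + om).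

(* [e] is a sequence of functions, each the derivative of the preceding one;
   [e 2] is summed over a box, and the corner terms make the sum converge. *)
Definition emV (e : nat -> R -> R[i]) N : R[i] :=
  \sum_(0 <= i < N) \sum_(0 <= j < N) e 2%N (c + w + (i%:R + j%:R * om))
  + \sum_(j < J) g j * (e j N%:R + e j (N%:R * om) - e j (N%:R + N%:R * om)).

Definition emrho (e : nat -> R -> R[i]) n : R[i] :=
  e 2%N (c + w + n) - \sum_(j < J) g j * emD (e j) n.

Lemma emV_rho e N : emV e N =
  \sum_(0 <= i < N) \sum_(0 <= j < N) emrho e (i%:R + j%:R * om) + \sum_(j < J) g j * e j 0.
Proof.
have E : \sum_(0 <= i < N) \sum_(0 <= j < N) \sum_(k < J) g k * emD (e k) (i%:R + j%:R * om) =
    \sum_(k < J) g k * (e k 0 - e k N%:R - e k (N%:R * om) + e k (N%:R + N%:R * om)).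
  under eq_bigr do rewrite exchange_big/=.
  rewrite exchange_big/=; apply: eq_bigr => k _.
  have := telescope2 (e k) om 0 N N; rewrite !add0r => <-.
  rewrite mulr_sumr; apply: eq_bigr => i _; rewrite mulr_sumr; apply: eq_bigr => j _.
  by rewrite add0r.
rewrite /emV /emrho; under [X in _ = X + _]eq_bigr do rewrite sumrB.
rewrite sumrB E -!addrA; congr (_ + _).
rewrite addrC -sumrB; apply: eq_bigr => k _; ring.
Qed.

Section Bound.
Context (e : nat -> R -> R[i]) (B : R).
Context (he : forall i u, 0 < u -> cD (e i) u (e i.+1 u)).
Context (hB : forall u, 1 <= u -> md (e J.+2 u) <= B / u ^+ 4).

Let B_ge0 : 0 <= B.
Proof. by have := le_trans (md_ge0 _) (hB (lexx 1)); rewrite expr1n divr1. Qed.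

Let tl (m al : R) j : (j <= J.+2)%N -> 2 * c0 + 2 <= m -> `|al| <= c0 ->
  md (e j (m + al) - \sum_(i < J.+2 - j) e (j + i)%N m * (al%:C ^+ i / i`!%:R)) <=
  32 * c0 ^+ (J.+2 - j) * (B / m ^+ 4).
Proof.
move=> jJ hm hal.
have hx x : 0 <= x <= 1 -> m / 2 <= m + al * x.
  move=> /andP[x0 x1].
  have : `|al * x| <= c0.
    by rewrite normrM (ger0_norm x0) (le_trans _ hal)// ler_piMr.
  by rewrite ler_norml => /andP[h _]; have := c0_ge0; lra.
have m2 : 1 <= m / 2 by have := c0_ge0; lra.
have m0 : 0 < m by lra.
apply: (le_trans (@chain_taylor e _ _ m al (16 * (B / m ^+ 4)) he _ _)).
- by move=> x /hx; lra.
- move=> x /hx h; rewrite subnKC//; apply: (le_trans (hB (le_trans m2 h))).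
  have -> : 16 * (B / m ^+ 4) = B / (m / 2) ^+ 4 by field; rewrite gt_eqF.
  rewrite ler_wpM2l// lef_pV2 ?posrE ?exprn_gt0//; [|lra..].
  by rewrite lerXn2r// nnegrE; lra.
have -> : 2 * (`|al| ^+ (J.+2 - j) * (16 * (B / m ^+ 4))) =
   32 * `|al| ^+ (J.+2 - j) * (B / m ^+ 4) by ring.
rewrite ler_wpM2r ?divr_ge0 ?exprn_ge0 ?(ltW m0)// ler_wpM2l//.
by rewrite lerXn2r ?nnegrE.
Qed.

Lemma emrho_bound n : 2 * c0 + 2 <= c + n -> md (emrho e n) <= CJ * (B / (c + n) ^+ 4).
Proof.
move=> hm; set m := c + n in hm *.
have c1 : `|c| <= c0.
  rewrite /c0 ger0_norm; first by rewrite lerDl.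
  by rewrite divr_ge0// addr_ge0// ltW.
have c2 : `|(1 - om) / 2| <= c0.
  apply: le_trans c1; rewrite /c !normrM ler_wpM2r//.
  by apply: (le_trans (ler_normB _ _)); rewrite (ger0_norm (ltW om_gt0)) normr1 ger0_norm// addr_ge0// ltW.
have cw : `|w| <= c0 by rewrite lerDr divr_ge0// addr_ge0// ltW.
pose T j (al : R) := \sum_(i < J.+2 - j) e (j + i)%N m * (al%:C ^+ i / i`!%:R).
pose D j (al : R) := e j (m + al) - T j al.
have hD j al : (j <= J.+2)%N -> `|al| <= c0 -> md (D j al) <= 32 * c0 ^+ (J.+2 - j) * (B / m ^+ 4).
  by move=> h1 h2; exact: tl.
have E1 : e 2%N (c + w + n) = D 2%N w + T 2%N w.
  by rewrite /D subrK; congr e; rewrite /m; ring.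
have E2 j : emD (e j) n = (D j c + D j (- c) - D j ((1 - om) / 2) - D j (- ((1 - om) / 2)))
   + (T j c + T j (- c) - T j ((1 - om) / 2) - T j (- ((1 - om) / 2))).
  rewrite /emD /D.
  have -> : n = m + - c by rewrite /m; ring.
  have -> : m - c + 1 = m + (1 - om) / 2 by rewrite /c; field.
  have -> : m - c + om = m + - ((1 - om) / 2) by rewrite /c; field.
  have -> : m + (1 - om) / 2 + om = m + c by rewrite /c; field.
  move: (e j _) (e j _) (e j _) (e j _) (T j _) (T j _) (T j _) (T j _).
  by move=> a1 a2 a3 a4 b1 b2 b3 b4; ring.
have E3 j : T j c + T j (- c) - T j ((1 - om) / 2) - T j (- ((1 - om) / 2)) =
   \sum_(i < J.+2 - j) e (j + i)%N m * em_delta om%:C i.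
  rewrite /T -big_split/= -!sumrB; apply: eq_bigr => i _.
  rewrite /em_delta /c !(rmorphN, rmorphD, rmorphM, fmorphV, rmorph_nat, rmorph1)/=; ring.
have E : emrho e n = D 2%N w - \sum_(j < J) g j *
    (D j c + D j (- c) - D j ((1 - om) / 2) - D j (- ((1 - om) / 2))).
  rewrite /emrho E1.
  rewrite (eq_bigr (fun j : 'I_J => g j *
    (D j c + D j (- c) - D j ((1 - om) / 2) - D j (- ((1 - om) / 2))) +
    g j * \sum_(i < J.+2 - j) e (j + i)%N m * em_delta om%:C i)); last first.
    by move=> j _; rewrite -E3 -mulrDr -E2.
  rewrite big_split/= (em_sum w%:C (fun k => e k m) J om0).
  have -> : T 2%N w = \sum_(k < J) e k.+2 m * (w%:C ^+ k / k`!%:R).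
    by rewrite /T subSS subSS subn0; apply: eq_bigr.
  ring.
rewrite E /CJ [in leRHS]mulrDl; apply: (le_trans (ler_mdB _ _)); apply: lerD.
  by have := hD 2%N w isT cw; rewrite subSS subSS subn0.
rewrite mulr_suml; apply: (le_trans (ler_md_sum _ _ _)); apply: ler_sum => j _.
have jJ : (j <= J.+2)%N by rewrite (leq_trans (ltnW (ltn_ord j)))// (leq_trans (leqnSn _)).
rewrite mdM -mulrA ler_wpM2l ?md_ge0//.
have h1 := hD j c jJ c1; have h2 := hD j (- c) jJ; rewrite normrN in h2; have {}h2 := h2 c1.
have h3 := hD j _ jJ c2; have h4 := hD j (- ((1 - om) / 2)) jJ; rewrite normrN in h4; have {}h4 := h4 c2.
have -> : 128 * c0 ^+ (J.+2 - j) * (B / m ^+ 4) =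
  32 * c0 ^+ (J.+2 - j) * (B / m ^+ 4) + 32 * c0 ^+ (J.+2 - j) * (B / m ^+ 4) +
  32 * c0 ^+ (J.+2 - j) * (B / m ^+ 4) + 32 * c0 ^+ (J.+2 - j) * (B / m ^+ 4) by ring.
exact: md_sum4.
Qed.

End Bound.

(** [C] and [K0] are chosen before the chain [e], which enters through [B] alone; hence all Taylor
    coefficients in [s] can be treated at once. *)
Lemma emV_cauchy : exists C K0, 0 <= C /\ forall e B,
  (forall i u, 0 < u -> cD (e i) u (e i.+1 u)) ->
  (forall u, 1 <= u -> md (e J.+2 u) <= B / u ^+ 4) ->
  forall L N, (K0 <= L)%N -> (L <= N)%N -> md (emV e N - emV e L) <= C * B / L.+1%:R.
Proof.
have [k [/andP[k0 k1] ko]] := half_bound om_gt0.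
pose K0 := Num.bound ((2 * c0 + 2) / (k / 2)).
have hK0 : (2 * c0 + 2) / (k / 2) < K0%:R.
  by apply: archi_boundP; rewrite divr_ge0//; have := c0_ge0; lra.
pose C := CJ * (4 / (k / 2) ^+ 4).
have C0 : 0 <= C by rewrite mulr_ge0// divr_ge0// exprn_ge0// divr_ge0// ltW.
exists (2 * C), K0; split=> [|e B he hB L N hL LN]; first by rewrite mulr_ge0.
have B0 : 0 <= B by have := le_trans (md_ge0 _) (hB _ (lexx 1)); rewrite expr1n divr1.
rewrite !emV_rho opprD addrACA subrr addr0 -[2 * C * B]mulrA.
apply: (@rect_bound _ _ (C * B) K0) => //; first exact: mulr_ge0.
move=> i j hij.
have i0 : 0 <= i%:R :> R by [].
have j0 : 0 <= j%:R :> R by [].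
have rm : k / 2 * (1 + i%:R + j%:R) <= c + (i%:R + j%:R * om).
  rewrite /c; nra.
have h2K : 2 * c0 + 2 <= c + (i%:R + j%:R * om).
  apply: le_trans rm; rewrite -ler_pdivrMl; last by lra.
  rewrite mulrC (le_trans (ltW hK0))//.
  by case/orP: hij => hh; rewrite -(ler_nat R) in hh; lra.
apply: (le_trans (emrho_bound he hB h2K)).
have k2 : 0 < k / 2 by lra.
have q := quartic_mj k2 rm.
have -> : C * B * (mj i * mj j) = CJ * (B * (4 / (k / 2) ^+ 4 * (mj i * mj j))) by rewrite /C; ring.
by rewrite !ler_wpM2l// -[_ ^-1]div1r.
Qed.

End EM.

(** * Power series *)

Section PS.
Context {R : realType}.
Implicit Types (a s h : R[i]) (c d : nat -> R[i]).

Definition ps (f : R[i] -> R[i]) c (r : R) : Prop :=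
  forall h, md h < r -> clim (fun n => \sum_(k < n) c k * h ^+ k) (f h).

(** On coefficient sequences [shift_seq] is multiplication by the variable [h], [mulop a]
    multiplication by [a - h], and [divop a] division by it. *)
Definition shift_seq c k : R[i] := if k is k'.+1 then c k' else 0.
Definition mulop a c k : R[i] := a * c k - shift_seq c k.
Fixpoint divop a c k : R[i] := (c k + (if k is k'.+1 then divop a c k' else 0)) / a.

Lemma mulop_divop a c : a != 0 -> mulop a (divop a c) = c.
Proof.
move=> a0; apply/funext => -[|k]; rewrite /mulop /=; first by field.
by rewrite mulrC divfK// addrK.
Qed.

Lemma climS (u : nat -> R[i]) l : clim (fun n => u n.+1) l <-> clim u l.
Proof.
split=> -[h]; split; first by rewrite -cvg_shiftS.
by have := h; rewrite -cvg_shiftS.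
Qed.

Lemma clim_ext (u v : nat -> R[i]) l : clim u l -> u =1 v -> clim v l.
Proof. by move=> h /funext <-. Qed.

Lemma clim_term c h l : clim (fun n => \sum_(k < n) c k * h ^+ k) l ->
  clim (fun n => c n * h ^+ n) 0.
Proof.
move=> H; rewrite -(subrr l).
apply: clim_ext (climD (proj2 (climS _ _) H) (climN H)) _ => n.
by rewrite big_ord_recr/= addrAC subrr add0r.
Qed.

Lemma mulop_sum a c h n : \sum_(k < n.+1) mulop a c k * h ^+ k =
  (a - h) * (\sum_(k < n.+1) c k * h ^+ k) + h * (c n * h ^+ n).
Proof.
elim: n => [|n IH]; first by rewrite !big_ord_recr !big_ord0 /mulop/=; ring.
rewrite big_ord_recr/= IH [in RHS]big_ord_recr/= /mulop/= !exprS; ring.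
Qed.

Lemma ps_mul a f c r : ps f c r -> ps (fun h => (a - h) * f h) (mulop a c) r.
Proof.
move=> H h hr; have {}H := H h hr; apply/climS.
have -> : (a - h) * f h = (a - h) * f h + h * 0 by ring.
apply: clim_ext (climD (climM (clim_cst (a - h)) (proj2 (climS _ _) H)) (climM (clim_cst h) (clim_term H))) _.
by move=> n; rewrite mulop_sum.
Qed.

Lemma contraction0 (q : R) (x y : nat -> R) : 0 <= q < 1 -> (forall n, 0 <= x n) ->
  (forall n, x n.+1 <= q * x n + y n) -> y @ \oo --> (0 : R) -> x @ \oo --> (0 : R).
Proof.
move=> /andP[q0 q1] x0 hx hy; apply/cvgr0Pnorm_le => e e0.
have e1 : 0 < e / 2 * (1 - q) by rewrite mulr_gt0 ?divr_gt0 ?subr_gt0.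
have /cvgr0Pnorm_le/(_ _ e1)[N _ HN] := hy.
have step m : x (N + m)%N <= q ^+ m * x N + e / 2.
  elim: m => [|m IH]; first by rewrite addn0 expr0 mul1r lerDl ltW// divr_gt0.
  rewrite addnS; apply: (le_trans (hx _)).
  have h1 := HN (N + m)%N (leq_addr _ _); rewrite /= in h1.
  have h2 := le_trans (ler_norm _) h1.
  have h3 := ler_wpM2l q0 IH.
  have -> : q ^+ m.+1 * x N + e / 2 = q * (q ^+ m * x N + e / 2) + e / 2 * (1 - q).
    by rewrite exprS; ring.
  exact: lerD.
have hq : (fun m => x N * q ^+ m) @ \oo --> (0 : R).
  by apply: cvg_scale0; apply: cvg_expr; rewrite ger0_norm.
have e2 : 0 < e / 2 by rewrite divr_gt0.
have /cvgr0Pnorm_le/(_ _ e2)[M _ HM] := hq.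
exists (N + M)%N => // n /= hn.
have -> : n = (N + (n - N))%N by rewrite subnKC// (leq_trans (leq_addr _ _) hn).
rewrite ger0_norm//; apply: (le_trans (step _)).
have h1 := HM (n - N)%N; rewrite /= leq_subRL ?(leq_trans (leq_addr _ _) hn)// in h1.
have := le_trans (ler_norm _) (h1 hn); rewrite mulrC => h2.
by rewrite [leRHS]splitr lerD2r.
Qed.

(** The partial sums for [d] are those for [mulop a d] divided by [a - h], up to a multiple of
    [d n * h ^+ n]. This term satisfies a recursion of ratio [h / a], of modulus below 1, with
    inhomogeneity tending to 0. *)
Lemma ps_div a f d r : r <= md a -> ps f (mulop a d) r ->
  ps (fun h => f h / (a - h)) d r.
Proof.
move=> ra H h hr; have {}H := H h hr.
have ah : a - h != 0.
  rewrite subr_eq0; apply: contraTneq hr => <-; by rewrite -leNgt.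
have a0 : 0 < md a by apply: le_lt_trans (md_ge0 h) (lt_le_trans hr ra).
have an : a != 0 by rewrite -md_gt0.
have x0 : clim (fun n => d n * h ^+ n) 0.
  split; apply/ccvgP; under eq_fun do rewrite subr0.
  pose q := md h / md a.
  have hq : 0 <= q < 1.
    by rewrite divr_ge0 ?md_ge0//= ltr_pdivrMr// mul1r (lt_le_trans hr).
  apply: (@contraction0 q _ (fun n => md (mulop a d n.+1 * h ^+ n.+1) / md a)) => //.
  - by move=> n; rewrite md_ge0.
  - move=> n; have -> : d n.+1 * h ^+ n.+1 =
       h / a * (d n * h ^+ n) + mulop a d n.+1 * h ^+ n.+1 / a.
      by rewrite /mulop/= exprS; field.
    by apply: (le_trans (ler_mdD _ _)); rewrite mdM [md (h / a)]mdM mdV [md (_ / a)]mdM mdV.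
  - under eq_fun do rewrite mulrC; apply: cvg_scale0.
    have [/ccvgP] := proj2 (climS (fun n => mulop a d n * h ^+ n) 0) (clim_term H).
    by under eq_fun do rewrite subr0.
apply/climS.
have -> : f h / (a - h) = (a - h)^-1 * (f h - h * 0) by rewrite mulr0 subr0 mulrC.
apply: clim_ext (climM (clim_cst (a - h)^-1) (climD (proj2 (climS _ _) H)
  (climN (climM (clim_cst h) x0)))) _.
by move=> n; rewrite mulop_sum addrK mulrA mulVf// mul1r.
Qed.

Lemma cD_sum (I : Type) (r : seq I) (f : I -> R -> R[i]) x (l : I -> R[i]) :
  (forall i, cD (f i) x (l i)) -> cD (fun y => \sum_(i <- r) f i y) x (\sum_(i <- r) l i).
Proof.
move=> h; elim: r => [|i r IH].
  by apply: cD_ext (cD_eq (cD_cst 0 x) _) _ => [|y]; rewrite ?big_nil.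
by apply: cD_ext (cD_eq (cDD (h i) IH) _) _ => [|y]; rewrite ?big_cons.
Qed.

Lemma cD_powfact (a : R[i]) x k :
  cD (fun y => (a * y%:C) ^+ k / k`!%:R) x (a * shift_seq (fun i => (a * x%:C) ^+ i / i`!%:R) k).
Proof.
elim: k => [|k IH] /=.
  by rewrite mulr0; apply: cD_ext (cD_cst 1 x) _ => y; rewrite expr0 fact0 divr1.
have hk : (k.+1%:R : R[i]) != 0 by rewrite pnatr_eq0.
have kap_fun : (k`!%:R : R[i]) != 0 by rewrite pnatr_eq0 -lt0n fact_gt0.
have h := cDZ (k.+1%:R^-1) (cDM (cDZ a (cD_id x)) IH).
apply: cD_ext (cD_eq h _) _ => [|y]; last first.
  rewrite factS natrM exprS; move: (_ ^+ k) => z.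
  by move: (k.+1%:R : R[i]) hk (k`!%:R : R[i]) kap_fun => p p0 q q0; field; rewrite p0 q0.
case: k IH hk kap_fun {h} => [|k] IH hk kap_fun /=.
  by rewrite expr0 fact0; field.
have kf' : (k`!%:R : R[i]) != 0 by rewrite pnatr_eq0 -lt0n fact_gt0.
have hk' : (k.+1%:R : R[i]) != 0 by rewrite pnatr_eq0.
rewrite factS natrM !exprS; move: (_ ^+ k) => z.
have e2 : k.+2%:R = k.+1%:R + 1 :> R[i] by rewrite natr1.
rewrite e2 in hk *.
move: (k.+1%:R : R[i]) hk hk' (k`!%:R : R[i]) kf' => p p1 p0 q q0.
by field; rewrite p1 p0 q0.
Qed.

(** The product of [exp(- a y)] with the partial sum has derivative [- a exp(- a y) (a y)^n / n!],
    which tends to 0 uniformly on [[0, 1]]; its value at 0 is 1. *)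
Lemma clim_cexp (a : R[i]) : clim (fun n => \sum_(k < n) a ^+ k / k`!%:R) (cexp a).
Proof.
pose S n (y : R) := \sum_(k < n) (a * y%:C) ^+ k / k`!%:R.
pose F n (y : R) := cexp (- a * y%:C) * S n.+1 y.
have dS n x : cD (S n.+1) x (a * S n x).
  have := cD_sum (index_enum _) (fun k : 'I_n.+1 => cD_powfact a x k).
  rewrite /S -mulr_sumr big_ord_recl/= add0r; exact.
have dF n x : cD (F n) x (- a * cexp (- a * x%:C) * ((a * x%:C) ^+ n / n`!%:R)).
  have h := cDM (cD_cexp (cDZ (- a) (cD_id x))) (dS n x).
  apply: cD_eq h _; rewrite /S big_ord_recr/=; ring.
pose M := md a * expR (md a).
have bnd n : md (F n 1 - 1) <= 2 * (M * (md a ^+ n / n`!%:R)).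
  have := @taylor_bound R 1 (fun i x => if i is 0 then F n x else
     - a * cexp (- a * x%:C) * ((a * x%:C) ^+ n / n`!%:R)) (M * (md a ^+ n / n`!%:R)).
  have F0 : F n 0 = 1.
    rewrite /F /S mulr0 cexp0 mul1r mulr0 big_ord_recl/= expr0 fact0 divr1 big1 ?addr0//.
    by move=> i _; rewrite expr0n/= mul0r.
  rewrite big_ord_recl big_ord0/= F0 fact0 divr1 addr0; apply.
    by move=> [|i] x // _ _; exact: dF.
  move=> x /andP[x0 x1]; rewrite mdM (mdM (- a)) mdN (mdM (_ ^+ n)) mdV md_nat mdX (mdM a) md_real ger0_norm//.
  apply: ler_pM; rewrite ?mulr_ge0 ?md_ge0 ?exprn_ge0 ?invr_ge0 ?ler0n ?mulr_ge0 ?md_ge0//.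
    rewrite ler_wpM2l ?md_ge0// cexp_md ler_expR.
    apply: (le_trans (ler_norm _)); apply: (le_trans (ler_Re_md _)).
    by rewrite (mdM (- a)) mdN md_real ger0_norm// ler_piMr ?md_ge0.
  rewrite ler_wpM2r ?invr_ge0 ?ler0n// lerXn2r ?nnegrE ?mulr_ge0 ?md_ge0//.
  by rewrite ler_piMr ?md_ge0.
have z : (fun n => 2 * (M * (md a ^+ n / n`!%:R))) @ \oo --> (0 : R).
  apply: cvg_scale0; apply: cvg_scale0.
  exact: cvg_exp_coeff.
have c1 : clim (fun n => F n 1) 1.
  split; apply/ccvgP; apply: cvg0_squeeze z => n; by rewrite md_ge0/= bnd.
apply/climS; rewrite -[cexp a]mulr1.
apply: clim_ext (climM (clim_cst (cexp a)) c1) _ => n.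
rewrite /F /S !mulr1 mulrA -cexpD addrN cexp0 mul1r; by [].
Qed.

End PS.

(** * Taylor expansion in [s] of powers, their primitives and their derivatives *)

Section Kap.
Context {R : realType}.
Implicit Types (a s h : R[i]) (c d : nat -> R[i]) (u r : R).

Definition conv (ka c : nat -> R[i]) k : R[i] := \sum_(i < k.+1) ka i * c (k - i)%N.

Lemma conv_mulop a ka c : conv (mulop a ka) c = mulop a (conv ka c).
Proof.
apply/funext => k; rewrite /conv /mulop mulr_sumr.
have -> : shift_seq (fun k => \sum_(i < k.+1) ka i * c (k - i)%N) k =
   \sum_(i < k.+1) shift_seq ka i * c (k - i)%N.
  case: k => [|k]; first by rewrite big_ord_recl big_ord0/= mul0r addr0.
  rewrite [RHS]big_ord_recl/= mul0r add0r; apply: eq_bigr => i _.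
  by rewrite /= /bump/= add1n subSS.
by rewrite -sumrB; apply: eq_bigr => i _; rewrite mulrBl mulrA.
Qed.

Lemma conv_sh ka c : conv ka (shift_seq c) = shift_seq (conv ka c).
Proof.
apply/funext => -[|k]; rewrite /conv/=; first by rewrite big_ord_recl big_ord0/= mulr0 addr0.
rewrite big_ord_recr/= subnn/= mulr0 addr0; apply: eq_bigr => i _.
by rewrite subSn// -ltnS.
Qed.

Definition unit0 k : R[i] := if k is 0 then 1 else 0.

Lemma conv_unit0 c : conv unit0 c = c.
Proof.
apply/funext => k; rewrite /conv big_ord_recl/= mul1r subn0 big1 ?addr0// => i _.
by rewrite mul0r.
Qed.

(* Taylor coefficients at [s] of [kap_fun], the factor of [u ^ (2 - s - j)] in
   the [j]-th member of the chain of derivatives around [u ^ (- s)]. *)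
Fixpoint kap s j : nat -> R[i] :=
  match j with
  | 0 => divop (2 - s) (divop (1 - s) unit0)
  | 1 => divop (1 - s) unit0
  | 2 => unit0
  | j'.+1 => mulop (2 - s - j'%:R) (kap s j')
  end.

Fixpoint kap_fun s j : R[i] :=
  match j with
  | 0 => 1 / (1 - s) / (2 - s)
  | 1 => 1 / (1 - s)
  | 2 => 1
  | j'.+1 => (2 - s - j'%:R) * kap_fun s j'
  end.

Lemma kapS s j : s != 1 -> s != 2 -> kap s j.+1 = mulop (2 - s - j%:R) (kap s j).
Proof.
move=> s1 s2; case: j => [|[|j]] //; rewrite [LHS]/= [kap _ _]/=.
  by rewrite subr0 mulop_divop// subr_eq0 eq_sym.
have -> : 2 - s - 1 = 1 - s by ring.
by rewrite mulop_divop// subr_eq0 eq_sym.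
Qed.

Definition ell u k : R[i] := (- (ln u)%:C) ^+ k / k`!%:R.

Lemma ell_ps u r : ps (fun h => cexp (- (ln u)%:C * h)) (ell u) r.
Proof.
move=> h _; apply: clim_ext (clim_cexp _) _ => n; apply: eq_bigr => k _.
by rewrite exprMn /ell mulrAC.
Qed.

Lemma ps_ext f g c r : ps f c r -> f =1 g -> ps g c r.
Proof. by move=> h /funext <-. Qed.

(** Index 2 is the exponential series. Higher indices are reached by multiplying with linear
    factors, the two lower ones by dividing; only the divisions restrict the radius. *)
Lemma kap_ps s j u r : s != 1 -> s != 2 -> r <= md (1 - s) -> r <= md (2 - s) ->
  ps (fun h => kap_fun (s + h) j * cexp (- (ln u)%:C * h)) (conv (kap s j) (ell u)) r.
Proof.
move=> s1 s2 r1 r2.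
pose G h := cexp (- (ln u)%:C * h).
have p2 : ps (fun h => kap_fun (s + h) 2 * G h) (conv (kap s 2) (ell u)) r.
  have -> : conv (kap s 2) (ell u) = ell u by exact: conv_unit0.
  by have H := @ell_ps u r; apply: (ps_ext H) => h; rewrite /= mul1r.
have p1 : ps (fun h => kap_fun (s + h) 1 * G h) (conv (kap s 1) (ell u)) r.
  have := p2; rewrite kapS// conv_mulop.
  have -> : 2 - s - 1 = 1 - s by ring.
  move=> /(ps_div r1) H; apply: ps_ext H _ => h /=.
  by rewrite mul1r mulrC mul1r opprD addrA.
have p0 : ps (fun h => kap_fun (s + h) 0 * G h) (conv (kap s 0) (ell u)) r.
  have := p1; rewrite kapS// conv_mulop subr0.
  move=> /(ps_div r2) H; apply: ps_ext H _ => h /=.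
  have -> : 2 - (s + h) = 2 - s - h by ring.
  by rewrite mulrAC.
case: j => [|[|j]] //; elim: j => // j IH.
rewrite kapS// conv_mulop; apply: ps_ext (ps_mul _ IH) _ => h.
rewrite [kap_fun _ j.+3]/=; rewrite -[kap_fun _ j.+2]/(kap_fun (s + h) j.+2) mulrA; congr (_ * _ * _).
by ring.
Qed.

Definition ez s j u : R[i] := kap_fun s j * cpow u (2 - s - j%:R).
(* The [k]-th Taylor coefficient of [ez] in [s]. Since these coefficients form
   a chain of derivatives in [u] as well, the Euler-Maclaurin estimate applies to
   each of them, which gives the analyticity of the limit without any Cauchy
   estimate. *)
Definition ec s j u k : R[i] := cpow u (2 - s - j%:R) * conv (kap s j) (ell u) k.

Lemma cpowD u s t : cpow u (s + t) = cpow u s * cpow u t.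
Proof. by rewrite /cpow mulrDl cexpD. Qed.

Lemma ec_ps s j u r : s != 1 -> s != 2 -> r <= md (1 - s) -> r <= md (2 - s) ->
  ps (fun h => ez (s + h) j u) (ec s j u) r.
Proof.
move=> s1 s2 r1 r2 h hr.
have H := kap_ps j u s1 s2 r1 r2 hr.
have e : cpow u (- h) = cexp (- (ln u)%:C * h) by rewrite /cpow; congr cexp; ring.
have -> : ez (s + h) j u = cpow u (2 - s - j%:R) * (kap_fun (s + h) j * cexp (- (ln u)%:C * h)).
  rewrite /ez (_ : 2 - (s + h) - j%:R = (2 - s - j%:R) + - h); last by ring.
  by rewrite cpowD e mulrCA.
apply: clim_ext (climM (clim_cst (cpow u (2 - s - j%:R))) H) _ => n.
by rewrite mulr_sumr; apply: eq_bigr => k _; rewrite mulrA.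
Qed.

Lemma cpowN1 u : 0 < u -> cpow u (- 1) = u%:C^-1.
Proof. by move=> u0; rewrite /cpow mulN1r cexpN cexp_real lnK. Qed.

Lemma is_derive_ln_pos u : 0 < u -> is_derive u 1 (@ln R : R -> R) u^-1.
Proof. by move=> u0; exact: is_derive1_ln. Qed.

Lemma cD_lnC u : 0 < u -> cD (fun y => (ln y)%:C) u (u%:C^-1).
Proof.
move=> u0; rewrite -fmorphV; split => /=; first exact: is_derive_ln_pos.
exact: is_derive_cst.
Qed.

Lemma cD_cpow s u : 0 < u -> cD (fun y => cpow y s) u (s * cpow u (s - 1)).
Proof.
move=> u0; have := cD_cexp (cDZ s (cD_lnC u0)); rewrite -/(cpow u s).
move=> H; apply: cD_eq H _.
have -> : cpow u (s - 1) = cpow u s / u%:C.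
  by rewrite cpowD cpowN1.
ring.
Qed.

Lemma cD_ell u k : 0 < u -> cD (fun y => ell y k) u (- u%:C^-1 * shift_seq (ell u) k).
Proof.
move=> u0; elim: k => [|k IH] /=.
  by rewrite mulr0; apply: cD_ext (cD_cst 1 u) _ => y; rewrite /ell expr0 fact0 divr1.
have hk : (k.+1%:R : R[i]) != 0 by rewrite pnatr_eq0.
have kf0 : (k`!%:R : R[i]) != 0 by rewrite pnatr_eq0 -lt0n fact_gt0.
have un : u%:C != 0 :> R[i] by apply: contraTneq u0 => -[->]; rewrite ltxx.
have h := cDZ (k.+1%:R^-1) (cDM (cDN (cD_lnC u0)) IH).
apply: cD_ext (cD_eq h _) _ => [|y]; last first.
  rewrite /ell factS natrM exprS; move: (_ ^+ k) => z.
  by move: (k.+1%:R : R[i]) hk (k`!%:R : R[i]) kf0 => p p0 q q0; field; rewrite p0 q0.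
case: k IH hk kf0 {h} => [|k] IH hk kf0 /=.
  by rewrite /ell expr0 fact0; field.
have kf' : (k`!%:R : R[i]) != 0 by rewrite pnatr_eq0 -lt0n fact_gt0.
have hk' : (k.+1%:R : R[i]) != 0 by rewrite pnatr_eq0.
rewrite /ell factS natrM !exprS; move: (_ ^+ k) => z.
have e2 : k.+2%:R = k.+1%:R + 1 :> R[i] by rewrite natr1.
rewrite e2 in hk *; move: (ln u)%:C => l.
move: (k.+1%:R : R[i]) hk hk' (k`!%:R : R[i]) kf' => p p1 p0 q q0.
by field; rewrite un p1 p0 q0.
Qed.

(** Differentiating the power brings down [2 - s - j], differentiating the logarithms shifts the
    coefficient index; together these are [mulop (2 - s - j)]. *)
Lemma cD_ec s j u k : s != 1 -> s != 2 -> 0 < u ->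
  cD (fun y => ec s j y k) u (ec s j.+1 u k).
Proof.
move=> s1 s2 u0.
have h := cDM (cD_cpow (2 - s - j%:R) u0)
  (cD_sum (index_enum _) (fun i : 'I_k.+1 => cDZ (kap s j i) (cD_ell (k - i) u0))).
apply: cD_eq h _; rewrite /ec kapS// conv_mulop.
have -> : 2 - s - j.+1%:R = 2 - s - j%:R - 1 by rewrite -[j.+1%:R]natr1; ring.
have e : cpow u (2 - s - j%:R) * - u%:C^-1 = - cpow u (2 - s - j%:R - 1).
  by rewrite (cpowD _ (2 - s - j%:R)) mulrN cpowN1.
rewrite -/(conv (kap s j) (ell u) k).
have -> : \sum_(i <- index_enum 'I_k.+1) kap s j i * (- u%:C^-1 * shift_seq (ell u) (k - i)%N) =
   - u%:C^-1 * conv (kap s j) (shift_seq (ell u)) k.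
  by rewrite /conv mulr_sumr; apply: eq_bigr => i _; rewrite mulrCA.
by rewrite (mulrA (cpow u (2 - s - j%:R))) e conv_sh /mulop; ring.
Qed.

Lemma kap_bound s j r : 0 <= r -> exists2 B, 0 <= B &
  forall n, \sum_(i < n) md (kap s j.+2 i) * r ^+ i <= B.
Proof.
move=> r0; elim: j => [|j [B B0 IH]].
  exists 1 => // -[|n]; first by rewrite big_ord0.
  by rewrite big_ord_recl/= md1 mul1r big1 ?addr0// => i _; rewrite md0 mul0r.
exists ((md (2 - s - j.+2%:R) + r) * B) => [|n].
  by rewrite mulr_ge0// addr_ge0 ?md_ge0.
have eK : kap s j.+3 = mulop (2 - s - j.+2%:R) (kap s j.+2) by [].
rewrite mulrDl eK.
apply: (@le_trans _ _ (\sum_(i < n) (md (2 - s - j.+2%:R) * (md (kap s j.+2 i) * r ^+ i)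
   + md (shift_seq (kap s j.+2) i) * r ^+ i))).
  apply: ler_sum => i _; rewrite mulrA -mulrDl ler_wpM2r ?exprn_ge0//.
  by rewrite /mulop (le_trans (ler_mdB _ _))// (mdM (2 - s - _)).
rewrite big_split/= -mulr_sumr; apply: lerD; first by rewrite ler_wpM2l ?md_ge0 ?IH.
case: n => [|n]; first by rewrite big_ord0 mulr_ge0.
rewrite big_ord_recl/= md0 mul0r add0r.
under eq_bigr do rewrite /bump/= add1n exprS mulrCA.
by rewrite -mulr_sumr ler_wpM2l ?IH.
Qed.

Lemma powfact_le_expR (x : R) k : 0 <= x -> x ^+ k / k`!%:R <= expR x.
Proof.
move=> x0; case: k => [|k].
  by rewrite expr0 fact0 divr1 -expR0 ler_expR.
by apply: le_trans (expR_ge1Dxn k x0); rewrite lerDr.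
Qed.

(** From [(r ln u)^i / i! <= u ^ r], the powers of the logarithm cost [u ^ r]; the summand [r] in
    the hypothesis pays for it, and the bound is geometric in [k]. *)
Lemma ec_bound s (J : nat) r : 0 < r -> 4 + r <= Re s + J%:R -> exists2 B, 0 <= B &
  forall k u, 1 <= u -> md (ec s J.+2 u k) <= B / r ^+ k / u ^+ 4.
Proof.
move=> r0 hJ; have [B B0 hB] := kap_bound s J (ltW r0).
exists B => // k u u1.
have u0 : 0 < u by lra.
have lu : 0 <= ln u by rewrite ln_ge0.
have rk i : 0 <= r ^+ i by rewrite exprn_ge0 ?ltW.
have e1 : md (conv (kap s J.+2) (ell u) k) * r ^+ k <= B * expR (r * ln u).
  apply: (@le_trans _ _ (\sum_(i < k.+1) (md (kap s J.+2 i) * r ^+ i) * expR (r * ln u))).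
    rewrite /conv; apply: (@le_trans _ _ ((\sum_(i < k.+1) md (kap s J.+2 i * ell u (k - i))) * r ^+ k)).
      by rewrite ler_wpM2r// ler_md_sum.
    rewrite mulr_suml; apply: ler_sum => i _.
    have ik : (i <= k)%N by rewrite -ltnS.
    have -> : r ^+ k = r ^+ i * r ^+ (k - i) by rewrite -exprD subnKC.
    have -> : md (kap s J.+2 i * ell u (k - i)) * (r ^+ i * r ^+ (k - i)) =
      (md (kap s J.+2 i) * r ^+ i) * ((r * ln u) ^+ (k - i) / (k - i)`!%:R).
      rewrite mdM /ell mdM mdV md_nat mdX mdN md_real ger0_norm// exprMn; ring.
    by rewrite ler_wpM2l ?mulr_ge0 ?md_ge0// powfact_le_expR// mulr_ge0// ltW.
  by rewrite -mulr_suml ler_wpM2r ?expR_ge0.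
have e2 : md (cpow u (2 - s - J.+2%:R)) = expR ((- Re s - J%:R) * ln u).
  rewrite cexp_md; congr expR; rewrite mulrC ReMr mulrC; congr (_ * _).
  have -> : 2 - s - J.+2%:R = - s - J%:R by rewrite -addn2 natrD; ring.
  by rewrite (ReD (- s)) !ReN Re_nat.
rewrite /ec mdM e2 ler_pdivlMr ?exprn_gt0// ler_pdivlMr ?exprn_gt0//.
have -> : u ^+ 4 = expR (4 * ln u).
  by rewrite expRM_natl lnK.
set X := expR ((- Re s - J%:R) * ln u).
have -> : X * md (conv (kap s J.+2) (ell u) k) * expR (4 * ln u) * r ^+ k =
   (md (conv (kap s J.+2) (ell u) k) * r ^+ k) * (X * expR (4 * ln u)) by ring.
have X0 : 0 <= X * expR (4 * ln u) by rewrite mulr_ge0 ?expR_ge0.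
apply: (le_trans (ler_wpM2r X0 e1)).
rewrite -mulrA -[leRHS]mulr1 ler_wpM2l// /X -!expRD -[X in _ <= X]expR0 ler_expR.
have -> : r * ln u + ((- Re s - J%:R) * ln u + 4 * ln u) = - ((Re s + J%:R - (4 + r)) * ln u) by ring.
by rewrite oppr_le0 mulr_ge0// subr_ge0.
Qed.

End Kap.

(** * The double zeta function *)

Section Zeta.
Context {R : realType}.
Implicit Types (s h : R[i]) (u r : R).

Lemma clim_md_le (u : nat -> R[i]) l (M : R) : clim u l -> (forall n, md (u n) <= M) -> md l <= M.
Proof.
move=> [/ccvg_md h] hM; apply: (@ler_cvg_to _ _ _ _ _ (fun=> M) _ _ h); first exact: cvg_cst.
by apply: nearW => n; exact: hM.
Qed.

Lemma geom_le (q : R) n : 0 <= q < 1 -> \sum_(k < n) q ^+ k <= (1 - q)^-1.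
Proof.
move=> /andP[q0 q1]; have p : 0 < 1 - q by rewrite subr_gt0.
rewrite -[leRHS]mul1r ler_pdivlMr//.
have := subrX1 q n => /(congr1 -%R); rewrite opprB -mulNr opprB mulrC => <-.
by rewrite gerBl exprn_ge0.
Qed.

Context (om w : R) (om_gt0 : 0 < om).

Definition barnesV J s N : R[i] := emV om w J (ez s) N.

Lemma emV_clim J (e : nat -> nat -> R -> R[i]) (e' : nat -> R -> R[i]) N :
  (forall j u, clim (fun n => e n j u) (e' j u)) ->
  clim (fun n => emV om w J (e n) N) (emV om w J e' N).
Proof.
move=> H; apply: climD.
  by apply: clim_sum => i; apply: clim_sum => j; exact: H.
apply: clim_sum => j; apply: climM; first exact: clim_cst.
by apply: climD; [apply: climD | apply: climN]; exact: H.
Qed.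

Lemma emV_sum J (e : nat -> nat -> R -> R[i]) (a : nat -> R[i]) n N :
  \sum_(k < n) emV om w J (e k) N * a k =
  emV om w J (fun j u => \sum_(k < n) e k j u * a k) N.
Proof.
rewrite /emV; under eq_bigr do rewrite mulrDl.
rewrite big_split/=; congr (_ + _).
  under eq_bigr do rewrite mulr_suml.
  rewrite exchange_big/=; apply: eq_bigr => i _.
  under eq_bigr do rewrite mulr_suml.
  by rewrite exchange_big.
under eq_bigr do rewrite mulr_suml.
rewrite exchange_big/=; apply: eq_bigr => j _.
rewrite -big_split -sumrB/= mulr_sumr; apply: eq_bigr => k _; ring.
Qed.

(** Each Taylor coefficient converges in [N] at a rate proportional to [r ^ - k / N]. For [|h| < r]
    these rates sum to a geometric series, so summing over [k] commutes with the limit in [N]. *)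
Lemma barnesV_local s r J : s != 1 -> s != 2 -> 0 < r -> r <= md (1 - s) -> r <= md (2 - s) ->
  4 + r <= Re s + J%:R -> exists c : nat -> R[i],
    (forall k, clim (emV om w J (fun j u => ec s j u k)) (c k)) /\
    forall h, md h < r -> exists v,
      clim (fun n => \sum_(k < n) c k * h ^+ k) v /\ clim (barnesV J (s + h)) v.
Proof.
move=> s1 s2 r0 r1 r2 hJ.
have [C [K0 [C0 hC]]] := @emV_cauchy R om w om_gt0 J.
have [B B0 hB] := ec_bound r0 hJ.
pose E k := emV om w J (fun j u => ec s j u k).
have hE k : forall L N, (K0 <= L)%N -> (L <= N)%N ->
    md (E k N - E k L) <= C * (B / r ^+ k) / L.+1%:R.
  apply: hC; last by move=> u u1; exact: hB.
  by move=> i u u0; exact: cD_ec.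
have hc0 k : exists l, clim (E k) l /\ forall L, (K0 <= L)%N ->
    md (l - E k L) <= 2 * (C * (B / r ^+ k)) / L.+1%:R.
  by have [l h1 h2] := ccvg_rate (hE k); exists l; split.
have [c hc] := choice hc0.
exists c; split=> [k|h hr]; first by case: (hc k).
pose q := md h / r.
have hq : 0 <= q < 1 by rewrite divr_ge0 ?md_ge0 ?ltW//= ltr_pdivrMr// mul1r.
pose A := C * B / (1 - q).
have A0 : 0 <= A by rewrite divr_ge0 ?mulr_ge0// subr_ge0; case/andP: hq => _ /ltW.
have rk k : r ^+ k != 0 by rewrite expf_neq0// gt_eqF.
have geo (f : nat -> R[i]) (K : R) n : 0 <= K ->
    (forall k, md (f k) <= K * (C * (B / r ^+ k))) ->
    md (\sum_(k < n) f k * h ^+ k) <= K * A.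
  move=> Kp hf; apply: (le_trans (ler_md_sum _ _ _)).
  apply: (@le_trans _ _ (\sum_(k < n) K * (C * B) * q ^+ k)).
    apply: ler_sum => k _; rewrite mdM mdX /q.
    have -> : K * (C * B) * (md h / r) ^+ k = K * (C * (B / r ^+ k)) * md h ^+ k.
      by rewrite expr_div_n; field.
    by rewrite ler_wpM2r ?exprn_ge0 ?md_ge0.
  rewrite -mulr_sumr -mulrA ler_wpM2l// /A ler_wpM2l ?mulr_ge0//; exact: geom_le.
have hV N : clim (fun n => \sum_(k < n) E k N * h ^+ k) (barnesV J (s + h) N).
  apply: clim_ext (@emV_clim J (fun n j u => \sum_(k < n) ec s j u k * h ^+ k) _ N _) _.
    by move=> j u; exact: ec_ps hr.
  by move=> n; rewrite -(emV_sum J (fun k j u => ec s j u k) (fun k => h ^+ k)).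
have hVC L N : (K0 <= L)%N -> (L <= N)%N ->
    md (barnesV J (s + h) N - barnesV J (s + h) L) <= A / L.+1%:R.
  move=> KL LN; apply: (clim_md_le (climD (hV N) (climN (hV L)))) => n.
  rewrite -sumrB; under eq_bigr do rewrite -mulrBl.
  rewrite mulrC; apply: (geo (fun k => E k N - E k L)) => [|k]; first by rewrite invr_ge0.
  by rewrite mulrC hE.
have [v hv1 hv2] := ccvg_rate hVC.
exists v; split; last by split.
split; apply: ccvg_eps => e e0.
have e3 : 0 < e / 3 by apply: divr_gt0.
have [K2 hK2] := bound_mj_lt (mulr_ge0 (ler0n _ 2) A0) e3.
pose L := maxn K0 K2.
have KL : (K0 <= L)%N by rewrite leq_maxl.
have b2 : md (barnesV J (s + h) L - v) <= e / 3.
  by rewrite -mdN opprB; apply: (le_trans (hv2 L KL)); apply: hK2; rewrite leq_maxr.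
have [/ccvgP/cvgr0Pnorm_le/(_ _ e3)] := hV L.
apply: filterS => n; rewrite ger0_norm ?md_ge0// => b3.
have b1 : md (\sum_(k < n) (c k - E k L) * h ^+ k) <= e / 3.
  apply: (le_trans (geo (fun k => c k - E k L) (2 / L.+1%:R) n _ _)).
  - by rewrite divr_ge0.
  - move=> k; have [_ /(_ L KL)] := hc k.
    by rewrite [in X in _ -> X]mulrAC.
  - by rewrite mulrAC; apply: hK2; rewrite leq_maxr.
have -> : \sum_(k < n) c k * h ^+ k - v = \sum_(k < n) (c k - E k L) * h ^+ k +
   (\sum_(k < n) E k L * h ^+ k - barnesV J (s + h) L) + (barnesV J (s + h) L - v).
  under [X in _ = X + _ + _]eq_bigr do rewrite mulrBl.
  rewrite sumrB; ring.
have -> : e = e / 3 + e / 3 + e / 3 by field.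
apply: (le_trans (ler_mdD _ _)); apply: lerD => //.
by apply: (le_trans (ler_mdD _ _)); apply: lerD.
Qed.

Lemma md_cpow u s : md (cpow u s) = expR (Re s * ln u).
Proof. by rewrite cexp_md mulrC ReMr mulrC. Qed.

Lemma cpow_vanish (a : R) s : 0 < a -> Re s < 0 ->
  clim (fun N => cpow (a * N.+1%:R) s) 0.
Proof.
move=> a0 s0; split; apply: ccvg_eps => e e0.
pose X := expR (ln e / Re s) / a.
have X0 : 0 <= X by rewrite divr_ge0 ?expR_ge0// ltW.
exists (Num.bound X) => // N /= hN.
have hX : X <= N.+1%:R.
  apply: (le_trans (ltW (archi_boundP X0))); rewrite ler_nat; exact: leq_trans hN _.
rewrite subr0 md_cpow -[leRHS]lnK// ler_expR -ler_ndivrMl// mulrC.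
have aN : 0 < a * N.+1%:R by rewrite mulr_gt0.
rewrite -ler_expR lnK ?posrE//.
by rewrite [leRHS]mulrC -ler_pdivrMr.
Qed.

Lemma ez_vanish s j : 0 < Re s + j%:R - 2 ->
  clim (fun N => ez s j N.+1%:R + ez s j (N.+1%:R * om) - ez s j (N.+1%:R + N.+1%:R * om)) 0.
Proof.
move=> hj.
have hr : Re (2 - s - j%:R) < 0 by rewrite (ReD (2 - s)) (ReD 2) !ReN !Re_nat; lra.
have h a : 0 < a -> clim (fun N => ez s j (a * N.+1%:R)) 0.
  by move=> a0; rewrite -(mulr0 (kap_fun s j)); apply: climM (clim_cst _) (cpow_vanish a0 hr).
have -> : 0 = 0 + 0 - 0 :> R[i] by ring.
have o1 : 0 < 1 + om by rewrite addr_gt0.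
apply: clim_ext (climD (climD (h 1 ltr01) (h om om_gt0)) (climN (h _ o1))) _ => N.
by congr (ez _ _ _ + ez _ _ _ - ez _ _ _); ring.
Qed.

(** The additional corner terms are powers of [N] with exponents of negative real part. *)
Lemma barnesV_indep s J J' : 2 < Re s + J%:R -> (J <= J')%N ->
  clim (fun N => barnesV J' s N.+1 - barnesV J s N.+1) 0.
Proof.
move=> hJ; elim: J' => [|J' IH]; first by rewrite leqn0 => /eqP->; apply: clim_ext (clim_cst 0) _ => N; rewrite subrr.
rewrite leq_eqVlt => /predU1P[->|]; first by apply: clim_ext (clim_cst 0) _ => N; rewrite subrr.
rewrite ltnS => JJ; have hJ' : 0 < Re s + J'%:R - 2.
  have : J%:R <= J'%:R :> R by rewrite ler_nat.
  lra.
have -> : 0 = 0 + em_coef om%:C w%:C J' * 0 :> R[i] by ring.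
apply: clim_ext (climD (IH JJ) (climM (clim_cst _) (ez_vanish hJ'))) _ => N.
rewrite /barnesV /emV big_ord_recr/=; ring.
Qed.

Definition cont_order s : nat := Num.bound (`|Re s| + 6).

Definition barnesZ s : R[i] := xget 0 [set v | clim (barnesV (cont_order s) s) v].

Lemma cont_order_ge s : 6 <= Re s + (cont_order s)%:R.
Proof.
have : `|Re s| + 6 < (cont_order s)%:R by apply: archi_boundP; rewrite addr_ge0.
by have := ler_normr (- Re s) (Re s); rewrite lexx orbT; have := ler_norm (- Re s); rewrite normrN; lra.
Qed.

Lemma radius_exists s (e : R) : s != 1 -> s != 2 -> 0 < e ->
  exists r, [/\ 0 < r, r <= 1, r <= e, r <= md (1 - s) & r <= md (2 - s)].
Proof.
move=> s1 s2 e0.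
have m1 : 0 < md (1 - s) by rewrite md_gt0 subr_eq0 eq_sym.
have m2 : 0 < md (2 - s) by rewrite md_gt0 subr_eq0 eq_sym.
exists (Num.min (Num.min 1 e) (Num.min (md (1 - s)) (md (2 - s)))).
by rewrite !lt_min ltr01 m1 m2 e0 !ge_min !lexx !orbT.
Qed.

(** In [barnesZ] the order varies with [s]. Independence of the order allows one order on a whole
    disc, as analyticity requires. *)
Lemma barnesZ_cvg s J : s != 1 -> s != 2 -> 4 < Re s + J%:R -> clim (barnesV J s) (barnesZ s).
Proof.
move=> s1 s2 hJ.
have ex K : 4 < Re s + K%:R -> exists v, clim (barnesV K s) v.
  rewrite -subr_gt0 => hK; have [r [r0 _ re r1 r2]] := radius_exists s1 s2 hK.
  have hK' : 4 + r <= Re s + K%:R by lra.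
  have [c [_ /(_ 0)]] := barnesV_local s1 s2 r0 r1 r2 hK'.
  by rewrite md0 => /(_ r0) [v [_]]; rewrite addr0 => hv; exists v.
have h6 := cont_order_ge s.
have h5 : 4 < Re s + (cont_order s)%:R by lra.
have hZ : clim (barnesV (cont_order s) s) (barnesZ s).
  by have [v hv] := ex _ h5; exact: (xgetPex 0 (ex_intro _ v hv)).
have [v hv] := ex J hJ.
suff -> : barnesZ s = v by [].
have h2 K : 4 < Re s + K%:R -> 2 < Re s + K%:R by lra.
have D : clim (fun N => barnesV J s N.+1 - barnesV (cont_order s) s N.+1) (v - barnesZ s).
  exact: climD (proj2 (climS _ _) hv) (climN (proj2 (climS _ _) hZ)).
suff D0 : clim (fun N => barnesV J s N.+1 - barnesV (cont_order s) s N.+1) 0.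
  by apply/esym/eqP; rewrite -subr_eq0; apply/eqP; apply: ccvg_unique (climP D) (climP D0).
case: (leqP (cont_order s) J) => JJ; first exact: barnesV_indep (h2 _ h5) JJ.
rewrite -oppr0; apply: clim_ext (climN (barnesV_indep (h2 _ hJ) (ltnW JJ))) _ => N.
by rewrite opprB.
Qed.

Lemma barnesZ_is_zeta : is_barnes_zeta2 ((1 + om) / 2 + w) om barnesZ.
Proof.
split=> [s hs|s s1 s2].
  have s1 : s != 1 by apply: contraTneq hs => ->; rewrite Re1 -leNgt ler1n.
  have s2 : s != 2 by apply: contraTneq hs => ->; rewrite Re_nat ltxx.
  have h6 := cont_order_ge s.
  have h5 : 4 < Re s + (cont_order s)%:R by lra.
  have hZ := barnesZ_cvg s1 s2 h5.
  (* For [Re s > 2] the order 0 is admissible: no corner terms remain and [barnesV] is the partial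
     sum of the double series. *)
  have h0 : 2 < Re s + 0%:R by rewrite addr0.
  have := climD (proj2 (climS _ _) hZ) (climN (barnesV_indep h0 (leq0n (cont_order s)))).
  rewrite oppr0 addr0 => H.
  have {}H : clim (fun N => barnesV 0 s N.+1) (barnesZ s).
    by apply: clim_ext H _ => N; rewrite subKr.
  apply: cvg_eqfun (climP (proj1 (climS _ _) H)) _ erefl => N.
  rewrite /barnesV /emV big_ord0 addr0 /barnes_partial big_mkord; apply: eq_bigr => i _.
  rewrite big_mkord; apply: eq_bigr => j _.
  have -> : (1 + om) / 2 + w + (i%:R + j%:R * om) = i%:R + j%:R * om + ((1 + om) / 2 + w) by ring.
  have e2 : 2 - s - 2%:R = - s by ring.
  by rewrite /ez e2 [kap_fun _ _]/= mul1r.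
have [r [r0 r11 _ r1 r2]] := radius_exists s1 s2 ltr01.
have h6 := cont_order_ge s.
have hJ : 4 + r <= Re s + (cont_order s)%:R by lra.
have [c [_ H]] := barnesV_local s1 s2 r0 r1 r2 hJ.
exists r, c; split=> // h; rewrite md_lt_ltc => hr.
have [v [hv1 hv2]] := H h hr.
suff -> : barnesZ (s + h) = v by exact: (climP hv1).
have n1 : s + h != 1.
  apply: contraTneq (lt_le_trans hr r1) => <-; by rewrite addrAC subrr add0r ltxx.
have n2 : s + h != 2.
  apply: contraTneq (lt_le_trans hr r2) => <-; by rewrite addrAC subrr add0r ltxx.
apply: ccvg_unique (climP _) (climP hv2).
apply: barnesZ_cvg => //; rewrite ReD.
have := ler_Re_md h; rewrite ler_norml => /andP[a1 _]; lra.
Qed.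

End Zeta.

(** * Uniqueness of the continuation *)

Section Identity.
Context {R : realType}.
Implicit Types (s h : R[i]) (u r : R).

(** Convergence at a radius [r1 < r] bounds [|c k| r1 ^ k]; for [|h| <= r1 / 2] the rest is a
    geometric series of ratio at most 1/2. *)
Lemma ps_tail (f : R[i] -> R[i]) c r m : 0 < r -> ps f c r ->
  exists K r', [/\ 0 <= K, 0 < r' < r &
    forall h n, md h <= r' -> md (\sum_(k < n.+1) c (m + k)%N * h ^+ k - c m) <= K * md h].
Proof.
move=> r0 hf; have [r1 [r10 r11]] : exists r1, 0 < r1 /\ r1 < r by exists (r / 2); lra.
have r1r : md (r1%:C : R[i]) < r by rewrite md_real ger0_norm ?ltW.
have [M M0 hM] : exists2 M, 0 <= M & forall k, md (c k) * r1 ^+ k <= M.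
  have [/ccvgP/cvgr0Pnorm_le/(_ _ ltr01)[N _ HN]] := clim_term (hf _ r1r).
  exists (1 + \sum_(k < N) md (c k) * r1 ^+ k).
    by rewrite addr_ge0// sumr_ge0// => i _; rewrite mulr_ge0 ?md_ge0 ?exprn_ge0 ?ltW.
  move=> k; case: (ltnP k N) => kN.
    rewrite (bigD1 (Ordinal kN))//= addrCA lerDl addr_ge0// sumr_ge0// => i _.
    by rewrite mulr_ge0 ?md_ge0 ?exprn_ge0 ?ltW.
  have := HN k kN; rewrite /= subr0 mdM mdX md_real (ger0_norm (ltW r10)).
  move=> h1; apply: (le_trans (ler_norm _)); apply: (le_trans h1).
  by rewrite lerDl sumr_ge0// => i _; rewrite mulr_ge0 ?md_ge0 ?exprn_ge0 ?ltW.
exists (2 * M / r1 ^+ m.+1), (r1 / 2); split.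
- by rewrite divr_ge0 ?mulr_ge0 ?exprn_ge0// ltW.
- by apply/andP; split; lra.
move=> h n hh; rewrite big_ord_recl/= addn0 mulr1 addrAC subrr add0r.
pose q := md h / r1.
have q0 : 0 <= q by rewrite divr_ge0 ?md_ge0 ?ltW.
have q1 : q <= 1 / 2 by rewrite ler_pdivrMr//; lra.
have hq : 0 <= q < 1 by rewrite q0/=; lra.
apply: (le_trans (ler_md_sum _ _ _)).
apply: (@le_trans _ _ (\sum_(i < n) M / r1 ^+ m * q * q ^+ i)).
  apply: ler_sum => i _; rewrite /bump/= add1n mdM mdX.
  have -> : M / r1 ^+ m * q * q ^+ i = M / r1 ^+ (m + i.+1) * md h ^+ i.+1.
    rewrite (exprD r1 m) invfM -[LHS]mulrA -(exprS q) {1}/q expr_div_n.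
    by move: (r1 ^+ m)^-1 (r1 ^+ i.+1)^-1 (md h ^+ i.+1) => x y z; ring.
  rewrite ler_wpM2r ?exprn_ge0 ?md_ge0// ler_pdivlMr ?exprn_gt0//.
rewrite -mulr_sumr.
have -> : 2 * M / r1 ^+ m.+1 * md h = M / r1 ^+ m * q * 2.
  by rewrite /q exprS invfM; ring.
rewrite ler_wpM2l ?mulr_ge0 ?invr_ge0 ?exprn_ge0 ?md_ge0 ?(ltW r10)//.
apply: (le_trans (geom_le _ hq)).
by rewrite invf_ple ?posrE//; lra.
Qed.

Lemma small_eq0 (a K : R) : 0 <= a -> 0 <= K ->
  (forall e, 0 < e -> exists2 x, 0 <= x <= e & a <= K * x) -> a = 0.
Proof.
move=> a0 K0 h; apply/eqP; rewrite eq_le a0 andbT; apply/ler_addgt0Pr => e e0.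
have e1 : 0 < e / (K + 1) by rewrite divr_gt0//; lra.
have [x /andP[x0 x1] h2] := h _ e1.
apply: (le_trans h2); rewrite add0r.
apply: (le_trans (ler_wpM2l K0 x1)).
by rewrite mulrCA ler_piMr ?(ltW e0)// ler_pdivrMr; lra.
Qed.

(** Strong induction: with the earlier coefficients zero, division by [h ^+ m] at a zero [h] gives
    [|c m| <= K |h|], and [h] may be arbitrarily small. *)
Lemma ps_zero (f : R[i] -> R[i]) c r : 0 < r -> ps f c r ->
  (forall e, 0 < e -> exists h, [/\ h != 0, md h <= e & f h = 0]) ->
  forall k, c k = 0.
Proof.
move=> r0 hf hz m; have [n] := ubnP m; elim: n m => // n IH m; rewrite ltnS => mn.
have hlt j : (j < m)%N -> c j = 0 by move=> jm; apply: IH; exact: leq_trans jm mn.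
have [K [r' [K0 /andP[r'0 r'r] hK]]] := ps_tail m r0 hf.
apply/eqP; rewrite -md_eq0; apply/eqP; apply: (@small_eq0 _ K) => //; first exact: md_ge0.
move=> e e0.
have e1 : 0 < Num.min e r' by rewrite lt_min e0.
have [h [h0 he fh]] := hz _ e1.
move: he; rewrite le_min => /andP[he hr'].
exists (md h); first by rewrite md_ge0.
have hr : md h < r by lra.
have H := hf h hr; rewrite fh in H.
have H2 : clim (fun n => \sum_(k < n.+1) c (m + k)%N * h ^+ k) 0.
  have H3 : clim (fun n => \sum_(k < (n + m).+1) c k * h ^+ k) 0.
    split; have := climP H; rewrite -(cvg_shiftn m.+1).
    by under eq_fun do rewrite addnS.
  have := climM (clim_cst (h ^+ m)^-1) H3; rewrite mulr0 => H4.
  apply: clim_ext H4 _ => k.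
  rewrite addnC -addnS big_split_ord/= big1 ?add0r.
    rewrite mulr_sumr; apply: eq_bigr => i _; rewrite exprD.
    by rewrite mulrCA [_^-1 * _]mulrA mulVf ?expf_neq0// mul1r.
  by move=> i _; rewrite hlt ?mul0r.
have H4 := climD H2 (climN (clim_cst (c m))).
rewrite -mdN -[- c m]add0r; apply: (clim_md_le H4) => k.
exact: hK.
Qed.

Lemma ps_derive1 (f : R[i] -> R[i]) c r : 0 < r -> ps f c r ->
  derive1 (f : R[i] -> R[i]^o) 0 = c 1%N.
Proof.
move=> r0 hf; have [K [r' [K0 /andP[r'0 r'r] hK]]] := ps_tail 1 r0 hf.
have f0 : f 0 = c 0%N.
  have h0 : md (0 : R[i]) < r by rewrite md0.
  have H := proj2 (climS _ _) (hf 0 h0).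
  apply: ccvg_unique (climP H) _; apply: climP; apply: clim_ext (clim_cst (c 0%N)) _ => n.
  by rewrite big_ord_recl/= mulr1 big1 ?addr0// => i _; rewrite expr0n/= mulr0.
have bd h : h != 0 -> md h <= r' -> md (h^-1 * (f h - f 0) - c 1%N) <= K * md h.
  move=> h0 hr'; have hr : md h < r by lra.
  have H := proj2 (climS _ _) (proj2 (climS _ _) (hf h hr)).
  have := climD (climM (clim_cst h^-1) (climD H (clim_cst (- f 0)))) (clim_cst (- c 1%N)).
  move=> /clim_md_le; apply => n.
  have -> : h^-1 * (\sum_(k < n.+2) c k * h ^+ k + - f 0) = \sum_(k < n.+1) c (1 + k)%N * h ^+ k.
    rewrite big_ord_recl/= mulr1 f0 addrAC subrr add0r mulr_sumr; apply: eq_bigr => k _.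
    by rewrite /bump/= exprS; field.
  exact: hK.
rewrite /derive1; apply: cvg_lim; first exact: norm_hausdorff.
apply/cvgrPdist_le => eps eps0.
pose e := Re eps.
have eE : eps = e%:C by rewrite /e; case: (eps) eps0 => a b; rewrite ltcE/= => /andP[/eqP-> _].
have e0 : 0 < e by move: eps0; rewrite eE ltcR.
have d0 : 0 < Num.min r' (e / (K + 1)).
  by rewrite lt_min r'0 divr_gt0//; lra.
exists ((Num.min r' (e / (K + 1)))%:C); first by rewrite /= ltcR.
move=> h /= hb h0.
have hm : md h < Num.min r' (e / (K + 1)) by move: hb; rewrite sub0r normrN md_lt_ltc.
move: hm; rewrite lt_min => /andP[h1 h2].
rewrite addr0 eE.
have : md (h^-1 * (f h - f 0) - c 1%N) <= e.
  apply: (le_trans (bd h h0 (ltW h1))).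
  apply: (@le_trans _ _ (K * (e / (K + 1)))); first by rewrite ler_wpM2l// ltW.
  by rewrite mulrCA ler_piMr ?(ltW e0)// ler_pdivrMr; lra.
by rewrite distrC normc_md lecR.
Qed.

(* This segment joins 0 to a point of the half-plane of convergence while
   avoiding the poles 1 and 2. *)
Definition segment_pt (t : R) : R[i] := t%:C * (3 +i* 1).

(** Identity theorem along one segment. [S] holds the parameters from which on [f] vanishes; zeros
    accumulate at its infimum, so the expansion there is zero and [f] vanishes beyond it, a
    contradiction unless the infimum is 0. *)
Lemma identity_segment (f : R[i] -> R[i]) :
  (forall t, 0 <= t <= 1 -> exists r c, 0 < r /\ ps (fun h => f (segment_pt t + h)) c r) ->
  (forall s, 2 < Re s -> f s = 0) ->
  exists2 r, 0 < r & forall h, md h < r -> f h = 0.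
Proof.
move=> hf h2.
have Rp t : Re (segment_pt t) = t * 3 by rewrite /segment_pt ReMr.
have mp t : md (segment_pt t) <= 4 * `|t|.
  rewrite /segment_pt mdM md_real mulrC ler_wpM2r//.
  by apply: (le_trans (ler_md_ReIm _)); rewrite /= !ger0_norm//; lra.
have pB t t' : segment_pt t - segment_pt t' = segment_pt (t - t') by rewrite /segment_pt rmorphB mulrBl.
pose S : set R := [set t | 0 <= t <= 1 /\ forall t', t <= t' <= 1 -> f (segment_pt t') = 0].
(* There the real part is [27/10 > 2], and a margin [1/10] remains for steps to the right of the
   infimum. *)
have S1 : S (9 / 10).
  by split=> [|t' /andP[t1 _]]; [apply/andP; split; lra | apply: h2; rewrite Rp; lra].
have Sinf : has_inf S by split; [exists (9 / 10) | exists 0 => t [/andP[]]].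
pose t0 := inf S.
have t00 : 0 <= t0 by apply: lb_le_inf; [exists (9 / 10) | move=> t [/andP[]]].
have t01 : t0 <= 9 / 10 by apply: ge_inf; [exact: (proj2 Sinf) | ].
have above t : t0 < t -> t <= 1 -> f (segment_pt t) = 0.
  move=> tt t1; have [x [hx hx2] xt] := inf_lt (proj1 Sinf) tt.
  by apply: hx2; rewrite (ltW xt).
have [r [c [r0 hr]]] : exists r c, 0 < r /\ ps (fun h => f (segment_pt t0 + h)) c r.
  by apply: hf; rewrite t00/=; lra.
have c0 : forall k, c k = 0.
  apply: (ps_zero r0 hr) => e e0.
  pose d := Num.min (e / 4) (1 / 10).
  have d0 : 0 < d by rewrite lt_min !divr_gt0.
  have de : d <= e / 4 by rewrite ge_min lexx.
  have d1 : d <= 1 / 10 by rewrite ge_min lexx orbT.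
  exists (segment_pt d); split.
  - by apply: contraTneq d0 => /(congr1 (@complex.Re R)); rewrite Rp /= => h; lra.
  - by apply: (le_trans (mp d)); rewrite ger0_norm; lra.
  - have -> : segment_pt t0 + segment_pt d = segment_pt (t0 + d) by rewrite /segment_pt rmorphD mulrDl.
    by apply: above; lra.
have z h : md h < r -> f (segment_pt t0 + h) = 0.
  move=> hh; apply: ccvg_unique (climP (hr h hh)) _; apply: climP.
  by apply: clim_ext (clim_cst 0) _ => n; rewrite big1// => i _; rewrite c0 mul0r.
have [t0_gt|t0_le] := ltP 0 t0.
  exfalso; pose d := Num.min (r / 8) t0.
  have d0 : 0 < d by rewrite lt_min t0_gt divr_gt0.
  have d1 : d <= r / 8 by rewrite ge_min lexx.
  have d2 : d <= t0 by rewrite ge_min lexx orbT.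
  have : S (t0 - d).
    split=> [|t' /andP[h1 h3]]; first by apply/andP; split; lra.
    have [tt|tt] := ltP t0 t'; first exact: above.
    have -> : segment_pt t' = segment_pt t0 + segment_pt (t' - t0) by rewrite -pB addrC subrK.
    by apply: z; apply: (le_lt_trans (mp _)); rewrite ler0_norm; lra.
  by move=> /(ge_inf (proj2 Sinf)); rewrite -/t0; lra.
have e : segment_pt t0 = 0 by have -> : t0 = 0; [apply/eqP; rewrite eq_le t0_le t00 | rewrite /segment_pt mul0r].
by exists r => // h hh; have := z h hh; rewrite e add0r.
Qed.

End Identity.

(** * The double sine function *)

Section DoubleSine.
Context {R : realType}.
Implicit Types (s h : R[i]) (u r : R).

Lemma cpow_nat u n : 0 < u -> cpow u n%:R = u%:C ^+ n :> R[i].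
Proof. by move=> u0; rewrite /cpow cexp_natmul cexp_real lnK. Qed.

Lemma cLn_real u : 0 < u -> cLn (u%:C : R[i]) = (ln u)%:C.
Proof.
move=> u0; rewrite -clog_cLn//= /clog md_real ger0_norm ?ltW//= divff ?gt_eqF//.
by rewrite acos1.
Qed.

Lemma ec0_1 u j : ec 0 j u 1 =
  cpow u (2 - j%:R) * (kap 0 j 1 - kap 0 j 0 * (ln u)%:C) :> R[i].
Proof.
rewrite /ec subr0; congr (_ * _).
rewrite /conv big_ord_recl big_ord1.
change (kap 0 j 0 * ell u 1 + kap 0 j 1 * ell u 0 = kap 0 j 1 - kap 0 j 0 * (ln u)%:C).
by rewrite /ell expr1 expr0 !divr1; ring.
Qed.

(** The derivative in [s] at 0 of [u ^ (- s)] is [- ln u], and the chains of primitives correspond;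
    [3/4] in [Elog] is the derivative of [1 / ((1 - s)(2 - s))] at 0. *)
Lemma ec0_Elog u j : 0 < u -> (j < 4)%N -> ec 0 j u 1 = - Elog (cLn (u%:C : R[i])) u%:C j.
Proof.
move=> u0; have un : u%:C != 0 :> R[i] by apply: contraTneq u0 => -[->]; rewrite ltxx.
rewrite cLn_real// ec0_1; move: (ln u)%:C => l.
case: j => [|[|[|[|j]]]] //= _; rewrite /mulop /=.
- by rewrite subr0 (cpow_nat 2 u0); field.
- have -> : 2 - 1 = 1%:R :> R[i] by ring.
  by rewrite cpow_nat//; field.
- have -> : 2 - 2 = 0%:R :> R[i] by ring.
  by rewrite cpow_nat//; field.
- have -> : 2 - 3 = - 1 :> R[i] by ring.
  by rewrite cpowN1//; field.
Qed.

Lemma ec0_4 u : ec 0 4 u 1 = cpow u (- 2) :> R[i].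
Proof.
rewrite ec0_1 /= /mulop/=.
have -> : 2 - 4 = - 2 :> R[i] by ring.
by field.
Qed.

Context (om w : R) (om_gt0 : 0 < om).

Let om0 : om%:C != 0 :> R[i].
Proof. by apply: contraTneq om_gt0 => -[->]; rewrite ltxx. Qed.

(** Order 5 is what [4 + r <= Re s + J] demands at [s = 0] with [r = 1/2]. [Psi] contains four
    corner terms, and the fifth is [O(N ^ -2)]. *)
Lemma emV_Psi N : 0 < (1 + om) / 2 + w ->
  emV om w 5 (fun j u => ec 0 j u 1) N.+1 = - Psi om%:C w%:C N.+1 +
    em_coef om%:C w%:C 4 * (cpow N.+1%:R (- 2) + cpow (N.+1%:R * om) (- 2) - cpow (N.+1%:R + N.+1%:R * om) (- 2)).
Proof.
move=> z0; rewrite /emV big_ord_recr/= !ec0_4 addrA; congr (_ + _).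
have N0 : 0 < N.+1%:R :> R by rewrite ltr0n.
have No : 0 < N.+1%:R * om by rewrite mulr_gt0.
have NNo : 0 < N.+1%:R + N.+1%:R * om by rewrite addr_gt0.
have c1 : ((N.+1%:R : R)%:C = N.+1%:R :> R[i]) by rewrite rmorph_nat.
have c2 : ((N.+1%:R * om)%:C = N.+1%:R * om%:C :> R[i]) by rewrite rmorphM rmorph_nat.
have c3 : ((N.+1%:R + N.+1%:R * om)%:C = N.+1%:R + N.+1%:R * om%:C :> R[i]) by rewrite rmorphD/= c1 c2.
rewrite /Psi /Gp -!addrA !opprD; congr (_ + _).
  rewrite -sumrN; apply: eq_bigr => i _; rewrite -sumrN; apply: eq_bigr => j _.
  have p : 0 < (1 + om) / 2 + w + (i%:R + j%:R * om).
    by rewrite ltr_wpDr// addr_ge0// mulr_ge0// ltW.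
  rewrite ec0_Elog//= ; congr (- cLn _).
  by rewrite !(rmorphD, rmorphM, fmorphV, rmorph1, rmorph_nat).
rewrite opprK -!sumrN -!big_split/=; apply: eq_bigr => -[j hj] _ /=.
rewrite !ec0_Elog// c1 c2 c3 (gam_em w%:C om0 hj); ring.
Qed.

Lemma barnesZ_deriv l : 0 < (1 + om) / 2 + w ->
  clim (fun N => Psi om%:C w%:C N) l ->
  exists r c, [/\ 0 < r, ps (barnesZ om w) c r & c 1%N = - l].
Proof.
move=> z0 hl.
have n1 : (0 : R[i]) != 1 by rewrite eq_sym oner_eq0.
have n2 : (0 : R[i]) != 2 by rewrite eq_sym pnatr_eq0.
have r0 : (0 : R) < 1 / 2 by rewrite divr_gt0.
have hJ : 4 + 1 / 2 <= Re (0 : R[i]) + 5%:R :> R by rewrite /= add0r; lra.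
have r1 : 1 / 2 <= md (1 - 0 : R[i]) by rewrite subr0 md1; lra.
have r2 : 1 / 2 <= md (2 - 0 : R[i]) by rewrite subr0 md_nat; lra.
have [c [h1 h2]] := barnesV_local w om_gt0 n1 n2 r0 r1 r2 hJ.
exists (1 / 2), c; split=> //.
- move=> h hr; have [v [hv1 hv2]] := h2 h hr; rewrite add0r in hv2.
  suff -> : barnesZ om w h = v by [].
  apply: ccvg_unique (climP _) (climP hv2); apply: barnesZ_cvg => //.
  + by apply: contraTneq hr => ->; rewrite md1 -leNgt; lra.
  + by apply: contraTneq hr => ->; rewrite md_nat -leNgt; lra.
  + by have := ler_Re_md h; rewrite ler_norml => /andP[a1 _]; lra.
- have H := proj2 (climS _ _) (h1 1%N).
  apply: ccvg_unique (climP H) _; apply: climP.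
  have v2 : Re (- 2 : R[i]) < 0 by rewrite ReN Re_nat; lra.
  have o1 : 0 < 1 + om by rewrite addr_gt0.
  have v (a : R) : 0 < a -> clim (fun N => cpow (a * N.+1%:R) (- 2)) 0.
    by move=> a0; exact: cpow_vanish.
  have := climD (climN (proj2 (climS _ _) hl)) (climM (clim_cst (em_coef om%:C w%:C 4))
    (climD (climD (v 1 ltr01) (v om om_gt0)) (climN (v _ o1)))).
  rewrite addr0 subr0 mulr0 addr0 => H2; apply: clim_ext H2 _ => N.
  have q3 : (1 + om) * N.+1%:R = N.+1%:R + N.+1%:R * om by ring.
  by rewrite mul1r [om * _]mulrC q3 emV_Psi.
Qed.

Lemma analytic_ps (f : R[i] -> R[i]) s : analytic_at f s ->
  exists r c, 0 < r /\ ps (fun h => f (s + h)) c r.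
Proof.
move=> [r [c [r0 H]]]; exists r, c; split=> // h hr; split; apply: H.
by rewrite md_lt_ltc.
Qed.

Lemma ps_sub (f g : R[i] -> R[i]) c d r r' : ps f c r -> ps g d r' ->
  ps (fun h => f h - g h) (fun k => c k - d k) (Num.min r r').
Proof.
move=> hf hg h; rewrite lt_min => /andP[h1 h2].
apply: clim_ext (climD (hf h h1) (climN (hg h h2))) _ => n.
by rewrite -sumrB; apply: eq_bigr => k _; rewrite mulrBl.
Qed.

(** The existence of [barnesZ] excludes the default value of [xget], and whichever continuation is
    chosen agrees with [barnesZ] near 0. *)
Lemma barnes_deriv0E l : 0 < (1 + om) / 2 + w ->
  clim (fun N => Psi om%:C w%:C N) l ->
  barnes_zeta2_deriv0 ((1 + om) / 2 + w) om = - l.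
Proof.
move=> z0 hl; have [r [c [r0 hc <-]]] := barnesZ_deriv z0 hl.
rewrite /barnes_zeta2_deriv0; set Z := barnes_zeta2 _ _.
have hZ : is_barnes_zeta2 ((1 + om) / 2 + w) om Z.
  exact: (xgetPex _ (ex_intro _ _ (barnesZ_is_zeta w om_gt0))).
have [hZ1 hZ2] := hZ; have [hB1 hB2] := barnesZ_is_zeta w om_gt0.
have [r' r'0 hz] : exists2 r, 0 < r & forall h, md h < r -> Z h - barnesZ om w h = 0.
  apply: (@identity_segment R (fun s => Z s - barnesZ om w s)).
    move=> t _.
    have p1 : segment_pt t != 1 :> R[i].
      apply/negP => /eqP h; have := congr1 (@complex.Re R) h.
      have := congr1 (@complex.Im R) h; rewrite ReMr ImMr/= mulr1 => ->; rewrite mul0r.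
      by move/eqP; rewrite eq_sym oner_eq0.
    have p2 : segment_pt t != 2 :> R[i].
      apply/negP => /eqP h; have := congr1 (@complex.Re R) h.
      have := congr1 (@complex.Im R) h; rewrite ReMr ImMr Im_nat Re_nat/= mulr1 => ->; rewrite mul0r.
      by move/eqP; rewrite eq_sym pnatr_eq0.
    have [r1 [c1 [r10 H1]]] := analytic_ps (hZ2 _ p1 p2).
    have [r2 [c2 [r20 H2]]] := analytic_ps (hB2 _ p1 p2).
    exists (Num.min r1 r2), (fun k => c1 k - c2 k); split; first by rewrite lt_min r10.
    exact: ps_sub.
  move=> s hs; apply/eqP; rewrite subr_eq0; apply/eqP.
  exact: ccvg_unique (hZ1 s hs) (hB1 s hs).
have m0 : 0 < Num.min r r' by rewrite lt_min r0.
apply: (ps_derive1 m0) => h; rewrite lt_min => /andP[h1 h2].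
have -> : Z h = barnesZ om w h by apply/eqP; rewrite -subr_eq0 hz.
exact: hc.
Qed.

End DoubleSine.

Section DoubleSineLimit.
Context {R : realType}.
Context (om w : R) (om_gt0 : 0 < om).
Context (z_gt0 : 0 < (1 + om) / 2 + w) (z'_gt0 : 0 < (1 + om) / 2 - w).

Lemma Psi_clim (v : R[i]) : exists l, clim (Psi om%:C v) l.
Proof.
have om0 : om%:C != 0 :> R[i] by apply: contraTneq om_gt0 => -[->]; rewrite ltxx.
have [K [K1 Ko KoV Kw]] : exists K, [/\ 1 <= K, md (om%:C : R[i]) < K, md (om%:C^-1 : R[i]) < K
    & md v < K].
  by apply: bound3; exact: md_ge0.
have [k [k01 ko]] := half_bound om_gt0.
have [C [K0 hC]] := Psi_cauchy K1 k01.
have h L N : (K0 <= L)%N -> (L <= N)%N ->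
    md (Psi om%:C v N - Psi om%:C v L) <= C / L.+1%:R by apply: hC; rewrite ltW.
have [l hl _] := ccvg_rate h.
by exists l; split.
Qed.

Lemma Im_Psi (v : R) N : 0 < (1 + om) / 2 + v -> Im (Psi om%:C v%:C N.+1) = 0.
Proof.
move=> hv.
have imD (a b : R[i]) : Im a = 0 -> Im b = 0 -> Im (a + b) = 0.
  by move=> ha hb; rewrite ImD ha hb addr0.
have imN (a : R[i]) : Im a = 0 -> Im (- a) = 0 by move=> ha; rewrite ImN ha oppr0.
have imM (a b : R[i]) : Im a = 0 -> Im b = 0 -> Im (a * b) = 0.
  by move=> ha hb; rewrite ImM ha hb mulr0 mul0r addr0.
have imV (a : R[i]) : Im a = 0 -> Im a^-1 = 0 by move=> ha; rewrite ImV ha !(mulNr, mul0r, oppr0).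
have imX (a : R[i]) n : Im a = 0 -> Im (a ^+ n) = 0.
  by move=> ha; elim: n => [|n IH]; rewrite ?expr0// exprS imM.
have imn n : Im (n%:R : R[i]) = 0 by rewrite Im_nat.
have im1 : Im (1 : R[i]) = 0 by [].
have imr (r : R) : Im (r%:C : R[i]) = 0 by [].
have imS (I : Type) (r : seq I) (f : I -> R[i]) : (forall i, Im (f i) = 0) -> Im (\sum_(i <- r) f i) = 0.
  by move=> hf; rewrite Im_sum big1.
have imG (u : R) : 0 < u -> Im (Gp cLn om%:C v%:C u%:C) = 0.
  move=> u0; apply: imS => -[j hj] /=; rewrite cLn_real//.
  apply (imM); case: j hj => [|[|[|[|j]]]] // _;
  rewrite ?[gam _ _ _]/= ?[Elog _ _ _]/=; repeat lazymatch goal with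
  | |- complex.Im (@GRing.add _ _ _) = 0 => apply imD
  | |- complex.Im (@GRing.opp _ _) = 0 => apply imN
  | |- complex.Im (@GRing.mul _ _ _) = 0 => apply imM
  | |- complex.Im (@GRing.inv _ _) = 0 => apply imV
  | |- complex.Im (@GRing.exp _ _ _) = 0 => apply imX
  | |- _ => first [exact: imn | done]
  end.
have N0 : 0 < N.+1%:R :> R by rewrite ltr0n.
have No : 0 < N.+1%:R * om by rewrite mulr_gt0.
have NNo : 0 < N.+1%:R + N.+1%:R * om by rewrite addr_gt0.
have c1 : ((N.+1%:R : R)%:C = N.+1%:R :> R[i]) by rewrite rmorph_nat.
have c2 : ((N.+1%:R * om)%:C = N.+1%:R * om%:C :> R[i]) by rewrite rmorphM rmorph_nat.
have c3 : ((N.+1%:R + N.+1%:R * om)%:C = N.+1%:R + N.+1%:R * om%:C :> R[i]) by rewrite rmorphD/= c1 c2.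
rewrite /Psi -c3 -c2 -c1; apply: (imD); last by apply: (imN); exact: imG.
apply: (imD); last exact: imG.
apply: (imD); last exact: imG.
apply: (imS) => i; apply: (imS) => j.
have p : 0 < (1 + om) / 2 + v + (i%:R + j%:R * om).
  by rewrite ltr_wpDr// addr_ge0// mulr_ge0// ltW.
have -> : (1 + om%:C) / 2 + v%:C + (i%:R + j%:R * om%:C) = ((1 + om) / 2 + v + (i%:R + j%:R * om))%:C.
  by rewrite !(rmorphD, rmorphM, fmorphV, rmorph1, rmorph_nat).
by rewrite cLn_real.
Qed.

(** The reflection in the double sine is [w -> - w]. At real arguments [Psi] is real, so the complex
    exponential reduces to the real one. *)
Lemma double_sineE : exists S,
  (fun N => Re (Psi om%:C w%:C N - Psi om%:C (- w%:C) N)) @ \oo --> S /\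
  double_sine om ((1 + om) / 2 + w) = (expR S)%:C.
Proof.
have [l hl] := Psi_clim w%:C; have [l' hl'] := Psi_clim (- w%:C).
exists (Re (l - l')); split.
  by have := ccvg_Re (climP (climD hl (climN hl'))).
rewrite /double_sine.
have -> : 1 + om - ((1 + om) / 2 + w) = (1 + om) / 2 + - w by field.
have eN : - w%:C = (- w)%:C :> R[i] by rewrite rmorphN.
rewrite eN in hl'.
rewrite (barnes_deriv0E om_gt0 z_gt0 hl) (barnes_deriv0E om_gt0 z'_gt0 hl').
rewrite opprK addrC -cexp_real; congr cexp.
have I v k : 0 < (1 + om) / 2 + v -> clim (Psi om%:C v%:C) k -> Im k = 0.
  move=> hv hk0; have hk := proj2 (climS _ _) hk0.
  have := ccvg_Re (climP (climM (clim_cst (- ci)) hk)).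
  have e (z : R[i]) : Re (- ci * z) = Im z by rewrite ReM ReN ImN/=; ring.
  rewrite e; under eq_fun do rewrite e Im_Psi//.
  by move=> /cvg_lim <-//; rewrite lim_cst.
apply: eqC => //=; rewrite ImD ImN (I _ _ z_gt0 hl) (I _ _ z'_gt0 hl'); ring.
Qed.

End DoubleSineLimit.

(** * The q-product under inversion and integer translation *)

Section Bridge.
Context {R : realType}.

Lemma ratrC (x : rat) : (ratr x : R)%:C = ratr x :> R[i].
Proof. exact: (fmorph_rat (real_complex R)). Qed.

Lemma ee_nat (n : nat) : ee n%:R = 1 :> R[i].
Proof.
have e : (0 +i* (2 * pi) : R[i]) = ci * (2 * pi)%:C.
  by apply: eqC; rewrite (ReM, ImM)/=; ring.
by rewrite /ee mulrC cexp_natmul e cexp_2pi expr1n.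
Qed.

Lemma ee_addint (z : R[i]) (j : int) : ee (z + j%:~R) = ee z.
Proof.
case: j => n; first by rewrite eeD ee_nat mulr1.
rewrite NegzE mulrNz -pmulrn.
by have := eeD (z - n.+1%:R) n.+1%:R; rewrite subrK ee_nat mulr1 => ->.
Qed.

Lemma qpochP (x y : rat) (tau : R[i]) : 0 < Im tau -> 0 < x ->
  clim (qprod ((ratr x)%:C * tau + (ratr y)%:C) tau) (qpoch x y tau) /\ 0 < md (qpoch x y tau).
Proof.
move=> t0 x0.
have z0 : 0 < Im ((ratr x)%:C * tau + (ratr y)%:C).
  by rewrite ImD ImMr/= addr0 mulr_gt0// ltr0q.
have [P [L [hP _ hL]]] := qprod_cvg t0 z0.
suff -> : qpoch x y tau = P by split; [split | rewrite hL expR_gt0].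
rewrite /qpoch.
have E : qprod ((ratr x)%:C * tau + (ratr y)%:C) tau = fun N : nat => \prod_(k < N)
    (1 - cexp ((0 +i* (2 * pi)) * (ratr x * tau + ratr y)) * cexp ((0 +i* (2 * pi)) * (k%:R * tau))).
  apply/funext => N; rewrite /qprod big_mkord; apply: eq_bigr => k _.
  by rewrite eeD !ratrC.
by move: hP; rewrite E => /cvg_lim; apply; exact: norm_hausdorff.
Qed.

Lemma qprod_shift (z z' tau tau' : R[i]) (i j : int) N :
  z' = z + i%:~R -> tau' = tau + j%:~R -> qprod z' tau' N = qprod z tau N.
Proof.
move=> -> ->; apply: eq_bigr => k _; congr (1 - _).
have -> : z + i%:~R + k%:R * (tau + j%:~R) = z + k%:R * tau + (i + k%:Z * j)%:~R.
  by rewrite rmorphD rmorphM/=; ring.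
by rewrite ee_addint.
Qed.

(* The inversion followed by the translation by [a] maps the pair [(x, y)] to
   [(1 - y, x + a y)] modulo integers. *)
Lemma modular_step (om : R) (tau tau' : nat -> R[i]) (x y x' y' : rat) (a j : int) :
  0 < om -> clim tau om%:C -> (forall n, 0 < Im (tau n)) -> (forall n, 0 < Re (tau n)) ->
  (forall n, tau' n = a%:~R - (tau n)^-1) ->
  0 < x <= 1 -> 0 <= y < 1 -> x' = 1 - y -> x + a%:~R * y = y' + j%:~R ->
  exists D, double_sine om (ratr x * om + ratr y) = D%:C /\
    (fun n => md (qpoch x y (tau n)) / md (qpoch x' y' (tau' n))) @ \oo --> D.
Proof.
move=> om0 ct it rt ht /andP[x0 x1] /andP[y0 y1] hx' hy'.
have X0 : 0 < ratr x :> R by rewrite ltr0q.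
have X1 : ratr x <= 1 :> R by rewrite -(rmorph1 (ratr : rat -> R)) ler_rat.
have Y0 : 0 <= ratr y :> R by rewrite ler0q.
have Y1 : ratr y < 1 :> R by rewrite -(rmorph1 (ratr : rat -> R)) ltr_rat.
have x'0 : 0 < x' by rewrite hx' subr_gt0.
pose w : R := (ratr x - 2^-1) * om + (ratr y - 2^-1).
have zE : ratr x * om + ratr y = (1 + om) / 2 + w by rewrite /w; field.
have z'E : (1 + om) / 2 - w = (1 - ratr x) * om + (1 - ratr y) by rewrite /w; field.
have z0 : 0 < (1 + om) / 2 + w by rewrite -zE ltr_wpDr// mulr_gt0.
have z'0 : 0 < (1 + om) / 2 - w.
  by rewrite z'E ltr_wpDl ?subr_gt0// mulr_ge0 ?subr_ge0// ltW.
have [S [hS hD]] := double_sineE om0 z0 z'0.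
exists (expR S); split; first by rewrite zE.
have aC : a%:~R = (a%:~R : R)%:C :> R[i] by rewrite intrC.
have it' n : 0 < Im (tau' n) by rewrite ht ImD aC/= add0r; exact: Im_Nv.
pose P n := qpoch x y (tau n); pose P' n := qpoch x' y' (tau' n).
have [hP mP] : (forall n, clim (qprod ((ratr x)%:C * tau n + (ratr y)%:C) (tau n)) (P n)) /\
    forall n, 0 < md (P n) by split=> n; have [] := qpochP y (it n) x0.
have [hP' mP'] : (forall n, clim (qprod ((ratr x)%:C + (ratr y - 1)%:C / tau n) (- (tau n)^-1)) (P' n)) /\
    forall n, 0 < md (P' n).
  split=> n; have [H h0] := qpochP y' (it' n) x'0; last by [].
  apply: clim_ext H _ => N; apply/esym.
  (* Here [x' tau' + y' = x + (y - 1) / tau + (a - j)], and [tau' = - 1 / tau + a]. *)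
  apply: (@qprod_shift _ _ _ _ (j - a) (- a)).
    have e : (ratr y' : R) = ratr x + a%:~R * ratr y - j%:~R.
      have -> : y' = x + a%:~R * y - j%:~R by rewrite hy' addrK.
      by rewrite rmorphB rmorphD rmorphM/= !ratr_int.
    have e1 : (ratr x' : R) = 1 - ratr y by rewrite hx' rmorphB rmorph1.
    have tn : tau n != 0 by exact: tau_neq0.
    rewrite e e1 ht; move: (ratr x : R) (ratr y : R) => X Y.
    rewrite !(rmorphB, rmorphD, rmorphM, rmorphN, rmorph1)/= -!intrC.
    by field.
  by rewrite ht rmorphN/=; ring.
have hS' : (fun N => Re (Psi om%:C (shifted_pt (ratr x) (ratr y) om%:C) N -
    Psi om%:C (- shifted_pt (ratr x) (ratr y) om%:C) N)) @ \oo --> S.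
  suff -> : shifted_pt (ratr x) (ratr y) om%:C = w%:C by [].
  by rewrite /shifted_pt /w !(rmorphD, rmorphM).
have H := theta_limit ct om0 it rt X0 X1 Y0 Y1 (fun n => climP (hP n)) (fun n => climP (hP' n)) hS'.
have H2 : (fun n => expR (ln (md (P n)) - ln (md (P' n)))) @ \oo --> expR S.
  by apply: continuous_cvg => //; exact: continuous_expR.
apply: (cvg_eqfun H2 _ erefl) => n.
by rewrite expRB !lnK ?posrE.
Qed.

End Bridge.

(** * Arithmetic of the quadratic order *)

Section Arith.
Context {R : realType}.

Lemma rat_sqr_nat (t : rat) (d : nat) : t ^+ 2 = d%:R -> exists m : nat, d = (m ^ 2)%N.
Proof.
move=> h.
have dn0 : (denq t)%:~R != 0 :> rat by rewrite intr_eq0 denq_eq0.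
have E : (numq t) ^+ 2 = d%:Z * (denq t) ^+ 2.
  apply: (@intr_inj rat); rewrite [LHS]rmorphXn [RHS]rmorphM rmorphXn/= -[(d%:Z)%:~R]/(d%:R) -h.
  by rewrite -{2}(divq_num_den t); field.
have E2 : (`|numq t| ^ 2 = d * `|denq t| ^ 2)%N.
  by have := congr1 absz E; rewrite abszM !abszX absz_nat.
have m1 : `|denq t|%N = 1%N.
  have h1 : (`|denq t| %| `|numq t| ^ 2)%N by rewrite E2 expnS mulnA dvdn_mulr// dvdn_mull// mulnC dvdn_mull.
  have h2 : coprime `|denq t| (`|numq t| ^ 2) by rewrite coprimeXr// coprime_sym coprime_num_den.
  by move: h2; rewrite /coprime (gcdn_idPl h1) => /eqP.
by exists `|numq t|%N; rewrite E2 m1 exp1n muln1.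
Qed.

Lemma int_abs_lt1 (i : int) : -1 < i -> i < 1 -> i = 0.
Proof. lia. Qed.

Context (d a b : nat).
Context (d_gt1 : (1 < d)%N) (d_sqfree : squarefree d).
Let s : R := Num.sqrt d%:R.
Let eps : R := unit_eps R d a b.
Context (eps_fund : mul_generates eps (totpos_units d)).
Context (eps_basis : quad_integers d =
  [set m%:~R + n%:~R * eps | m in [set: int] & n in [set: int]]).

Lemma sqr_s : s ^+ 2 = d%:R. Proof. by rewrite sqr_sqrtr. Qed.

Lemma sqrt_free (p q : rat) : ratr p + ratr q * s = 0 -> p = 0 /\ q = 0.
Proof.
move=> h; have [q0|q0] := eqVneq q 0.
  by move: h; rewrite q0 rmorph0 mul0r addr0 => /eqP; rewrite fmorph_eq0 => /eqP->.
exfalso.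
have q0' : ratr q != 0 :> R by rewrite fmorph_eq0.
have e : ratr q * s = - ratr p by apply/eqP; rewrite -subr_eq0 opprK addrC h.
have hs : s = ratr (- p / q).
  have -> : ratr (- p / q) = - ratr p / ratr q :> R by rewrite rmorphM fmorphV rmorphN.
  by rewrite -e mulrAC mulfV ?mul1r.
have : (- p / q) ^+ 2 = d%:R.
  by apply: (fmorph_inj (ratr : rat -> R)); rewrite rmorphXn/= -hs sqr_s rmorph_nat.
move=> /rat_sqr_nat [m hm].
have : m = 1%N by apply: d_sqfree; rewrite hm.
by move=> m1; move: d_gt1; rewrite hm m1.
Qed.

Lemma epsE : eps = ratr (a%:R / 2) + ratr (b%:R / 2) * s.
Proof. by rewrite !(rmorphM, fmorphV, rmorph_nat)/= /eps /unit_eps -/s; field. Qed.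

Lemma eps_totpos (n : int) : totpos_units d (eps ^ n).
Proof. by rewrite eps_fund; exists n. Qed.

Lemma eps_int (n : int) : quad_integers d (eps ^ n).
Proof. by have [] := eps_totpos n. Qed.

Lemma quad_intP x : quad_integers d x <-> exists m n : int, x = m%:~R + n%:~R * eps.
Proof.
rewrite eps_basis; split; first by move=> [m _ [n _ <-]]; exists m, n.
by move=> [m [n ->]]; exists m => //; exists n.
Qed.

Lemma sqrt_int : quad_integers d s.
Proof.
split; first by exists 0, 1; rewrite /quad rmorph0 rmorph1 add0r mul1r.
exists ('X^2 - (d%:Z)%:P); first exact: monicXnsubC.
by rewrite rootE rmorphB/= map_polyXn map_polyC/= !hornerE sqr_s subrr.
Qed.

(** Otherwise [eps] would be rational, although [Z + Z eps] contains [sqrt d]. *)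
Lemma b_gt0 : (0 < b)%N.
Proof.
rewrite lt0n; apply/negP => /eqP b0.
have /quad_intP[m [n h]] := sqrt_int.
have H : ratr (m%:~R + n%:~R * (a%:R / 2)) + ratr (- 1) * s = 0.
  rewrite rmorphN rmorph1 mulN1r [s in - s]h epsE b0 mul0r rmorph0 mul0r addr0.
  by rewrite rmorphD rmorphM/= !ratr_int; ring.
by have [_ /eqP] := sqrt_free H; rewrite oppr_eq0 oner_eq0.
Qed.

Let b2 : (b%:R / 2 : rat) != 0.
Proof. by rewrite mulf_neq0// pnatr_eq0 -lt0n b_gt0. Qed.

Lemma eps_free (p q : rat) : ratr p + ratr q * eps = 0 -> p = 0 /\ q = 0.
Proof.
move=> h; have [h1 /eqP h2] : p + q * (a%:R / 2) = 0 /\ q * (b%:R / 2) = 0.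
  by apply: sqrt_free; rewrite -h epsE !(rmorphD, rmorphM)/=; ring.
move: h2; rewrite mulf_eq0 (negPf b2) orbF => /eqP q0.
by move: h1; rewrite q0 mul0r addr0.
Qed.

Lemma eps_coords (p q p' q' : rat) : ratr p + ratr q * eps = ratr p' + ratr q' * eps ->
  p = p' /\ q = q'.
Proof.
move=> h; have [h1 h2] : p - p' = 0 /\ q - q' = 0.
  apply: eps_free; rewrite !rmorphB/=.
  have -> : ratr p - ratr p' + (ratr q - ratr q') * eps =
    (ratr p + ratr q * eps) - (ratr p' + ratr q' * eps) by ring.
  by rewrite h subrr.
by split; apply/eqP; rewrite -subr_eq0 ?h1 ?h2.
Qed.

Let N : rat := (a%:R ^+ 2 - d%:R * b%:R ^+ 2) / 4.

Lemma eps_sqrN : eps ^+ 2 = a%:R * eps - ratr N.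
Proof.
rewrite /N !(rmorphM, rmorphB, rmorphXn, fmorphV, rmorph_nat)/= -sqr_s.
by rewrite /eps /unit_eps -/s; field.
Qed.

Lemma eps_gt0 : 0 < eps.
Proof. by have := eps_totpos 1; rewrite expr1z => -[_ _ [p [q [-> h _]]]]. Qed.

Let eps0 : eps != 0. Proof. by rewrite gt_eqF// eps_gt0. Qed.

(** Total positivity makes the norm positive; expressing [eps ^+ 2] and [eps^-1] in the basis
    [1, eps] makes it an integer with integral inverse. *)
Lemma N_eq1 : N = 1.
Proof.
have N0 : 0 < N.
  have := eps_totpos 1; rewrite expr1z => -[_ _ [p [q [h1 h2 h3]]]].
  have [hp hq] : p - a%:R / 2 = 0 /\ q - b%:R / 2 = 0.
    apply: sqrt_free; rewrite !rmorphB/=.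
    have -> : ratr p - ratr (a%:R / 2) + (ratr q - ratr (b%:R / 2)) * s =
      quad R d p q - (ratr (a%:R / 2) + ratr (b%:R / 2) * s) by rewrite /quad -/s; ring.
    by rewrite -h1 -epsE subrr.
  have {}hp : p = a%:R / 2 by apply/eqP; rewrite -subr_eq0 hp.
  have {}hq : q = b%:R / 2 by apply/eqP; rewrite -subr_eq0 hq.
  rewrite -(ltr0q R); have := mulr_gt0 h2 h3; congr (0 < _).
  rewrite /quad -/s rmorphN/=.
  have -> : (ratr p + ratr q * s) * (ratr p + - ratr q * s) = ratr p ^+ 2 - ratr q ^+ 2 * s ^+ 2 by ring.
  rewrite sqr_s hp hq /N !(rmorphM, rmorphB, rmorphXn, fmorphV, rmorph_nat)/=; by field.
have /quad_intP[m [n h]] := eps_int 2; have /quad_intP[m' [n' h']] := eps_int (-1).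
have h2 : eps ^+ 2 = ratr m%:~R + ratr n%:~R * eps by rewrite !ratr_int -h.
have [e1 _] : - N = m%:~R /\ (a%:R : rat) = n%:~R.
  by apply: eps_coords; rewrite -h2 eps_sqrN rmorphN rmorph_nat/=; ring.
have h3 : 1 = (m'%:~R + n'%:~R * eps) * eps by rewrite -h' -{2}(expr1z eps) -expfzDr// addNr expr0z.
have [e2 _] : (1 : rat) = - (n'%:~R * N) /\ (0 : rat) = m'%:~R + n'%:~R * a%:R.
  apply: eps_coords; rewrite rmorph0 rmorph1 mul0r addr0 {1}h3.
  have -> : (m'%:~R + n'%:~R * eps) * eps = m'%:~R * eps + n'%:~R * eps ^+ 2 by ring.
  rewrite eps_sqrN !(rmorphN, rmorphM, rmorphD)/= !ratr_int rmorph_nat; ring.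
have NE : N = (- m)%:~R by rewrite rmorphN/= -e1 opprK.
have e3 : n' * m = 1.
  by apply: (@intr_inj rat); rewrite rmorphM/= -e1 mulrN -e2.
have m0 : 0 < - m by rewrite -(ltr0z rat) -NE.
have := congr1 absz e3; rewrite abszM => /eqP; rewrite muln_eq1 => /andP[_ /eqP hm].
by rewrite NE -(gtz0_abs m0) abszN hm.
Qed.

Lemma eps_sqr : eps ^+ 2 = a%:R * eps - 1.
Proof. by rewrite eps_sqrN N_eq1 rmorph1. Qed.

Lemma eps_inv : eps^-1 = a%:R - eps.
Proof. by apply: (mulfI eps0); rewrite mulfV// mulrBr -expr2 eps_sqr; ring. Qed.

Lemma eps_diff : eps - eps^-1 = b%:R * s.
Proof. by rewrite eps_inv /eps /unit_eps -/s; field. Qed.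

Lemma bs_gt0 : 0 < b%:R * s.
Proof. by rewrite mulr_gt0 ?ltr0n ?b_gt0// sqrtr_gt0 ltr0n (ltn_trans _ d_gt1). Qed.

Lemma eps_gt1 : 1 < eps.
Proof.
have h := bs_gt0; rewrite -eps_diff subr_gt0 in h.
rewrite ltNge; apply/negP => e1; move: h; apply/negP; rewrite -leNgt.
by apply: (le_trans e1); rewrite invf_ge1// eps_gt0.
Qed.

Lemma quad_int_add (x y : R) : quad_integers d x -> quad_integers d y -> quad_integers d (x + y).
Proof.
move=> /quad_intP[m [n ->]] /quad_intP[m' [n' ->]]; apply/quad_intP; exists (m + m'), (n + n').
by rewrite !rmorphD/=; ring.
Qed.

Lemma quad_int_mul (x y : R) : quad_integers d x -> quad_integers d y -> quad_integers d (x * y).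
Proof.
move=> /quad_intP[m [n ->]] /quad_intP[m' [n' ->]]; apply/quad_intP.
exists (m * m' - n * n'), (m * n' + n * m' + a%:Z * n * n').
rewrite !(rmorphD, rmorphB, rmorphM)/= -[(a%:Z)%:~R]/(a%:R).
have -> : (m%:~R + n%:~R * eps) * (m'%:~R + n'%:~R * eps) = m%:~R * m'%:~R +
  (m%:~R * n'%:~R + n%:~R * m'%:~R) * eps + n%:~R * n'%:~R * eps ^+ 2 by ring.
by rewrite eps_sqr; ring.
Qed.

Lemma quad_int_intr (m : int) : quad_integers d (m%:~R : R).
Proof. by apply/quad_intP; exists m, 0; rewrite mul0r addr0. Qed.

Lemma quad_int_opp (x : R) : quad_integers d x -> quad_integers d (- x).
Proof. by move=> h; rewrite -mulN1r; apply: quad_int_mul => //; exact: (quad_int_intr (-1)). Qed.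

Lemma quad_field_mul p q p' q' : exists p'' q'' : rat,
  (ratr p + ratr q * eps) * (ratr p' + ratr q' * eps) = ratr p'' + ratr q'' * eps.
Proof.
exists (p * p' - q * q'), (p * q' + q * p' + a%:R * q * q').
rewrite !(rmorphD, rmorphB, rmorphM)/= rmorph_nat.
have -> : (ratr p + ratr q * eps) * (ratr p' + ratr q' * eps) = ratr p * ratr p' +
  (ratr p * ratr q' + ratr q * ratr p') * eps + ratr q * ratr q' * eps ^+ 2 by ring.
by rewrite eps_sqr; ring.
Qed.

Context (beta : R).
Context (beta_int : quad_integers d beta) (beta_neq0 : beta != 0).

(* The norm of [beta], with [g] the conjugate of [beta]. *)
Lemma beta_norm : exists (M : int) (g : R), [/\ M != 0, quad_integers d g & beta * g = M%:~R].
Proof.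
have /quad_intP[m [n hb]] := beta_int.
exists (m ^+ 2 + m * n * a%:Z + n ^+ 2), (m%:~R + n%:~R * a%:R - n%:~R * eps).
have E : beta * (m%:~R + n%:~R * a%:R - n%:~R * eps) = (m ^+ 2 + m * n * a%:Z + n ^+ 2)%:~R.
  rewrite hb !(rmorphD, rmorphM, rmorphXn)/= -[(a%:Z)%:~R]/(a%:R).
  have -> : (m%:~R + n%:~R * eps) * (m%:~R + n%:~R * a%:R - n%:~R * eps) = m%:~R ^+ 2 +
    m%:~R * n%:~R * a%:R + n%:~R ^+ 2 * (a%:R * eps - eps ^+ 2) by ring.
  by rewrite eps_sqr; ring.
split=> //.
  rewrite -(intr_eq0 R) -E mulf_neq0//; apply/negP => /eqP h.
  have [h1 h2] : m%:~R + n%:~R * a%:R = 0 :> rat /\ - n%:~R = 0 :> rat.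
    by apply: eps_free; rewrite -h !(rmorphD, rmorphM, rmorphN)/= !ratr_int rmorph_nat; ring.
  have n0 : n = 0 by apply/eqP; rewrite -(intr_eq0 rat) -oppr_eq0 h2.
  move: h1; rewrite n0 mul0r addr0 => /eqP; rewrite intr_eq0 => /eqP m0.
  by move: beta_neq0; rewrite hb n0 m0 mul0r addr0 eqxx.
apply/quad_intP; exists (m + n * a%:Z), (- n).
by rewrite !(rmorphD, rmorphM, rmorphN)/=; ring.
Qed.

Let mu := beta^-1.

Lemma mu_quad : exists p q : rat, mu = ratr p + ratr q * eps.
Proof.
have [M [g [M0 /quad_intP[m [n hg]] hM]]] := beta_norm.
have M0' : M%:~R != 0 :> R by rewrite intr_eq0.
exists (m%:~R / M%:~R), (n%:~R / M%:~R).
rewrite !(rmorphM, fmorphV)/= !ratr_int; apply: (mulfI beta_neq0); rewrite mulfV//.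
have -> : beta * (m%:~R / M%:~R + n%:~R / M%:~R * eps) = beta * (m%:~R + n%:~R * eps) / M%:~R by ring.
by rewrite -hg hM mulfV.
Qed.

Lemma epsD (i j : int) : eps ^ (i + j) = eps ^ i * eps ^ j.
Proof. exact: expfzDr. Qed.

Lemma epsNV (i : int) : eps ^ i * eps ^ (- i) = 1.
Proof. by rewrite -epsD subrr. Qed.

Lemma pair_valE (k : int) (x y : R) :
  x * eps ^ (1 - k) + y * eps ^ (- k) = eps ^ (- k) * (x * eps + y).
Proof. by rewrite epsD expr1z; ring. Qed.

(** Multiplication by the unit [eps ^ k] turns the condition into [x eps + y] lying in
    [eps ^ k mu + Z + Z eps], so the coordinates are reduced modulo 1. *)
Lemma pair_exists k : exists p, is_shintani_pair d eps mu k p.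
Proof.
have [p0 [q0 hmu]] := mu_quad.
have /quad_intP[m [n hk]] := eps_int k.
have [p [q hpq]] := quad_field_mul m%:~R n%:~R p0 q0.
have E : eps ^ k * mu = ratr p + ratr q * eps by rewrite hk hmu -hpq !ratr_int.
(* Ceiling for the interval [0 < x <= 1], floor for [0 <= y < 1]. *)
exists (q - (Num.ceil q)%:~R + 1, p - (Num.floor p)%:~R); split => /=.
- have := ceil_itv q; rewrite rmorphB/= => /andP[h1 h2]; apply/andP; split; lra.
- have := floor_itv p; rewrite rmorphD/= => /andP[h1 h2]; apply/andP; split; lra.
exists (eps ^ (- k) * ((- Num.floor p)%:~R + (1 - Num.ceil q)%:~R * eps)).
  apply: quad_int_mul; first exact: eps_int.
  by apply/quad_intP; do 2 eexists.
rewrite pair_valE.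
have -> : mu = eps ^ (- k) * (eps ^ k * mu) by rewrite mulrA [_ * eps ^ k]mulrC epsNV mul1r.
rewrite E -mulrDr; congr (_ * _).
rewrite !(rmorphD, rmorphN, rmorph1)/= !ratr_int; ring.
Qed.

Lemma pair_uniq k p p' : is_shintani_pair d eps mu k p -> is_shintani_pair d eps mu k p' -> p = p'.
Proof.
case: p p' => x y [x' y'] [/= /andP[x0 x1] /andP[y0 y1] [z hz ez]] [/= /andP[x0' x1'] /andP[y0' y1'] [z' hz' ez']].
have /quad_intP[m [n hmn]] : quad_integers d (eps ^ k * (z - z')).
  by apply: quad_int_mul; [exact: eps_int | apply: quad_int_add => //; exact: quad_int_opp].
have [h1 h2] : y - y' = m%:~R /\ x - x' = n%:~R.
  apply: eps_coords; rewrite !rmorphB/= !ratr_int -hmn.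
  have -> : z - z' = (mu + z) - (mu + z') by ring.
  rewrite ez ez' !pair_valE -mulrBr [RHS]mulrA epsNV mul1r; ring.
have small (t : rat) (i : int) : t = i%:~R -> -1 < t < 1 -> t = 0.
  move=> -> /andP[]; rewrite -[-1]/((-1)%:~R) -[1]/(1%:~R) !ltr_int => i1 i2.
  by rewrite (int_abs_lt1 i1 i2).
congr (_, _); apply/eqP; rewrite -subr_eq0; apply/eqP.
- by apply: (small _ _ h2); apply/andP; split; lra.
- by apply: (small _ _ h1); apply/andP; split; lra.
Qed.

Lemma pairP k : is_shintani_pair d eps mu k (shintani_pair d eps mu k).
Proof. by have [p hp] := pair_exists k; apply: (xgetPex _ (ex_intro _ p hp)). Qed.

Lemma pairE k p : is_shintani_pair d eps mu k p -> shintani_pair d eps mu k = p.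
Proof. exact: pair_uniq (pairP k). Qed.

(** Lowering the index multiplies by [eps^-1 = a - eps], and
    [(x eps + y)(a - eps) = (x + a y) - y eps]. As [y] runs through [[0, 1[], [1 - y] runs through
    []0, 1]]. *)
Lemma pair_step (k : int) : let p := shintani_pair d eps mu (k + 1) in
  let p' := shintani_pair d eps mu k in
  p'.1 = 1 - p.2 /\ exists j : int, p.1 + a%:R * p.2 = p'.2 + j%:~R.
Proof.
have := pairP (k + 1); case: (shintani_pair d eps mu (k + 1)) => x y /=.
move=> [/= /andP[x0 x1] /andP[y0 y1] [z hz ez]].
pose r := x + a%:R * y.
rewrite (@pairE k (1 - y, r - (Num.floor r)%:~R)).
  by split=> //=; exists (Num.floor r); rewrite subrK.
split => /=.
- by apply/andP; split; lra.
- have := floor_itv r; rewrite rmorphD/= => /andP[h1 h2]; apply/andP; split; lra.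
exists (z + eps ^ (- k) * ((- Num.floor r)%:~R + 1%:~R * eps)).
  apply: quad_int_add => //; apply: quad_int_mul; first exact: eps_int.
  by apply/quad_intP; do 2 eexists.
rewrite addrA ez !pair_valE opprD epsD /r.
have -> : eps ^ (- 1) = a%:R - eps by rewrite -eps_inv.
rewrite !(rmorphD, rmorphN, rmorphM, rmorph1)/= !ratr_int rmorph_nat.
have -> : eps ^ (- k) * (a%:R - eps) * (ratr x * eps + ratr y) =
  eps ^ (- k) * (ratr x * (a%:R * eps - eps ^+ 2) + (a%:R - eps) * ratr y) by ring.
by rewrite eps_sqr; ring.
Qed.

(** The exponents [n] with [eps ^ n] congruent to 1 modulo [beta]; they form a subgroup. *)
Definition unit_pow (n : int) := exists2 z, quad_integers d z & eps ^ n - 1 = beta * z.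

(** Since [(eps ^ g - 1) mu] is an integer of the field, [eps ^ (k + g) mu] and [eps ^ k mu] have
    the same class. *)
Lemma pair_period k (g : int) : unit_pow g ->
  shintani_pair d eps mu (k + g) = shintani_pair d eps mu k.
Proof.
move=> [t ht et]; apply: pairE.
have [h1 h2 [z hz ez]] := pairP k; split => //.
move: ez; set p := shintani_pair _ _ _ _; rewrite pair_valE => ez.
have /quad_intP[m [n hm]] := ht.
exists (eps ^ (- g) * (z - t)).
  by apply: quad_int_mul; [exact: eps_int | apply: quad_int_add => //; exact: quad_int_opp].
rewrite pair_valE opprD epsD.
have -> : eps ^ (- k) * eps ^ (- g) * (ratr p.1 * eps + ratr p.2) =
   eps ^ (- g) * (eps ^ (- k) * (ratr p.1 * eps + ratr p.2)) by ring.
rewrite -ez.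
have hg : eps ^ g = 1 + beta * t by rewrite -et addrC subrK.
have e : t = mu * (eps ^ g - 1) by rewrite et mulrA mulVf ?mul1r.
have e2 : eps ^ (- g) * t = mu - eps ^ (- g) * mu.
  by rewrite e mulrCA mulrBr [eps ^ (- g) * eps ^ g]mulrC epsNV mulr1 mulrBr mulr1 [mu * _]mulrC.
by rewrite mulrBr e2 mulrDr; ring.
Qed.

Lemma unit_pow_add i j : unit_pow i -> unit_pow j -> unit_pow (i + j).
Proof.
move=> [z hz ez] [t ht et]; exists (eps ^ i * t + z).
  by apply: quad_int_add => //; apply: quad_int_mul => //; exact: eps_int.
rewrite mulrDr -ez mulrCA -et epsD; ring.
Qed.

Lemma unit_pow_opp i : unit_pow i -> unit_pow (- i).
Proof.
move=> [z hz ez]; exists (- (eps ^ (- i) * z)).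
  by apply: quad_int_opp; apply: quad_int_mul => //; exact: eps_int.
rewrite mulrN mulrCA -ez mulrBr mulr1 [_ * eps ^ i]mulrC epsNV; ring.
Qed.

(** Pigeonhole: among [M^2 + 1] powers of [eps] two have the same coordinates modulo the norm [M] of
    [beta], so [M], and with it [beta], divides their difference. *)
Lemma unit_pow_exists : exists n : nat, (0 < n)%N /\ unit_pow n.
Proof.
have [M [g [M0 hg hM]]] := beta_norm.
have [A hA] := choice (fun i : nat => (quad_intP (eps ^ i%:Z)).1 (eps_int i)).
have [B hB] := choice hA.
have [K hK] : exists K, `|M|%N = K.+1 by exists (`|M|%N).-1; rewrite prednK// absz_gt0.
pose red (x : int) : 'I_K.+1 := inord `|(x %% M)%Z|.
have redE x : nat_of_ord (red x) = `|(x %% M)%Z|%N.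
  rewrite inordK// -hK -ltz_nat gez0_abs ?modz_ge0// abszE; exact: ltz_mod.
have redP x y : red x = red y -> exists q, x - y = M * q.
  move=> /(congr1 (@nat_of_ord _)); rewrite !redE => h.
  have {}h : (x %% M)%Z = (y %% M)%Z.
    by rewrite -[LHS]gez0_abs ?modz_ge0// -[RHS]gez0_abs ?modz_ge0// h.
  exists ((x %/ M)%Z - (y %/ M)%Z).
  by rewrite {1}(divz_eq x M) {1}(divz_eq y M) h; ring.
pose L := (K.+1 * K.+1)%N.
pose f (i : 'I_L.+1) := (red (A i), red (B i)).
have [i [j [ij fij]]] : exists i j : 'I_L.+1, (i < j)%N /\ f i = f j.
  have ninj : ~ injective f.
    by move=> /leq_card; rewrite card_prod !card_ord ltnn.
  have [i hi] : exists i, ~ forall j, f i = f j -> i = j.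
    by apply: contrapT => h; apply: ninj => i j; apply: contrapT => hij; apply: h; exists i => /(_ j).
  have [j hj] : exists j, ~ (f i = f j -> i = j).
    by apply: contrapT => h; apply: hi => j; apply: contrapT => hij; apply: h; exists j.
  have fe : f i = f j by apply: contrapT => h; apply: hj => /h.
  have : (i : nat) <> j by move=> h; apply: hj => _; exact: val_inj.
  move=> /eqP; rewrite neq_ltn => /orP[h|h]; first by exists i, j.
  by exists j, i.
exists (j - i)%N; split; first by rewrite subn_gt0.
have [[q1 h1] [q2 h2]] : (exists q, A j - A i = M * q) /\ exists q, B j - B i = M * q.
  by case: fij => h1 h2; split; apply: redP.
exists (eps ^ (- i%:Z) * (g * (q1%:~R + q2%:~R * eps))).
  apply: quad_int_mul; first exact: eps_int.
  by apply: quad_int_mul => //; apply/quad_intP; do 2 eexists.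
rewrite mulrCA [beta * _]mulrA hM.
have -> : M%:~R * (q1%:~R + q2%:~R * eps) = eps ^ j%:Z - eps ^ i%:Z.
  have -> : eps ^ j%:Z - eps ^ i%:Z = (A j - A i)%:~R + (B j - B i)%:~R * eps.
    by rewrite !hB !rmorphB/=; ring.
  by rewrite h1 h2 !rmorphM/=; ring.
rewrite mulrBr -!epsD addNr expr0z -subzn ?(ltnW ij)// [- _ + _]addrC.
by [].
Qed.

(** The subgroup of exponents is generated by its least positive element, by division with
    remainder. *)
Lemma unit_index_exists : exists g, is_unit_index d eps (principal_ideal d beta) g.
Proof.
have [n [n0 hn]] := unit_pow_exists.
pose P (n : nat) := (0 < n)%N && `[< unit_pow n >].
have exP : exists n, P n by exists n; rewrite /P n0; exact/asboolP.
case: (ex_minnP exP) => g /andP[g0 /asboolP hg] gmin.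
have mem (m : int) : congr1_units d (principal_ideal d beta) (eps ^ m) <-> unit_pow m.
  split.
    by move=> [_ [_ [z hz <-] e]]; exists z => //; rewrite -e addrC addKr.
  move=> [z hz e]; split; first exact: eps_totpos.
  by exists (beta * z); [exists z | rewrite -e addrC subrK].
have mulg (m : int) : unit_pow (g%:Z * m).
  have nat_case (k : nat) : unit_pow (g%:Z * k%:Z).
    elim: k => [|k IH]; first by rewrite mulr0; exists 0; [exact: (quad_int_intr 0) | rewrite expr0z subrr mulr0].
    by rewrite intS mulrDr mulr1; exact: unit_pow_add.
  by case: m => k; [| rewrite NegzE mulrN; apply: unit_pow_opp].
exists g; split=> //.
  apply/seteqP; split => x.
    move=> [hx hc].
    have : range (fun n : int => eps ^ n) x by rewrite -[range _]eps_fund.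
    move=> [m _ e]; have hm : unit_pow m by apply/mem; rewrite e; split.
    have hr : unit_pow (m %% g)%Z.
      have -> : (m %% g)%Z = m + - (g%:Z * (m %/ g)%Z) by rewrite {2}(divz_eq m g); ring.
      by apply: unit_pow_add => //; apply: unit_pow_opp.
    have gz : g%:Z != 0 by rewrite -lt0n.
    have r0 : (m %% g)%Z = 0.
      have rn : (m %% g)%Z = `|(m %% g)%Z|%N by rewrite gez0_abs ?modz_ge0.
      apply/eqP; rewrite rn; apply/eqP; congr Posz; apply/eqP; rewrite -leqn0 leqNgt; apply/negP => h.
      have := gmin `|(m %% g)%Z|%N; rewrite /P h /= => /(_ _).
      rewrite leqNgt -ltz_nat -rn ltz_mod//= => h2.
      have : false by apply: h2; apply/asboolP.
      by [].
    exists (m %/ g)%Z => //; rewrite -e {2}(divz_eq m g) r0 addr0 mulrC.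
    by rewrite exprnP exprz_exp.
  by move=> [m _ <-]; rewrite exprnP exprz_exp; apply/mem.
move=> h h0 hgen; apply: gmin; rewrite /P h0; apply/asboolP.
apply/mem; rewrite -exprnP hgen.
by exists 1; rewrite ?expr1z.
Qed.

End Arith.

(** * The sequence tau *)

Section Tau.
Context {R : realType} (d a b : nat).
Let eps : R := unit_eps R d a b.
Let s : R := b%:R * Num.sqrt d%:R.
Context (eps_gt1 : 1 < eps) (eps_inv : eps^-1 = a%:R - eps) (eps_diff : eps - eps^-1 = s).

Let eps_gt0 : 0 < eps. Proof. exact: lt_trans ltr01 eps_gt1. Qed.
Let eps0 : eps != 0. Proof. by rewrite gt_eqF. Qed.
Let s_gt0 : 0 < s.
Proof. by rewrite -eps_diff subr_gt0 (lt_trans _ eps_gt1)// invf_lt1. Qed.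

Definition trace_pow (n : int) : R := eps ^ n + eps ^ (- n).

Lemma trace_pow_gt0 n : 0 < trace_pow n.
Proof. by rewrite addr_gt0// exprz_gt0. Qed.

Lemma chebT_trace_pow n : ((chebT n).[a%:Z])%:~R = trace_pow n.
Proof.
have := chebTE n eps0; rewrite -/(trace_pow n).
have -> : eps + eps^-1 = (a%:Z)%:~R by rewrite eps_inv -pmulrn; ring.
by rewrite horner_map.
Qed.

Lemma tau_seqE n : tau_seq R d a b n = (trace_pow (n + 1) / trace_pow n) +i* (s / trace_pow n).
Proof.
rewrite /tau_seq !intrC !chebT_trace_pow -fmorphV mulrC.
by apply: eqC; rewrite (ReMr, ImMr)/= mulrC ?addr0 ?add0r.
Qed.

Lemma tau_seq_Im n : 0 < Im (tau_seq R d a b n).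
Proof. by rewrite tau_seqE/= divr_gt0// trace_pow_gt0. Qed.

Lemma tau_seq_Re n : 0 < Re (tau_seq R d a b n).
Proof. by rewrite tau_seqE/= divr_gt0 ?trace_pow_gt0. Qed.

Lemma trace_powS n : trace_pow (n + 1) = eps * eps ^ n + eps^-1 * eps ^ (- n).
Proof. by rewrite /trace_pow opprD !expfzDr// expr1z -exprN1 mulrC [eps ^ (- n) * _]mulrC. Qed.

Lemma trace_pow_rec n : trace_pow (n + 2) = a%:R * trace_pow (n + 1) - trace_pow n.
Proof.
have -> : n + 2 = n + 1 + 1 by ring.
rewrite !trace_powS expfzDr// expr1z opprD expfzDr// exprN1.
have -> : a%:R = eps + eps^-1 by rewrite eps_inv; ring.
by rewrite /trace_pow; field.
Qed.

(** The left side is the square of the modulus of the numerator of [tau_n], so inverting [tau_n]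
    produces the denominator of [tau_{n+2}]. *)
Lemma trace_pow_mul n : trace_pow (n + 1) ^+ 2 + s ^+ 2 = trace_pow (n + 2) * trace_pow n.
Proof.
have -> : n + 2 = n + 1 + 1 by ring.
rewrite !trace_powS expfzDr// expr1z opprD expfzDr// exprN1 -eps_diff /trace_pow -invr_expz.
by have := expfz_neq0 n eps0; move: (eps ^ n) => e e0; field; rewrite e0 eps0.
Qed.

Lemma tau_seq_rec n : tau_seq R d a b (n + 2) = a%:R - (tau_seq R d a b n)^-1.
Proof.
have E m : tau_seq R d a b m = ((trace_pow (m + 1))%:C + ci * s%:C) / (trace_pow m)%:C.
  rewrite tau_seqE -fmorphV [RHS]mulrC.
  by apply: eqC; rewrite (ReMr, ImMr) (ReD, ImD) (ReM, ImM)/=; ring.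
have e3 : n + 2 + 1 = n + 1 + 2 by ring.
rewrite !E e3 (trace_pow_rec (n + 1)).
have e2 : n + 1 + 1 = n + 2 by ring.
rewrite e2; have h := trace_pow_mul n.
have T0 : (trace_pow n)%:C != 0 :> R[i] by have := trace_pow_gt0 n; apply: contraTneq => -[->]; rewrite ltxx.
have V0 : (trace_pow (n + 2))%:C != 0 :> R[i] by have := trace_pow_gt0 (n + 2); apply: contraTneq => -[->]; rewrite ltxx.
have U0 : (trace_pow (n + 1))%:C + ci * s%:C != 0 :> R[i].
  have := s_gt0; apply: contraTneq => /(congr1 (@complex.Im R)).
  by rewrite ImD ImM/= mul0r mul1r !add0r => ->; rewrite ltxx.
have hC : (trace_pow (n + 1))%:C ^+ 2 + s%:C ^+ 2 = (trace_pow (n + 2))%:C * (trace_pow n)%:C :> R[i].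
  by rewrite -!rmorphXn -rmorphD h rmorphM.
rewrite rmorphB rmorphM rmorph_nat/= invf_div.
move: hC T0 V0 U0; move: (trace_pow n)%:C (trace_pow (n + 1))%:C (trace_pow (n + 2))%:C s%:C => T U V S hC T0 V0 U0.
apply: (mulIf V0); rewrite mulfVK// mulrBl; apply: (mulIf U0).
rewrite mulrBl [T / _ * V]mulrAC divfK// [T * V]mulrC -hC.
have -> : (a%:R * V - U + ci * S) * (U + ci * S) = a%:R * V * (U + ci * S) - U ^+ 2 + ci ^+ 2 * S ^+ 2.
  by ring.
by rewrite [ci ^+ 2]ci2; ring.
Qed.

Lemma trace_pow_ge1 m : 1 <= trace_pow m.
Proof.
have f0 : 0 < eps ^ (- m) by rewrite exprz_gt0.
have e0 : 0 < eps ^ m by rewrite exprz_gt0.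
have [h|h] := leP 1 (eps ^ m); first by rewrite /trace_pow -[1]addr0 lerD// ltW.
rewrite /trace_pow -[1]add0r lerD ?(ltW e0)// -invr_expz invf_ge1// ltW//.
Qed.

(** Common to the limits [eps], with [f = eps ^ (- m)], and [eps^-1], with [f = eps ^ m]; the real
    parts approach from opposite sides. *)
Lemma tau_seq_dist m (t f : R) : 0 < f -> (trace_pow m)^-1 <= f ->
  trace_pow (m + 1) / trace_pow m - t = - (s * (f / trace_pow m)) \/ trace_pow (m + 1) / trace_pow m - t = s * (f / trace_pow m) ->
  md (tau_seq R d a b m - t%:C) <= 2 * s * f.
Proof.
move=> f0 iv ht.
have t0 := trace_pow_gt0 m.
apply: (le_trans (ler_md_ReIm _)); rewrite tau_seqE ReD ImD ReN ImN/= oppr0 addr0.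
have iv0 : 0 <= (trace_pow m)^-1 by rewrite invr_ge0 ltW.
have s0 : 0 <= s by rewrite ltW.
have h1 : f / trace_pow m <= f.
  by rewrite ler_piMr ?(ltW f0)// invf_le1// trace_pow_ge1.
have -> : `|trace_pow (m + 1) / trace_pow m - t| = s * (f / trace_pow m).
  by case: ht => ->; rewrite ?normrN ger0_norm// !mulr_ge0// ltW.
rewrite ger0_norm ?mulr_ge0//.
have -> : 2 * s * f = s * f + s * f by ring.
by apply: lerD; rewrite ler_wpM2l.
Qed.

Lemma tau_seq_dist_pos m : md (tau_seq R d a b m - eps%:C) <= 2 * s * eps ^ (- m).
Proof.
have t0 := trace_pow_gt0 m; have f0 : 0 < eps ^ (- m) by rewrite exprz_gt0.
apply: tau_seq_dist => //.
  by rewrite -invr_expz lef_pV2 ?posrE ?exprz_gt0// /trace_pow lerDl ltW.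
left; rewrite trace_powS -eps_diff; rewrite /trace_pow in t0 *; field.
by rewrite eps0 gt_eqF.
Qed.

Lemma tau_seq_dist_neg m : md (tau_seq R d a b m - (eps^-1)%:C) <= 2 * s * eps ^ m.
Proof.
have t0 := trace_pow_gt0 m; have f0 : 0 < eps ^ m by rewrite exprz_gt0.
apply: tau_seq_dist => //.
  by rewrite -[leRHS]invrK invr_expz lef_pV2 ?posrE ?exprz_gt0// /trace_pow lerDr ltW.
right; rewrite trace_powS -eps_diff; rewrite /trace_pow in t0 *; field.
by rewrite eps0 gt_eqF.
Qed.

Lemma expz_decay (k : int) : (fun n : nat => 2 * s * eps ^ (k - n%:Z)) @ \oo --> (0 : R).
Proof.
have q1 : `|eps^-1| < 1 by rewrite ger0_norm ?invr_ge0 ?(ltW eps_gt0)// invf_lt1.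
apply: (cvg_eqfun (cvg_scale0 (2 * s * eps ^ k) (cvg_expr q1)) _ erefl) => n.
have e : eps^-1 ^+ n = eps ^ (- n%:Z) by rewrite exprVn -invr_expz.
by rewrite e -mulrA -expfzDr.
Qed.

Lemma tau_seq_pos (k : int) : clim (fun n : nat => tau_seq R d a b (n%:Z + k)) eps%:C.
Proof.
split; apply/ccvgP; apply: cvg0_squeeze (expz_decay (- k)) => n.
rewrite md_ge0/=; apply: (le_trans (tau_seq_dist_pos _)).
by rewrite opprD addrC.
Qed.

Lemma tau_seq_neg (k : int) : clim (fun n : nat => tau_seq R d a b (- n%:Z + k)) (eps^-1)%:C.
Proof.
split; apply/ccvgP; apply: cvg0_squeeze (expz_decay k) => n.
by rewrite md_ge0/=; apply: (le_trans (tau_seq_dist_neg _)); rewrite addrC.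
Qed.

End Tau.

(** * Telescoping and assembly *)

Lemma rcvgM (R : realType) (u v : nat -> R) (l m : R) : u @ \oo --> l ->
  v @ \oo --> m -> (fun n => u n * v n) @ \oo --> l * m.
Proof. by move=> hu hv; exact: cvgM. Qed.

Section Main.
Context {R : realType} (d a b : nat).
Let eps : R := unit_eps R d a b.
Context (d_gt1 : (1 < d)%N) (d_sqfree : squarefree d).
Context (eps_fund : mul_generates eps (totpos_units d)).
Context (eps_basis : quad_integers d =
  [set m%:~R + n%:~R * eps | m in [set: int] & n in [set: int]]).
Context (beta : R) (beta_int : quad_integers d beta) (beta_neq0 : beta != 0).

Let e1 : 1 < eps. Proof. exact: eps_gt1. Qed.
Let ei : eps^-1 = a%:R - eps. Proof. exact: eps_inv. Qed.
Let ed : eps - eps^-1 = b%:R * Num.sqrt d%:R. Proof. exact: eps_diff. Qed.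

Let pr k := shintani_pair d eps beta^-1 k.
Let tau := tau_seq R d a b.
Let F (k : nat) (t : R[i]) := md (qpoch (pr k%:Z).1 (pr k%:Z).2 t).

Let prP k : is_shintani_pair d eps beta^-1 k (pr k).
Proof. exact: pairP. Qed.

Lemma qpoch_pair_gt0 k n : 0 < F k (tau n).
Proof.
have [/andP[x0 _] _ _] := prP k%:Z.
by have [] := qpochP (pr k%:Z).2 (tau_seq_Im e1 ei ed n) x0.
Qed.

(* Telescoping along the orbit [tau, M tau, M^2 tau, ...] of
   [M t = a - 1 / t]. *)
Lemma orbit_limit (h : nat -> int) (om : R) : 0 < om ->
  (forall k, clim (fun n => tau (h n + k)) om%:C) -> forall m : nat,
  exists D : R, \prod_(1 <= k < m.+1)
      (let p := shintani_pair d eps beta^-1 k%:Z in double_sine om (ratr p.1 * om + ratr p.2)) = D%:C /\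
    forall c : int, (fun n => F m (tau (h n + c)) / F 0 (tau (h n + (c + m%:Z * 2)))) @ \oo --> D.
Proof.
move=> om0 hc; elim=> [|m [D [hD IH]]].
  exists 1; split=> [|c]; first by rewrite big_geq.
  apply: (cvg_eqfun (@cvg_cst _ (1 : R) _ _ _) _ erefl) => n.
  by rewrite mul0r addr0 divff// gt_eqF// qpoch_pair_gt0.
have [hx [j hy]] := pair_step d_gt1 d_sqfree eps_fund eps_basis beta_int beta_neq0 m%:Z.
have [p0 p1 _] := prP (m%:Z + 1).
have mS : m.+1%:Z = m%:Z + 1 by rewrite -addn1 PoszD.
have step (c : int) := @modular_step R om (fun n => tau (h n + c)) (fun n => tau (h n + c + 2)) _ _ _ _ a%:Z j
  om0 (hc c) (fun n => tau_seq_Im e1 ei ed _) (fun n => tau_seq_Re e1 ei _)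
  (fun n => tau_seq_rec e1 ei ed _) p0 p1 hx hy.
have [E [hE _]] := step 0.
exists (D * E); split=> [|c].
  by rewrite big_nat_recr//= hD mS hE -rmorphM.
have [E' [hE' cE]] := step c.
have EE : E' = E by have := hE'; rewrite hE => -[->].
have H := rcvgM cE (IH (c + 2)); rewrite EE in H; rewrite [D * E]mulrC.
apply: (cvg_eqfun H _ erefl) => n.
have -> : c + 2 + m%:Z * 2 = c + m.+1%:Z * 2 by rewrite mS; ring.
have -> : h n + (c + 2) = h n + c + 2 by ring.
have f0 := qpoch_pair_gt0 m (h n + c + 2); have f1 := qpoch_pair_gt0 0 (h n + (c + m.+1%:Z * 2)).
have cancel (x y z : R) : 0 < y -> x / y * (y / z) = x / z.
  by move=> y0; rewrite mulrA divfK// gt_eqF.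
by rewrite /F mS; apply: cancel; exact: f0.
Qed.

Let g := unit_index d eps (principal_ideal d beta).

Lemma unit_indexP : is_unit_index d eps (principal_ideal d beta) g.
Proof.
have [g' hg'] := unit_index_exists d_gt1 d_sqfree eps_fund eps_basis beta_int beta_neq0.
exact: (xgetPex _ (ex_intro _ _ hg')).
Qed.

Lemma unit_pow_g : unit_pow d a b beta g%:Z.
Proof.
have [_ hg _] := unit_indexP.
have [_ [_ [z hz <-] e]] : congr1_units d (principal_ideal d beta) (eps ^+ g).
  by rewrite hg; exists 1; rewrite ?expr1z.
by exists z => //; rewrite -/eps -exprnP -e addrC addKr.
Qed.

(** Starting at offset [- g], [g] steps of length 2 end at offset [g]; the final pair of index 0 is
    the pair of index [g] by periodicity. *)
Lemma half_limit (h : nat -> int) (om : R) : 0 < om ->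
  (forall k, clim (fun n => tau (h n + k)) om%:C) ->
  exists D : R, shintani_half d eps beta om = D%:C /\
    (fun n => F g (tau (h n - g%:Z)) / F g (tau (h n + g%:Z))) @ \oo --> D.
Proof.
move=> om0 hc; have [D [hD cD]] := orbit_limit om0 hc g.
exists D; split; first exact: hD.
apply: (cvg_eqfun (cD (- g%:Z)) _ erefl) => n.
have -> : - g%:Z + g%:Z * 2 = g%:Z by ring.
have e : pr g%:Z = pr 0.
  by have := pair_period d_gt1 d_sqfree eps_fund eps_basis beta_int beta_neq0 0 unit_pow_g; rewrite add0r.
by rewrite /F e.
Qed.

(** Around [n] the sequence [tau] tends to [eps] and yields the first half of the invariant; around
    [- n] it tends to [eps^-1] and yields the second. Both quotients involve the same pair. *)
Lemma shintani_X_limit : exists (x y : rat),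
  (fun n : nat =>
     `| qpoch x y (tau (n%:Z - g%:Z)) / qpoch x y (tau (n%:Z + g%:Z))
        * (qpoch x y (tau (- n%:Z - g%:Z)) / qpoch x y (tau (- n%:Z + g%:Z))) |
     : R[i]^o) @ \oo --> (shintani_X d eps beta : R[i]^o).
Proof.
exists (pr g%:Z).1, (pr g%:Z).2.
have ep : 0 < eps by exact: lt_trans ltr01 e1.
have ip : 0 < eps^-1 by rewrite invr_gt0.
have [D1 [h1 c1]] := half_limit ep (tau_seq_pos e1 ei ed).
have [D2 [h2 c2]] := half_limit ip (tau_seq_neg e1 ei ed).
rewrite /shintani_X h1 h2 -rmorphM.
apply: (cvg_eqfun (ccvg_real (rcvgM c1 c2)) _ erefl) => n.
by rewrite normc_md !mdM !mdV.
Qed.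

End Main.

Theorem theorem1p1 (R : realType) (d a b : nat) (u v : rat)
    (d_gt1 : (1 < d)%N) (d_sqfree : squarefree d)
    (eps_fund : mul_generates (unit_eps R d a b) (totpos_units d))
    (eps_basis : quad_integers d =
       [set m%:~R + n%:~R * unit_eps R d a b | m in [set: int] & n in [set: int]])
    (f_integral : quad_integers d (quad R d u v))
    (f_neq0 : quad R d u v != 0) :
  exists (g : nat) (x y : rat),
    is_unit_index d (unit_eps R d a b) (principal_ideal d (quad R d u v)) g /\
    (fun n : nat =>
       let tau (k : int) := tau_seq R d a b k in
       `| qpoch x y (tau (n%:Z - g%:Z)) / qpoch x y (tau (n%:Z + g%:Z))
          * (qpoch x y (tau (- n%:Z - g%:Z)) / qpoch x y (tau (- n%:Z + g%:Z))) |
       : R[i]^o) @ \oo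
    --> (shintani_X d (unit_eps R d a b) (quad R d u v) : R[i]^o).
Proof.
have [x [y hxy]] := shintani_X_limit d_gt1 d_sqfree eps_fund eps_basis f_integral f_neq0.
exists (unit_index d (unit_eps R d a b) (principal_ideal d (quad R d u v))), x, y.
split; last exact: hxy.
exact (unit_indexP d_gt1 d_sqfree eps_fund eps_basis f_integral f_neq0).
Qed.
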